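(* Let $\mathcal{T}$ be an SCI-space, $\mathcal{F}$ an SCI-subspace of $\mathcal{T}$, and $\mathcal{S}$ a subset of $\mathcal{T}$. Denote $\mathcal{N}=\mathcal{F}\cap\mathcal{S}$. Assume that there is a projection $\pi:\mathcal{T}\to\mathcal{F}$ (compatible with restriction and inclusion maps) such that for every $f$ in $\mathcal{T}_{k,\rho}$, the element $\zeta(f)=f-\pi(f)$ satisfies $$\|\zeta(f)\|_{k,\rho}\le\|f\|_{k,\rho}\,Poly(\|f\|_{[(k+1)/2],\rho})$$ for all $k\in\mathbb{N}$ (or at least for all $k$ sufficiently large), where $[\;]$ is the integer part. Let $\mathcal{G}$ be an SCI-group acting on $\mathcal{T}$ by a linear left SCI-action and let $\mathcal{G}^0$ be a closed subgroup of $\mathcal{G}$ formed by elements preserving $\mathcal{S}$. Let $\mathcal{H}$ be an SCI-space and assume that there exist maps $\mathrm{H}:\mathcal{S}\to\mathcal{H}$ and $\Phi:\mathcal{H}\to\mathcal{G}^0$ and an integer $s\in\mathbb{N}$ such that for every $0<\rho\le1$, every $f$ in $\mathcal{S}$ and all $g,g_1,g_2$ in $\mathcal{H}$, and for all $k$ in $\mathbb{N}$ (or at least for all $k$ sufficiently large), we have the three properties: $$\|\mathrm{H}(f)\|_{k,\rho}\le\|\zeta(f)\|_{k+s,\rho}\,Poly(\|f\|_{[(k+1)/2]+s,\rho})+\|f\|_{k+s,\rho}\,\|\zeta(f)\|_{[(k+1)/2]+s,\rho}\,Poly(\|f\|_{[(k+1)/2]+s,\rho}),$$ $$\|\Phi(g)-Id\|_{k,\rho'}\le\|g\|_{k+s,\rho}\,Poly(\|g\|_{[(k+1)/2]+s,\rho})\quad\text{if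 }\rho'\le\rho(1-c\|g\|_{2,\rho}),$$ and $$\|\Phi(g_1)\cdot f-\Phi(g_2)\cdot f\|_{k,\rho'}\le\|g_1-g_2\|_{k+s,\rho}\|f\|_{k+s,\rho}\,Poly(\|g_1\|_{k+s,\rho},\|g_2\|_{k+s,\rho})+\|f\|_{k+s,\rho}\,Poly_{(2)}(\|g_1\|_{k+s,\rho},\|g_2\|_{k+s,\rho})$$ if $\rho'\le\rho(1-c\|g_1\|_{2,\rho})$ and $\rho'\le\rho(1-c\|g_2\|_{2,\rho})$, where $c$ is a positive constant. Finally, for every $f$ in $\mathcal{S}$ denote $\phi_f=Id+\chi_f=\Phi(\mathrm{H}(f))\in\mathcal{G}^0$ and assume that there is a positive real number $\delta$ such that $$\|\zeta(\phi_f\cdot f)\|_{k,\rho'}\le\|\zeta(f)\|_{k+s,\rho}^{1+\delta}\,Q(\|f\|_{k+s,\rho},\|\chi_f\|_{k+s,\rho},\|\zeta(f)\|_{k+s,\rho},\|f\|_{k,\rho})\quad\text{if }\rho'\le\rho(1-c\|\chi_f\|_{1,\rho}),$$ where $Q$ is a polynomial of four variables with positive coefficients whose degree in the first variable does not depend on $k$. Let $0<R\le1$. Then there exist $l\in\mathbb{N}$ and two positive constants $\alpha$ and $\beta$ with the following property: for all $p\in\mathbb{N}\cup\{\infty\}$, $p\ge l$, and for all $f\in\mathcal{S}_{2p-1,R}$ with $\|f\|_{2l-1,R}<\alpha$ and $\|\zeta(f)\|_{l,R}<\beta$, there exists $\psi\in\mathcal{G}^0_{p,R/2}$ such that $\psi\cdot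 f\in\mathcal{N}_{p,R/2}$.
   Context: Polynomial notation. $Poly(\cdot)$ denotes a polynomial expression in its argument(s), with positive coefficients, which does not depend on the elements $f,g,\dots$ involved (it may depend on $k$, and continuously on the radius $\rho$). $Poly_{(p)}(\cdot)$ denotes such a polynomial containing only terms of degree $\ge p$. Different occurrences may denote different polynomials. SCI-spaces. An SCI-space $\mathcal{H}$ is a collection of Banach spaces $(\mathcal{H}_{k,\rho},\|\cdot\|_{k,\rho})$, $0<\rho\le1$, $k\in\mathbb{Z}_+=\{0,1,2,\dots\}$ ($\rho$ is the radius, $k$ the smoothness; $f\in\mathcal{H}$ means $f\in\mathcal{H}_{k,\rho}$ for some $k,\rho$), such that: (1) if $k<k'$ then $\mathcal{H}_{k',\rho}$ is a linear subspace of $\mathcal{H}_{k,\rho}$ for every $\rho$; (2) if $0<\rho'<\rho\le1$ then for each $k$ there is a given linear map (radius restriction) $\pi_{\rho,\rho'}:\mathcal{H}_{k,\rho}\to\mathcal{H}_{k,\rho'}$, not depending on $k$, with $\pi_{\rho,\rho''}=\pi_{\rho',\rho''}\circ\pi_{\rho,\rho'}$; the restriction of $f$ is still denoted $f$; (3) $\|f\|_{k,\rho}\ge\|f\|_{k',\rho'}$ for all $k\ge k'$, $\rho\ge\rho'$ (with $\|f\|_{k,\rho}=+\infty$ if $f\notin\mathcal{H}_{k,\rho}$); (4) for each $0<\rho\le1$ and $t>1$ there is a linear smoothing operator $S_\rho(t):\mathcal{H}_{0,\rho}\to\mathcal{H}_{\infty,\rho}=\bigcap_k\mathcal{H}_{k,\rho}$,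 depending continuously on $\rho$, such that for all $p\ge q$ in $\mathbb{Z}_+$: $\|S_\rho(t)f\|_{p,\rho}\le C_{\rho,p,q}t^{p-q}\|f\|_{q,\rho}$ and $\|f-S_\rho(t)f\|_{q,\rho}\le C_{\rho,p,q}t^{q-p}\|f\|_{p,\rho}$, where $C_{\rho,p,q}>0$ does not depend on $f,t$ and is continuous in $\rho$. An SCI-subspace of $\mathcal{H}$ is a collection of subspaces $\mathcal{V}_{k,\rho}\subset\mathcal{H}_{k,\rho}$ forming themselves an SCI-space under the induced norms, smoothing operators, inclusions and radius restrictions (these operators preserve $\mathcal{V}$). A subset of $\mathcal{H}$ is a collection of subsets $\mathcal{F}_{k,\rho}\subset\mathcal{H}_{k,\rho}$ invariant under the inclusion and radius restriction maps. SCI-groups. An SCI-group $\mathcal{G}$ modelled on an SCI-space $\mathcal{W}$ consists of elements written as formal sums $\phi=Id+\chi$, $\chi\in\mathcal{W}$; $\phi\in\mathcal{G}_{k,\rho}$ means $\chi\in\mathcal{W}_{k,\rho}$, one writes $\chi=\phi-Id$, and $Id=Id+0$ is the neutral element. It carries the following scaled laws with a constant $c>0$ independent of $\rho,k$. Composition: if $0<\rho'<\rho\le1$, $k\ge1$, $\phi=Id+\chi$, $\psi=Id+\xi\in\mathcal{G}_{k,\rho}$ and $\rho'/\rho\le1-c\|\xi\|_{1,\rho}$, then $\phi\circ\psi\in\mathcal{G}_{k,\rho'}$ is defined (compatibly with restriction); composition is associative after appropriate restrictions of radii. Inversion: if $\phi\in\mathcal{G}_{k,\rho}$ and $\|\phi-Id\|_{1,\rho}<1/c$,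 then $\phi^{-1}\in\mathcal{G}_{k,\rho'}$ is defined with $\rho'=(1-\frac12c\|\phi-Id\|_{1,\rho})\rho$, and $\phi\circ\phi^{-1}$, $\phi^{-1}\circ\phi$ are well-defined and equal to $Id$ in radius $(1-c\|\phi-Id\|_{1,\rho})\rho$. Continuity conditions: (i) for each $k\ge1$ there is a polynomial $P$ such that for all $\chi\in\mathcal{W}_{2k-1,\rho}$ with $\|\chi\|_{1,\rho}<1/c$, $\|(Id+\chi)^{-1}-Id\|_{k,\rho'}\le\|\chi\|_{k,\rho}P(\|\chi\|_{k,\rho})$ with $\rho'=(1-c\|\chi\|_{1,\rho})\rho$; (ii) if $\phi_m\to\phi$ in $\mathcal{G}_{k,\rho}$ (for $\|\cdot\|_{k,\rho}$) then $\phi_m^{-1}\to\phi^{-1}$ in $\mathcal{G}_{k,\rho'}$, $\rho'=(1-c\|\phi-Id\|_{1,\rho})\rho$; (iii) for each $k\ge1$ there are polynomials $P,Q,R,T$ of one variable such that if $\phi=Id+\chi$, $\psi=Id+\xi\in\mathcal{G}_{k,\rho}$ and $\rho'/\rho\le1-c\|\xi\|_{1,\rho}$ then $\|\phi\circ\psi-\phi\|_{k,\rho'}\le\|\xi\|_{k,\rho}P(\|\xi\|_{k,\rho})+\|\chi\|_{k+1,\rho}\|\xi\|_{k,\rho}Q(\|\xi\|_{k,\rho})$ and $\|\phi\circ\psi-Id\|_{k,\rho'}\le\|\xi\|_{k,\rho}R(\|\xi\|_{k,\rho})+\|\chi\|_{k,\rho}(1+\|\xi\|_{k,\rho}T(\|\xi\|_{k,\rho}))$.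 SCI-actions. A linear left SCI-action of an SCI-group $\mathcal{G}$ on an SCI-space $\mathcal{H}$ is given by a positive integer $\gamma$ and a constant $c>0$ such that for each $\phi=Id+\chi\in\mathcal{G}_{k,\rho}$ and $f\in\mathcal{H}_{k,\rho}$, the element $\phi\cdot f$ is well-defined in $\mathcal{H}_{k,\rho'}$ with $\rho'=(1-c\|\chi\|_{1,\rho})\rho$, is linear in $f$, the usual axioms of a left group action hold modulo appropriate restrictions of radii, and: (i) for each $k$ there are polynomials $Q,R$ with $\|(Id+\chi)\cdot f\|_{2k-1,\rho'}\le\|f\|_{2k-1,\rho}(1+\|\chi\|_{k+\gamma,\rho}Q(\|\chi\|_{k+\gamma,\rho}))+\|\chi\|_{2k-1+\gamma,\rho}\|f\|_{k,\rho}R(\|\chi\|_{k+\gamma,\rho})$; (ii) for each $k$ there is a polynomial $T$ of two variables with $\|(\phi+\chi)\cdot f-\phi\cdot f\|_{k,\rho'}\le\|\chi\|_{k+\gamma,\rho}\|f\|_{k+\gamma,\rho}T(\|\phi-Id\|_{k+\gamma,\rho},\|\chi\|_{k+\gamma,\rho})$. In these inequalities $\rho'=(1-c(\|\chi\|_{1,\rho}+\|\phi-Id\|_{1,\rho}))\rho$ (with $\phi=Id$ in (i)). The subgroup $\mathcal{G}^0$ need not itself be an SCI-group; closed means closed under convergence with respect to the norms $\|\cdot\|_{k,\rho}$. ''Preserving $\mathcal{S}$'' means mapping elements of $\mathcal{S}$ to elements of $\mathcal{S}$ under the action. *)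

(* Defs.v *)
From HB Require Import structures.
From mathcomp Require Import all_boot all_order all_algebra.
From mathcomp Require Import all_classical all_reals all_analysis.
From mathcomp Require mpoly.
Set Implicit Arguments.
Unset Strict Implicit.
Unset Printing Implicit Defensive.
Import Order.TTheory GRing.Theory Num.Theory.
Import numFieldNormedType.Exports.
Local Open Scope classical_set_scope.
Local Open Scope ring_scope.

(* The expressions Poly(x_1, .., x_n).  The coefficients are functions of the
   radius, nonnegative and continuous on ]0, 1]; dependence on k is obtained
   by quantifying over k before the polynomial. *)
Record radPoly (K : realType) (n : nat) := RadPoly {
  rp_poly : mpoly.mpoly n (K -> K);
  rp_ge0 : forall m (r : K), 0 < r <= 1 -> 0 <= mpoly.mcoeff m rp_poly r;
  rp_cont : forall m, {within `]0, 1], continuous (mpoly.mcoeff m rp_poly)} }.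

Definition rp_eval (K : realType) (n : nat) (P : radPoly K n) (r : K)
    (x : n.-tuple K) : K :=
  mpoly.meval (fun i => cst (tnth x i) : K -> K) (rp_poly P) r.

(* Poly_(d) : only terms of total degree at least d *)
Definition rp_mindeg (K : realType) (n : nat) (d : nat) (P : radPoly K n) :=
  forall m, mpoly.mcoeff m (rp_poly P) <> 0 -> (d <= mpoly.mdeg m)%N.

Definition rp_deg1_le (K : realType) (n : nat) (d : nat) (P : radPoly K n.+1) :=
  forall m, mpoly.mcoeff m (rp_poly P) <> 0 ->
    (mpoly.fun_of_multinom m ord0 <= d)%N.

(* D is a linear subspace of E on which N is a complete norm; the values of N
   outside of D are irrelevant. *)
Record isBanach (K : realType) (E : lmodType K) (D : set E) (N : E -> K)
    : Prop := {
  bn_0 : D 0;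
  bn_lin : forall a x y, D x -> D y -> D (a *: x + y);
  bn_ge0 : forall x, D x -> 0 <= N x;
  bn_eq0 : forall x, D x -> N x = 0 -> x = 0;
  bn_Z : forall a x, D x -> N (a *: x) = `|a| * N x;
  bn_D : forall x y, D x -> D y -> N (x + y) <= N x + N y;
  bn_complete : forall u : nat -> E, (forall m, D (u m)) ->
    (forall e, 0 < e -> exists m0, forall i j, (m0 <= i)%N -> (m0 <= j)%N ->
       N (u i - u j) < e) ->
    exists2 x, D x & (fun m => N (u m - x)) @ \oo --> (0 : K) }.

(* The axioms of SCI-spaces, for a scale of subspaces D k r of vector spaces
   E r.  Subspaces of a fixed E r encode that the spaces of radius r are nested
   and that restriction and smoothing do not depend on k.  [res r r'] is only
   meaningful for 0 < r' <= r <= 1, [sm r t] for t > 1 and 0 < r <= 1. *)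
Record isSCI (K : realType) (E : K -> lmodType K)
    (D : nat -> forall (r : K), set (E r)) (N : nat -> forall (r : K), E r -> K)
    (res : forall (r r' : K), {linear E r -> E r'})
    (sm : forall (r : K), K -> {linear E r -> E r}) : Prop := {
  sci_banach : forall k (r : K), 0 < r <= 1 -> isBanach (D k r) (N k r);
  sci_incl : forall k k' (r : K), 0 < r <= 1 -> (k <= k')%N -> D k' r `<=` D k r;
  sci_res_dom : forall k (r r' : K) f, 0 < r' -> r' <= r -> r <= 1 ->
    D k r f -> D k r' (res r r' f);
  sci_res_id : forall (r : K) f, 0 < r <= 1 -> D 0%N r f -> res r r f = f;
  sci_res_comp : forall (r r' r'' : K) f, 0 < r'' -> r'' <= r' -> r' <= r -> r <= 1 ->
    D 0%N r f -> res r' r'' (res r r' f) = res r r'' f;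
  sci_mono : forall k k' (r r' : K) f, (k' <= k)%N -> 0 < r' -> r' <= r -> r <= 1 ->
    D k r f -> N k' r' (res r r' f) <= N k r f;
  sci_sm_dom : forall k (r : K) t f, 0 < r <= 1 -> 1 < t -> D 0%N r f ->
    D k r (sm r t f);
  (* continuity of the smoothing operators with respect to the radius, all the
     radii being compared in the space of the smallest one *)
  sci_sm_cont : forall k (r0 r : K) t f, 0 < r0 -> r0 <= r -> r <= 1 -> 1 < t ->
    D 0%N r f ->
    let g r1 := res r1 r0 (sm r1 t (res r r1 f)) in
    forall (r1 : K), r0 <= r1 <= r ->
      {within `[r0, r], continuous (fun r2 => N k r0 (g r2 - g r1))};
  sci_sm_bound : exists2 C : nat -> nat -> K -> K,
    forall p q, {within `]0, 1], continuous (C p q)} /\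
      (forall (r : K), 0 < r <= 1 -> 0 < C p q r) &
    forall p q (r : K) t f, (q <= p)%N -> 0 < r <= 1 -> 1 < t ->
      (D q r f -> N p r (sm r t f) <= C p q r * t ^+ (p - q) * N q r f) /\
      (D p r f -> N q r (f - sm r t f) <= C p q r * t ^- (p - q) * N p r f) }.

Record sciSpace (K : realType) := SciSpace {
  sci_elt :> K -> lmodType K;
  dom : nat -> forall (r : K), set (sci_elt r);
  nrm : nat -> forall (r : K), sci_elt r -> K;
  res : forall (r r' : K), {linear sci_elt r -> sci_elt r'};
  smooth : forall (r : K), K -> {linear sci_elt r -> sci_elt r};
  sci_axioms : isSCI dom nrm res smooth }.

Arguments dom {K} s k r.
Arguments nrm {K} s k r x.
Arguments res {K} s r r'.
Arguments smooth {K} s r t.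

(* x belongs to X_{k,r} and its norm there is at most B : the meaning of
   ||x||_{k,r} <= B when the norm is +oo outside of X_{k,r} *)
Definition nrm_le (K : realType) (X : sciSpace K) k r (x : X r) (B : K) :=
  dom X k r x /\ nrm X k r x <= B.

(* Radius loss : x belongs to X_{k,r} and 0 < r' <= r (1 - c ||x||_{k,r}) *)
Definition shrinks (K : realType) (X : sciSpace K) (c : K) k (r : K) (x : X r)
    (r' : K) :=
  [/\ 0 < r <= 1, dom X k r x, 0 < r' & r' <= r * (1 - c * nrm X k r x)].

Arguments nrm_le {K} X k r x B.
Arguments shrinks {K} X c k r x r'.

Unset Implicit Arguments.

Record sciSubset (K : realType) (X : sciSpace K) := SciSubset {
  sub_set :> nat -> forall (r : K), set (X r);
  sub_dom : forall k (r : K), 0 < r <= 1 -> sub_set k r `<=` dom X k r;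
  sub_incl : forall k k' (r : K), 0 < r <= 1 -> (k <= k')%N ->
    sub_set k' r `<=` sub_set k r;
  sub_res : forall k (r r' : K) f, 0 < r' -> r' <= r -> r <= 1 ->
    sub_set k r f -> sub_set k r' (res X r r' f) }.

Record sciSubspace (K : realType) (X : sciSpace K) := SciSubspace {
  ss_set :> nat -> forall (r : K), set (X r);
  ss_dom : forall k (r : K), 0 < r <= 1 -> ss_set k r `<=` dom X k r;
  ss_sci : isSCI ss_set (nrm X) (res X) (smooth X) }.

Set Implicit Arguments.

Arguments sciSubset {K} X.
Arguments sciSubspace {K} X.
Arguments sub_set {K X} s k r.
Arguments ss_set {K X} s k r.

(* The scale of intersections A_{k,r} `&` B_{k,r} *)
Definition scaleI (K : realType) (X : sciSpace K)
    (A B : nat -> forall (r : K), set (X r)) : nat -> forall (r : K), set (X r) :=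
  fun k r => A k r `&` B k r.

(* Membership in A_{p,r} for p in N \cup {oo} (None stands for oo), where
   A_{oo,r} is the intersection of all A_{k,r} *)
Definition in_scale (K : realType) (X : sciSpace K)
    (A : nat -> forall (r : K), set (X r)) (p : option nat) r (x : X r) : Prop :=
  if p is Some q then A q r x else forall k, A k r x.

Arguments in_scale {K X} A p r x.

(* l <= p *)
Definition lvl_le (l : nat) (p : option nat) : bool :=
  if p is Some q then (l <= q)%N else true.

(* The element Id + chi of the group is represented by chi, so that Id is 0 and
   G_{k,r} is W_{k,r}.  The laws are partial operations: [comp r r' chi xi] is
   the composite of radius r' of elements of radius r, and [inv r r' chi] is
   the restriction to the radius r' of the inverse of an element of radius r.
   They are unconstrained outside of the radii allowed by [comp_def] and
   [inv_def]. *)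
Definition comp_def (K : realType) (W : sciSpace K) (c : K) (r r' : K) (xi : W r) :=
  shrinks W c 1 r xi r' /\ r' < r.

Definition inv_def (K : realType) (W : sciSpace K) (c : K) (r r' : K) (chi : W r) :=
  shrinks W (c / 2) 1 r chi r' /\ c * nrm W 1 r chi < 1.

Unset Implicit Arguments.

Record sciGroup (K : realType) (W : sciSpace K) := SciGroup {
  gcst : K;
  comp : forall (r r' : K), W r -> W r -> W r';
  inv : forall (r r' : K), W r -> W r';
  gcst_gt0 : 0 < gcst;
  comp_dom : forall k (r r' : K) chi xi, (1 <= k)%N ->
    dom W k r chi -> dom W k r xi -> comp_def gcst r' xi ->
    dom W k r' (comp r r' chi xi);
  comp_res_out : forall (r r' r'' : K) chi xi,
    dom W 1 r chi -> comp_def gcst r' xi -> 0 < r'' -> r'' <= r' ->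
    res W r' r'' (comp r r' chi xi) = comp r r'' chi xi;
  comp_res_in : forall (r r1 r' : K) chi xi, 0 < r1 -> r1 <= r ->
    dom W 1 r chi -> comp_def gcst r' xi ->
    comp_def gcst r' (res W r r1 xi) ->
    comp r1 r' (res W r r1 chi) (res W r r1 xi) = comp r r' chi xi;
  comp_id_r : forall (r r' : K) chi, 0 < r' -> r' < r -> r <= 1 -> dom W 1 r chi ->
    comp r r' chi 0 = res W r r' chi;
  comp_id_l : forall (r r' : K) xi, comp_def gcst r' xi ->
    comp r r' 0 xi = res W r r' xi;
  comp_assoc : forall (r r1 r2 r3 : K) phi psi eta, dom W 1 r phi ->
    comp_def gcst r1 psi -> comp_def gcst r3 (res W r r1 eta) ->
    comp_def gcst r2 eta -> comp_def gcst r3 (comp r r2 psi eta) ->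
    comp r1 r3 (comp r r1 phi psi) (res W r r1 eta) =
    comp r2 r3 (res W r r2 phi) (comp r r2 psi eta);
  inv_dom : forall k (r r' : K) chi, (1 <= k)%N -> dom W k r chi ->
    inv_def gcst r' chi -> dom W k r' (inv r r' chi);
  inv_res_out : forall (r r' r'' : K) chi, inv_def gcst r' chi ->
    0 < r'' -> r'' <= r' ->
    res W r' r'' (inv r r' chi) = inv r r'' chi;
  inv_law : forall (r r' : K) chi, shrinks W gcst 1 r chi r' ->
    let r1 := (1 - gcst / 2 * nrm W 1 r chi) * r in r' < r1 ->
    comp r1 r' (res W r r1 chi) (inv r r1 chi) = 0 /\
    comp r1 r' (inv r r1 chi) (res W r r1 chi) = 0;
  inv_bound : forall k, (1 <= k)%N -> exists P : radPoly K 1,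
    forall (r r' : K) chi, dom W (2 * k - 1) r chi -> shrinks W gcst 1 r chi r' ->
    nrm_le W k r' (inv r r' chi)
      (nrm W k r chi * rp_eval P r [tuple nrm W k r chi]);
  (* the last condition on r' ensures that all the inverses are defined in
     the radius r' *)
  inv_cont : forall k (r r' : K) (chis : nat -> W r) chi, (1 <= k)%N ->
    (forall m, dom W k r (chis m)) -> dom W k r chi ->
    (fun m => nrm W k r (chis m - chi)) @ \oo --> (0 : K) ->
    shrinks W gcst 1 r chi r' -> (forall m, inv_def gcst r' (chis m)) ->
    (fun m => nrm W k r' (inv r r' (chis m) - inv r r' chi)) @ \oo --> (0 : K);
  comp_bound : forall k, (1 <= k)%N -> exists P Q Rp Tp : radPoly K 1,
    forall (r r' : K) chi xi, dom W k r chi -> dom W k r xi ->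
    comp_def gcst r' xi ->
    let x := [tuple nrm W k r xi] in
    (dom W k.+1 r chi ->
     nrm_le W k r' (comp r r' chi xi - res W r r' chi)
       (nrm W k r xi * rp_eval P r x +
        nrm W k.+1 r chi * nrm W k r xi * rp_eval Q r x)) /\
    nrm_le W k r' (comp r r' chi xi)
      (nrm W k r xi * rp_eval Rp r x +
       nrm W k r chi * (1 + nrm W k r xi * rp_eval Tp r x)) }.

Arguments sciGroup {K} W.
Arguments gcst {K W} s.
Arguments comp {K W} s r r' chi xi.
Arguments inv {K W} s r r' chi.

(* [act r r' chi f] is the element (Id + chi) . f of radius r', where Id + chi
   and f have radius r; it is meaningful under [shrinks W acst 1 r chi r']. *)
Record sciAction (K : realType) (W : sciSpace K) (G : sciGroup W)
    (X : sciSpace K) := SciAction {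
  agamma : nat;
  acst : K;
  act : forall (r r' : K), W r -> X r -> X r';
  agamma_gt0 : (0 < agamma)%N;
  acst_gt0 : 0 < acst;
  act_dom : forall k (r r' : K) chi f, dom W k r chi -> dom X k r f ->
    shrinks W acst 1 r chi r' -> dom X k r' (act r r' chi f);
  act_lin : forall (r r' : K) chi a f g, dom X 0 r f -> dom X 0 r g ->
    shrinks W acst 1 r chi r' ->
    act r r' chi (a *: f + g) = a *: act r r' chi f + act r r' chi g;
  act_res_out : forall (r r' r'' : K) chi f, dom X 0 r f ->
    shrinks W acst 1 r chi r' -> 0 < r'' -> r'' <= r' ->
    res X r' r'' (act r r' chi f) = act r r'' chi f;
  act_res_in : forall (r r1 r' : K) chi f, 0 < r1 -> r1 <= r -> dom X 0 r f ->
    shrinks W acst 1 r chi r' -> shrinks W acst 1 r1 (res W r r1 chi) r' ->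
    act r1 r' (res W r r1 chi) (res X r r1 f) = act r r' chi f;
  act_id : forall (r r' : K) f, 0 < r' -> r' <= r -> r <= 1 -> dom X 0 r f ->
    act r r' 0 f = res X r r' f;
  act_comp : forall (r r1 r2 r3 : K) chi xi f,
    dom W 1 r chi -> dom X 0 r f ->
    comp_def (gcst G) r1 xi -> shrinks W acst 1 r1 (comp G r r1 chi xi) r3 ->
    shrinks W acst 1 r xi r2 -> shrinks W acst 1 r2 (res W r r2 chi) r3 ->
    act r1 r3 (comp G r r1 chi xi) (res X r r1 f) =
    act r2 r3 (res W r r2 chi) (act r r2 xi f);
  act_bound : forall k, (1 <= k)%N -> exists Q Rp : radPoly K 1,
    forall (r r' : K) chi f, dom X (2 * k - 1) r f ->
    dom W (2 * k - 1 + agamma) r chi -> shrinks W acst 1 r chi r' ->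
    let x := nrm W (k + agamma) r chi in
    nrm_le X (2 * k - 1) r' (act r r' chi f)
      (nrm X (2 * k - 1) r f * (1 + x * rp_eval Q r [tuple x]) +
       nrm W (2 * k - 1 + agamma) r chi * nrm X k r f * rp_eval Rp r [tuple x]);
  act_cont : forall k, exists Tp : radPoly K 2,
    forall (r r' : K) eta chi f, 0 < r <= 1 -> dom W (k + agamma) r eta ->
    dom W (k + agamma) r chi -> dom X (k + agamma) r f ->
    0 < r' -> r' <= (1 - acst * (nrm W 1 r chi + nrm W 1 r eta)) * r ->
    nrm_le X k r' (act r r' (eta + chi) f - act r r' eta f)
      (nrm W (k + agamma) r chi * nrm X (k + agamma) r f *
       rp_eval Tp r [tuple nrm W (k + agamma) r eta; nrm W (k + agamma) r chi]) }.

Set Implicit Arguments.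

Arguments sciAction {K W} G X.
Arguments agamma {K W G X} s.
Arguments acst {K W G X} s.
Arguments act {K W G X} s r r' chi f.

(* G0 is a subgroup of G, closed under convergence for the norms ||.||_{k,r} *)
Record closedSubgroup (K : realType) (W : sciSpace K) (G : sciGroup W)
    (G0 : sciSubset W) : Prop := {
  csg_id : forall k (r : K), 0 < r <= 1 -> G0 k r 0;
  csg_comp : forall k (r r' : K) chi xi, (1 <= k)%N -> G0 k r chi -> G0 k r xi ->
    comp_def (gcst G) r' xi -> G0 k r' (comp G r r' chi xi);
  csg_inv : forall k (r r' : K) chi, (1 <= k)%N -> G0 k r chi ->
    inv_def (gcst G) r' chi -> G0 k r' (inv G r r' chi);
  csg_closed : forall k (r : K) (u : nat -> W r) chi, 0 < r <= 1 ->
    (forall m, G0 k r (u m)) -> dom W k r chi ->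
    (fun m => nrm W k r (u m - chi)) @ \oo --> (0 : K) -> G0 k r chi }.

Definition preserves (K : realType) (W : sciSpace K) (G : sciGroup W)
    (X : sciSpace K) (A : sciAction G X) (G0 : sciSubset W) (S : sciSubset X) :=
  forall k (r r' : K) chi f, G0 k r chi -> S k r f ->
    shrinks W (acst A) 1 r chi r' -> S k r' (act A r r' chi f).

(* A linear projection onto F, compatible with inclusions (one map for each
   radius) and restrictions *)
Definition isProj (K : realType) (X : sciSpace K) (F : sciSubspace X)
    (pi : forall (r : K), {linear X r -> X r}) :=
  [/\ forall k (r : K) f, 0 < r <= 1 -> dom X k r f -> F k r (pi r f),
      forall k (r : K) f, 0 < r <= 1 -> F k r f -> pi r f = f &
      forall (r r' : K) f, 0 < r' -> r' <= r -> r <= 1 -> dom X 0 r f ->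
        res X r r' (pi r f) = pi r' (res X r r' f)].

Definition zeta (K : realType) (X : sciSpace K)
    (pi : forall (r : K), {linear X r -> X r}) r (f : X r) : X r := f - pi r f.

(* Main.v *)
(** Nash-Moser iteration in the scale. Put [f_{d+1} = Phi(S(t_d) H(f_d)) . f_d]
with [t_{d+1} = t_d^q] and [1 < q < 1 + min(delta, 1)], where [S(t_d)] is the
smoothing operator, on radii decreasing from [R]. At a fixed large level [l]
one propagates simultaneously a bound on [|f_d|_l], the slow growth
[|f_d|_{2l-1} <= t_d^A] and the fast decay [|zeta(f_d)|_l <= t_d^-1].
Interpolating between the levels [l] and [2l-1], a fixed shift of the level
costs only a factor [t_d^e] with [e] small. Hence [zeta_quad] gives
[|zeta(f_{d+1})|_l <= t_d^(-q-e)], while smoothing costs a factor [t_d^B] at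
level [2l-1] with [B] independent of [l], which is absorbed as soon as
[(q-1) A > B]. The same estimates pass from level [k] to level [k+1] whenever
[f] is in [S_{2k+1}], with [t_0] and [A] unchanged, so that all the levels
allowed by [p] converge for one and the same iteration.

The composites of the diffeomorphisms [phi_d] lose too much radius, but
[theta_d = phi_0^-1 o .. o phi_{d-1}^-1] only loses [|phi_d - Id|_1] at each
step; its limit [theta] satisfies [theta . f_oo = f], and [psi = theta^-1]. *)
Require Import Defs.
From HB Require Import structures.
From mathcomp Require Import all_boot all_order all_algebra.
From mathcomp Require Import all_classical all_reals all_analysis.
From mathcomp Require Import ring lra zify.
Set Implicit Arguments.
Unset Strict Implicit.
Unset Printing Implicit Defensive.
Import Order.TTheory GRing.Theory Num.Theory.
Import numFieldNormedType.Exports.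
Local Open Scope classical_set_scope.
Local Open Scope ring_scope.

(** * Polynomial bounds and orders of magnitude *)

Arguments sub_incl {K X} s {k k' r}.
Arguments sub_dom {K X} s {k r}.
Arguments sub_res {K X} s {k r r' f}.
Arguments ss_dom {K X} s {k r}.
Arguments ss_sci {K X} s.
Arguments gcst_gt0 {K W} s.
Arguments comp_dom {K W} s {k r r' chi xi}.
Arguments comp_res_out {K W} s {r r' r'' chi xi}.
Arguments comp_res_in {K W} s {r r1 r' chi xi}.
Arguments comp_bound {K W} s {k}.
Arguments inv_dom {K W} s {k r r' chi}.
Arguments inv_res_out {K W} s {r r' r'' chi}.
Arguments inv_law {K W} s {r r' chi}.
Arguments inv_bound {K W} s {k}.
Arguments acst_gt0 {K W G X} s.
Arguments act_dom {K W G X} s {k r r' chi f}.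
Arguments act_lin {K W G X} s {r r' chi} a {f g}.
Arguments act_res_out {K W G X} s {r r' r'' chi f}.
Arguments act_res_in {K W G X} s {r r1 r' chi f}.
Arguments act_id {K W G X} s {r r' f}.
Arguments act_comp {K W G X} s {r r1 r2 r3 chi xi f}.
Arguments act_bound {K W G X} s {k}.
Arguments act_cont {K W G X} s k.

(** The top level is 2l-1 because the tame estimates evaluate their polynomial factors near level
    [(k+1)/2]: at k = 2l-1, up to the shift [s], these factors only see level l, where f_d is
    bounded. Of the two bounds on q, q < 1 + delta comes from [zeta_quad]; q < 2 comes from the
    smoothing error and from the part of degree 2 in [Phi_diff], both close to t_d^-2. In
    [zeta_quad] the norm |f|_{k+s} is only O(t_d^e), so its degree enters the choice of e. Since l
    is chosen after e, this degree must not depend on k. The set S is not assumed closed. The limit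
    of f_d is therefore only shown to lie in F, and membership in S comes from the exact identity
    psi . f = f_oo with psi in G0. In a composite the radius loss is measured by the right factor.
    The product phi_d o (phi_{d-1} o .. o phi_0) would pay at each step for the whole inner product,
    which does not tend to Id, whereas theta_d o phi_d^-1 pays for the small new factor only. *)

Section RadPoly.
Variables (K : realType) (n : nat).
Implicit Types (P : radPoly K n) (r : K) (x : n.-tuple K).

Lemma rp_evalE P r x : rp_eval P r x =
  \sum_(m <- mpoly.msupp (rp_poly P))
    mpoly.mcoeff m (rp_poly P) r *
    \prod_(i < n) tnth x i ^+ mpoly.fun_of_multinom m i.
Proof.
rewrite /rp_eval mpoly.mevalE fct_sumE; apply: eq_bigr => m _ /=.
congr (_ * _).
elim/big_ind2 : _ => // [f a g b fa gb|i _].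
  by rewrite -fa -gb.
by elim: (mpoly.fun_of_multinom m i) => [|j IH]; rewrite ?expr0// !exprS -IH.
Qed.

Lemma continuous_le_bound (a : K) (f : K -> K) : 0 < a <= 1 ->
  {within `]0, 1], continuous f} ->
  exists2 C, 0 <= C & forall r, a <= r <= 1 -> f r <= C.
Proof.
move=> /andP[a0 a1] fc.
have fc' : {within `[a, 1], continuous f}.
  apply: continuous_subspaceW fc => r /=; rewrite !in_itv/= => /andP[ar ->].
  by rewrite (lt_le_trans a0 ar).
have [c _ cP] := EVT_max a1 fc'.
exists (Num.max 0 (f c)) => [|r r1]; first by rewrite le_max lexx.
by rewrite le_max cP ?orbT// in_itv.
Qed.

(** Bounding the monomials is enough, because the coefficients are continuous on ]0, 1] and hence
    bounded on [a, 1]. The constant serves a whole family [J] at once, which is the source of all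
    later uniformity. *)
Lemma rp_eval_le (J : Type) P (a : K) (rr : J -> K) (xx : J -> n.-tuple K)
    (Y : J -> K) : 0 < a <= 1 -> (forall j, a <= rr j <= 1) ->
  (forall j i, 0 <= tnth (xx j) i) ->
  (forall m, mpoly.mcoeff m (rp_poly P) <> 0 -> exists2 D, 0 <= D &
     forall j, \prod_(i < n) tnth (xx j) i ^+ mpoly.fun_of_multinom m i
       <= D * Y j) ->
  exists2 C, 0 <= C & forall j, 0 <= rp_eval P (rr j) (xx j) <= C * Y j.
Proof.
move=> a01 rr1 xx0 xxY.
have rr01 j : 0 < rr j <= 1.
  by have /andP[ar ->] := rr1 j; move: a01 => /andP[/lt_le_trans ->].
have big0 j m : 0 <= \prod_(i < n) tnth (xx j) i ^+ mpoly.fun_of_multinom m i.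
  by apply: prodr_ge0 => i _; rewrite exprn_ge0.
suff [C C0 CP] : exists2 C, 0 <= C & forall j, rp_eval P (rr j) (xx j) <= C * Y j.
  exists C => // j; rewrite CP andbT rp_evalE; apply: sumr_ge0 => m _.
  by rewrite mulr_ge0// rp_ge0.
suff [C C0 CP] : exists2 C, 0 <= C & forall j,
    \sum_(m <- mpoly.msupp (rp_poly P))
    mpoly.mcoeff m (rp_poly P) (rr j) *
    \prod_(i < n) tnth (xx j) i ^+ mpoly.fun_of_multinom m i <= C * Y j.
  by exists C => // j; rewrite rp_evalE.
elim: (mpoly.msupp (rp_poly P)) => [|m s [C C0 CP]].
  by exists 0 => // j; rewrite big_nil mul0r.
(* The induction on the list forgets that [m] lies in the support, while [xxY] only covers monomials
   with a nonzero coefficient. *)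
have [/eqP m0|m0] := eqVneq (mpoly.mcoeff m (rp_poly P)) 0.
  exists C => // j; rewrite big_cons (eqP m0) mul0r add0r; exact: CP.
have [D D0 DP] : exists2 D, 0 <= D &
     forall j, \prod_(i < n) tnth (xx j) i ^+ mpoly.fun_of_multinom m i
       <= D * Y j.
  by apply: xxY; apply/eqP.
have [E E0 EP] := continuous_le_bound a01 (@rp_cont _ _ P m).
exists (E * D + C); first by rewrite addr_ge0// mulr_ge0.
move=> j; rewrite big_cons mulrDl lerD//.
rewrite (le_trans (ler_wpM2r _ (EP _ _)))//.
by rewrite -mulrA ler_wpM2l.
Qed.

End RadPoly.

Lemma powR_gt1 (K : realType) (a x : K) : 1 < a -> 0 < x -> 1 < a `^ x.
Proof.
move=> a1 x0; have <- : 1 `^ x = 1 :> K by rewrite powR1.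
by rewrite gt0_ltr_powR// nnegrE// ltW// (lt_trans ltr01).
Qed.

Lemma powR_large (K : realType) (y x : K) : 0 < x ->
  exists2 t, 1 < t & forall t', t <= t' -> y <= t' `^ x.
Proof.
move=> x0; have y2 : 1 < 2 + `|y| by rewrite (@lt_le_trans _ _ 2) ?ltr1n ?lerDl.
exists ((2 + `|y|) `^ x^-1) => [|t' tt']; first by rewrite powR_gt1// invr_gt0.
have y0 : 0 <= 2 + `|y| by rewrite addr_ge0.
rewrite (@le_trans _ _ (2 + `|y|))//.
  by rewrite (le_trans (ler_norm y))// lerDr.
have -> : 2 + `|y| = ((2 + `|y|) `^ x^-1) `^ x.
  by rewrite -powRrM mulVf ?lt0r_neq0// powRr1.
have t'0 : 0 <= t' by rewrite (le_trans _ tt')// powR_ge0.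
by apply: ge0_ler_powR tt'; rewrite ?nnegrE ?powR_ge0 ?(ltW x0).
Qed.

Section Order.
Variables (K : realType) (I : Type) (t : I -> K).
Hypothesis t1 : forall i, 1 <= t i.
Implicit Types (u v : I -> K) (x y z : K).

(* [u i = O(t i `^ x)] uniformly in [i], with [u] nonnegative. *)
Definition ordle x u := exists2 C, 0 <= C & forall i, 0 <= u i <= C * t i `^ x.

Lemma ordle_ge0 x u : ordle x u -> forall i, 0 <= u i.
Proof. by move=> [C _ uP] i; have /andP[] := uP i. Qed.

Lemma ordleW x y u : x <= y -> ordle x u -> ordle y u.
Proof.
move=> xy [C C0 uP]; exists C => // i; have /andP[-> /le_trans->]// := uP i.
by rewrite ler_wpM2l// ler_powR.
Qed.

Lemma ordle_le x u v : (forall i, 0 <= u i <= v i) -> ordle x v -> ordle x u.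
Proof.
move=> uv [C C0 vP]; exists C => // i.
have /andP[-> /le_trans->]// := uv i; by have /andP[] := vP i.
Qed.

Lemma ordleD x u v : ordle x u -> ordle x v -> ordle x (fun i => u i + v i).
Proof.
move=> [C C0 uP] [D D0 vP]; exists (C + D) => [|i]; first by rewrite addr_ge0.
have /andP[u0 uC] := uP i; have /andP[v0 vC] := vP i.
by rewrite addr_ge0//= mulrDl lerD.
Qed.

Lemma ordleM x y z u v : x + y <= z -> ordle x u -> ordle y v ->
  ordle z (fun i => u i * v i).
Proof.
move=> xyz [C C0 uP] [D D0 vP]; apply: ordleW xyz _.
exists (C * D) => [|i]; first by rewrite mulr_ge0.
have /andP[u0 uC] := uP i; have /andP[v0 vC] := vP i.
rewrite mulr_ge0//= powRD; last first.
  by apply/implyP => _; rewrite gt_eqF// (lt_le_trans ltr01).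
by rewrite mulrACA ler_pM.
Qed.

Lemma ordle_cst x c : 0 <= c -> 0 <= x -> ordle x (fun=> c).
Proof.
move=> c0 x0; exists c => // i; rewrite c0/= ler_peMr//.
by rewrite -(powRr0 (t i)) ler_powR.
Qed.

Lemma ordle_powt x : ordle x (fun i => t i `^ x).
Proof. by exists 1 => // i; rewrite mul1r lexx powR_ge0. Qed.

Lemma ordle_powR x p u : 0 <= p -> ordle x u -> ordle (x * p) (fun i => u i `^ p).
Proof.
move=> p0 [C C0 uP]; exists (C `^ p) => [|i]; first exact: powR_ge0.
have /andP[u0 uC] := uP i; rewrite powR_ge0/= powRrM -powRM ?powR_ge0//.
by rewrite ge0_ler_powR// nnegrE// mulr_ge0// powR_ge0.
Qed.

Lemma ordle_exp x y n u : ordle x u -> x *+ n <= y -> ordle y (fun i => u i ^+ n).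
Proof.
move=> ux; elim: n y => [|n IH] y xy.
  by apply: ordle_cst; rewrite -?(mulr0n x).
rewrite (_ : (fun _ => _) = fun i => u i * u i ^+ n).
  by apply: (ordleM (x := x) (y := x *+ n)) => //; [rewrite -mulrS|exact: IH].
by apply/funext => i; rewrite exprS.
Qed.

Lemma ordle_prod n (x : 'I_n -> K) y (u : 'I_n -> I -> K) :
  (forall j, ordle (x j) (u j)) -> \sum_j x j <= y ->
  ordle y (fun i => \prod_j u j i).
Proof.
elim: n x y u => [|n IH] x y u ux xy.
  rewrite (_ : (fun _ => _) = fun=> 1).
    by apply: ordle_cst => //; rewrite big_ord0 in xy.
  by apply/funext => i; rewrite big_ord0.
rewrite (_ : (fun _ => _) = fun i => u ord0 i * \prod_j u (lift ord0 j) i).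
  apply: (ordleM (x := x ord0) (y := \sum_j x (lift ord0 j))) => //.
    by rewrite -big_ord_recl.
  exact: (IH (fun j => x (lift ord0 j)) _ (fun j => u (lift ord0 j))).
by apply/funext => i; rewrite big_ord_recl.
Qed.

Section Poly.
Variables (a : K) (rad : I -> K).
Hypotheses (a01 : 0 < a <= 1) (rad1 : forall i, a <= rad i <= 1).

Lemma ordle_rp n (P : radPoly K n) (x : 'I_n -> K) y (u : I -> n.-tuple K) :
  (forall j, ordle (x j) (fun i => tnth (u i) j)) ->
  (forall m, mpoly.mcoeff m (rp_poly P) <> 0 ->
     \sum_j x j *+ mpoly.fun_of_multinom m j <= y) ->
  ordle y (fun i => rp_eval P (rad i) (u i)).
Proof.
move=> ux xy; apply: (rp_eval_le a01 rad1) => [i j|m m0].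
  by have := ordle_ge0 (ux j) i.
have [C C0 CP] := ordle_prod (fun j => ordle_exp (ux j) (lexx _)) (xy m m0).
by exists C => // i; have /andP[] := CP i.
Qed.

Lemma ordle_rp0 n (P : radPoly K n) (u : I -> n.-tuple K) :
  (forall j, ordle 0 (fun i => tnth (u i) j)) ->
  ordle 0 (fun i => rp_eval P (rad i) (u i)).
Proof.
move=> u0; apply: (ordle_rp (x := fun=> 0)) => // m _.
by rewrite big1// => j _; rewrite mul0rn.
Qed.

Lemma ordle_rp1 (P : radPoly K 1) (u : I -> K) : ordle 0 u ->
  ordle 0 (fun i => rp_eval P (rad i) [tuple u i]).
Proof.
by move=> u0; apply: ordle_rp0 => j; rewrite (ord1 j); under eq_fun do rewrite tnth0.
Qed.

Lemma ordle_rp2 (P : radPoly K 2) (u v : I -> K) : ordle 0 u -> ordle 0 v ->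
  ordle 0 (fun i => rp_eval P (rad i) [tuple u i; v i]).
Proof.
move=> u0 v0; apply: ordle_rp0; case=> [[|[|//]]] ?.
  exact: u0.
exact: v0.
Qed.

(** Since [x <= 0], a monomial of higher degree has a smaller exponent, so the terms of lowest
    degree decide. *)
Lemma ordle_rp2_mindeg (P : radPoly K 2) d x (u v : I -> K) : rp_mindeg d P ->
  x <= 0 -> ordle x u -> ordle x v ->
  ordle (x *+ d) (fun i => rp_eval P (rad i) [tuple u i; v i]).
Proof.
move=> Pd x0 ux vx; apply: (ordle_rp (x := fun=> x)).
  case=> [[|[|//]]] ?; [exact: ux|exact: vx].
move=> m /Pd; rewrite mpoly.mdegE => dm.
by rewrite sumrMnr -lerN2 -!mulNrn ler_wpMn2l ?oppr_ge0.
Qed.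

(** Bounded arguments contribute no power of t, so only the degree in the first argument matters.
    This shape is the one of [zeta_quad], where |f|_{k+s} is the only unbounded argument. *)
Lemma ordle_rp4_deg1 (P : radPoly K 4) d x y (u0 u1 u2 u3 : I -> K) :
  rp_deg1_le d P -> 0 <= x -> x *+ d <= y -> ordle x u0 ->
  ordle 0 u1 -> ordle 0 u2 -> ordle 0 u3 ->
  ordle y (fun i => rp_eval P (rad i) [tuple u0 i; u1 i; u2 i; u3 i]).
Proof.
move=> Pd x0 xy ux u10 u20 u30.
apply: (ordle_rp (x := fun j => if j == ord0 then x else 0)).
  case=> [[|[|[|[|//]]]]] ?; [exact: ux|exact: u10|exact: u20|exact: u30].
move=> m /Pd md; rewrite (bigD1 ord0)//= big1 ?addr0; last first.
  by move=> j /negbTE->; rewrite mul0rn.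
by apply: le_trans xy; rewrite ler_wpMn2l.
Qed.

End Poly.
End Order.

(** * SCI-spaces and interpolation *)

Section SciSpace.
Variables (K : realType) (X : sciSpace K).
Implicit Types (k : nat) (r : K).

Section FixedRadius.
Variable r : K.
Hypothesis r01 : 0 < r <= 1.
Implicit Types (x y : X r).

Let ban k : isBanach (dom X k r) (nrm X k r).
Proof. exact: (sci_banach (sci_axioms X) k r01). Qed.

Lemma dom_0 k : dom X k r 0. Proof. exact: bn_0 (ban k). Qed.

Lemma dom_lin k a x y : dom X k r x -> dom X k r y -> dom X k r (a *: x + y).
Proof. exact: (bn_lin (ban k)). Qed.

Lemma dom_D k x y : dom X k r x -> dom X k r y -> dom X k r (x + y).
Proof. by move=> dx dy; rewrite -(scale1r x); exact: dom_lin. Qed.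

Lemma dom_N k x : dom X k r x -> dom X k r (- x).
Proof.
by move=> dx; rewrite -scaleN1r -[_ *: _]addr0; apply: dom_lin => //; exact: dom_0.
Qed.

Lemma dom_B k x y : dom X k r x -> dom X k r y -> dom X k r (x - y).
Proof. by move=> dx dy; apply: dom_D => //; exact: dom_N. Qed.

Lemma nrm_ge0 k x : dom X k r x -> 0 <= nrm X k r x.
Proof. exact: (bn_ge0 (ban k)). Qed.

Lemma nrm_eq0 k x : dom X k r x -> nrm X k r x = 0 -> x = 0.
Proof. exact: (bn_eq0 (ban k)). Qed.

Lemma nrm_0 k : nrm X k r 0 = 0.
Proof. by rewrite -(scale0r 0) (bn_Z (ban k)) ?normr0 ?mul0r//; exact: dom_0. Qed.

Lemma nrm_N k x : dom X k r x -> nrm X k r (- x) = nrm X k r x.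
Proof. by move=> dx; rewrite -scaleN1r (bn_Z (ban k))// normrN1 mul1r. Qed.

Lemma nrm_D k x y : dom X k r x -> dom X k r y ->
  nrm X k r (x + y) <= nrm X k r x + nrm X k r y.
Proof. exact: (bn_D (ban k)). Qed.

Lemma nrm_B k x y : dom X k r x -> dom X k r y ->
  nrm X k r (x - y) <= nrm X k r x + nrm X k r y.
Proof. by move=> dx dy; rewrite -(nrm_N dy) nrm_D//; exact: dom_N. Qed.

Lemma nrm_BC k x y : dom X k r x -> dom X k r y ->
  nrm X k r (x - y) = nrm X k r (y - x).
Proof. by move=> dx dy; rewrite -opprB nrm_N//; exact: dom_B. Qed.

Lemma nrm_tri k x y : dom X k r x -> dom X k r y ->
  nrm X k r x <= nrm X k r (x - y) + nrm X k r y.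
Proof. by move=> dx dy; rewrite -{1}(subrK y x) nrm_D//; exact: dom_B. Qed.

Lemma dom_leq k k' x : (k <= k')%N -> dom X k' r x -> dom X k r x.
Proof. by move=> kk; exact: (sci_incl (sci_axioms X) r01 kk). Qed.

Lemma nrm_leq k k' x : (k <= k')%N -> dom X k' r x ->
  nrm X k r x <= nrm X k' r x.
Proof.
move=> kk dx; have /andP[r0 r1] := r01.
have := sci_mono (sci_axioms X) kk r0 (lexx r) r1 dx.
by rewrite (sci_res_id (sci_axioms X))//; exact: dom_leq dx.
Qed.

End FixedRadius.

Section Restriction.
Variables (r r' : K).
Hypotheses (r'0 : 0 < r') (r'r : r' <= r) (r1 : r <= 1).

Lemma dom_res k x : dom X k r x -> dom X k r' (res X r r' x).
Proof. exact: (sci_res_dom (sci_axioms X)). Qed.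

Lemma nrm_res k x : dom X k r x -> nrm X k r' (res X r r' x) <= nrm X k r x.
Proof. exact: (sci_mono (sci_axioms X)). Qed.

Lemma res_comp r'' x : 0 < r'' -> r'' <= r' -> dom X 0 r x ->
  res X r' r'' (res X r r' x) = res X r r'' x.
Proof. by move=> ? ?; exact: (sci_res_comp (sci_axioms X)). Qed.

End Restriction.

(** The constants of the smoothing operators are continuous on ]0, 1], hence bounded on [a0, 1];
    families with varying radii need a common constant. *)
Lemma smooth_bound (a0 : K) p q : 0 < a0 <= 1 -> (q <= p)%N ->
  exists2 C, 0 <= C & forall r t x, a0 <= r <= 1 -> 1 < t ->
    (dom X q r x ->
      nrm X p r (smooth X r t x) <= C * t ^+ (p - q) * nrm X q r x) /\
    (dom X p r x ->
      nrm X q r (x - smooth X r t x) <= C * t ^- (p - q) * nrm X p r x).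
Proof.
move=> a01 qp; have [C Cc CP] := sci_sm_bound (sci_axioms X).
have [D D0 DP] := continuous_le_bound a01 (Cc p q).1.
exists D => // r t x ar t1.
have r01 : 0 < r <= 1.
  by move: a01 ar => /andP[a0' _] /andP[/(lt_le_trans a0') -> ->].
have t0 : 0 < t by rewrite (lt_trans ltr01).
split=> dx.
  apply: le_trans ((CP _ _ _ _ _ qp r01 t1).1 dx) _.
  rewrite ler_wpM2r ?nrm_ge0// ler_wpM2r ?exprn_ge0 ?(ltW t0)//.
  exact: DP.
apply: le_trans ((CP _ _ _ _ _ qp r01 t1).2 dx) _.
rewrite ler_wpM2r ?nrm_ge0// ler_wpM2r ?invr_ge0 ?exprn_ge0 ?(ltW t0)//.
exact: DP.
Qed.

Section Interpolation.
Variables (I : Type) (t rad : I -> K) (a0 : K).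
Hypotheses (t1 : forall i, 1 < t i) (a01 : 0 < a0 <= 1)
  (rad1 : forall i, a0 <= rad i <= 1).

Let tge1 i : 1 <= t i. Proof. exact: ltW. Qed.

Lemma rad01 i : 0 < rad i <= 1.
Proof. by move: a01 (rad1 i) => /andP[a0' _] /andP[/(lt_le_trans a0') -> ->]. Qed.

Lemma ordle_nrm k x (u : forall i, X (rad i)) (B : I -> K) :
  (forall i, nrm_le X k (rad i) (u i) (B i)) -> ordle t x B ->
  ordle t x (fun i => nrm X k (rad i) (u i)).
Proof.
move=> uB; apply: ordle_le => i; have [du ->] := uB i.
by rewrite nrm_ge0// rad01.
Qed.

Lemma ordle_nrm_leq k k' x (u : forall i, X (rad i)) : (k <= k')%N ->
  (forall i, dom X k' (rad i) (u i)) ->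
  ordle t x (fun i => nrm X k' (rad i) (u i)) ->
  ordle t x (fun i => nrm X k (rad i) (u i)).
Proof.
move=> kk du; apply: ordle_nrm => i; split; last by rewrite nrm_leq ?rad01.
exact: (dom_leq (rad01 i) kk).
Qed.

(* Splitting [u] by the smoothing operator of parameter [t `^ (e / m)]. *)
Lemma interpolation (a b p m : nat) (x y e : K) (u : forall i, X (rad i)) :
  (a <= p <= a + m)%N -> (p <= b)%N -> (0 < m)%N -> 0 < e ->
  (y - x) * m%:R <= e * (b - p)%:R ->
  (forall i, dom X b (rad i) (u i)) ->
  ordle t x (fun i => nrm X a (rad i) (u i)) ->
  ordle t y (fun i => nrm X b (rad i) (u i)) ->
  ordle t (x + e) (fun i => nrm X p (rad i) (u i)).
Proof.
move=> /andP[ap pam] pb m0 e0 xy du ua ub.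
have mR : 0 < m%:R :> K by rewrite ltr0n.
pose z := e / m%:R; have z0 : 0 < z by rewrite divr_gt0.
pose w i := t i `^ z.
have w1 i : 1 < w i by exact: powR_gt1.
have [C C0 CP] := smooth_bound a01 ap.
have [D D0 DP] := smooth_bound a01 pb.
pose B i := C * w i ^+ (p - a) * nrm X a (rad i) (u i) +
  D * w i ^- (b - p) * nrm X b (rad i) (u i).
apply: (ordle_nrm (B := B)) => [i|].
  have r01 := rad01 i.
  have dup : dom X p (rad i) (u i) by exact: dom_leq (du i).
  have dsm : dom X p (rad i) (smooth X (rad i) (w i) (u i)).
    apply: (sci_sm_dom (sci_axioms X)) => //; exact: dom_leq (du i).
  split=> //; rewrite /B -{1}(subrK (smooth X (rad i) (w i) (u i)) (u i)) addrC.
  rewrite (le_trans (nrm_D _ _ _))//; first exact: dom_B.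
  apply: lerD.
    apply: (CP _ _ _ (rad1 i) (w1 i)).1; apply: dom_leq (du i) => //; lia.
  exact: (DP _ _ _ (rad1 i) (w1 i)).2 (du i).
have wE i n : w i ^+ n = t i `^ (z * n%:R).
  by rewrite -powR_mulrn ?powR_ge0// /w -powRrM.
(* Smoothed part: w^(p-a) <= t^e because p - a <= m. Remainder: w^-(b-p) = t^(-e(b-p)/m) <= t^(x-y),
   which brings t^y down to t^x. *)
apply: ordleD.
  apply: (ordleM tge1 (x := e) (y := x)) => //; first by rewrite addrC.
  apply: (ordleM tge1 (x := 0) (y := e)); rewrite ?add0r//.
    exact: ordle_cst.
  under eq_fun do rewrite wE.
  apply: ordleW (ordle_powt _ _) => //.
  rewrite /z -mulrA ger_pMr// mulrC ler_pdivrMr// mul1r ler_nat; lia.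
apply: (ordleM tge1 (x := x - y) (y := y)) => //.
  by rewrite subrK lerDl ltW.
apply: (ordleM tge1 (x := 0) (y := x - y)); rewrite ?add0r//.
  exact: ordle_cst.
under eq_fun do rewrite wE -powRN.
apply: ordleW (ordle_powt _ _) => //.
by rewrite lerNl opprB /z mulrAC ler_pdivlMr.
Qed.

End Interpolation.
End SciSpace.

(** * Limits and the action of inverses *)

Section RealSequences.
Variable K : realType.
Implicit Types (u v : nat -> K).

Lemma pow2V_gt0 d : 0 < (2^-1 : K) ^+ d.
Proof. by rewrite exprn_gt0// invr_gt0. Qed.

Lemma pow2V_le1 d : (2^-1 : K) ^+ d <= 1.
Proof. by rewrite exprn_ile1 ?invr_ge0// invf_le1// ler1n. Qed.

Lemma cvg0_pow2V (C : K) : (fun d => C * 2^-1 ^+ d) @ \oo --> (0 : K).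
Proof.
rewrite -(mulr0 C); apply: cvgMr; apply: cvg_expr.
by rewrite ger0_norm ?invr_ge0// invf_lt1// ltr1n.
Qed.

Lemma cvg0_le u v : (forall d, 0 <= u d <= v d) -> v @ \oo --> (0 : K) ->
  u @ \oo --> (0 : K).
Proof.
move=> uv v0; apply: (@squeeze_cvgr _ _ _ _ (fun=> 0) v) => //.
  by near=> d; exact: uv.
exact: cvg_cst.
Unshelve. all: by end_near. Qed.

Lemma cvg0_ge_le (x y : K) v : (forall d, x <= v d + y) -> v @ \oo --> (0 : K) ->
  x <= y.
Proof.
move=> xv v0; rewrite -[y]add0r.
have vy : (fun d => v d + y) @ \oo --> 0 + y by apply: cvgD v0 _; exact: cvg_cst.
by apply: cvgr_to_ge vy _; exact: nearW.
Qed.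

(** Discrete Gronwall: each step multiplies u_d + 1 by at most 1 + C 2^-d <= exp(C 2^-d), and the
    exponents add up to 2C(1 - 2^-d). The constant [C] may be large, which is the situation at high
    levels. *)
Lemma bounded_rec u (C : K) : 0 <= C -> (forall d, 0 <= u d) ->
  (forall d, u d.+1 <= C * 2^-1 ^+ d + u d * (1 + C * 2^-1 ^+ d)) ->
  exists2 M, 0 <= M & forall d, u d <= M.
Proof.
move=> C0 u0 uS; have w0 d := pow2V_gt0 d.
suff uM d : u d + 1 <= (u 0%N + 1) * expR (2 * C * (1 - 2^-1 ^+ d)).
  exists ((u 0%N + 1) * expR (2 * C)) => [|d].
    by rewrite mulr_ge0 ?expR_ge0// addr_ge0.
  have := uM d; rewrite -lerBrDr => /le_trans; apply.
  rewrite lerBlDr -[leLHS]addr0 lerD// ler_wpM2l ?addr_ge0// ler_expR.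
  by rewrite ler_piMr ?mulr_ge0// gerBl ltW.
elim: d => [|d IH]; first by rewrite expr0 subrr mulr0 expR0 mulr1.
have -> : 2 * C * (1 - 2^-1 ^+ d.+1) = 2 * C * (1 - 2^-1 ^+ d) + C * 2^-1 ^+ d.
  by rewrite exprS; field.
rewrite expRD mulrA.
rewrite (@le_trans _ _ ((u d + 1) * (1 + C * 2^-1 ^+ d)))//.
  rewrite (le_trans (lerD (uS d) (lexx 1)))//; lra.
rewrite ler_pM ?expR_ge1Dx ?addr_ge0 ?mulr_ge0 ?(ltW (w0 d))//.
Qed.

End RealSequences.

Section Limits.
Variables (K : realType) (X : sciSpace K) (r : K).
Hypothesis r01 : 0 < r <= 1.

Lemma lim_unique k (u : nat -> X r) x y : (forall d, dom X k r (u d)) ->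
  dom X k r x -> dom X k r y ->
  (fun d => nrm X k r (u d - x)) @ \oo --> (0 : K) ->
  (fun d => nrm X k r (u d - y)) @ \oo --> (0 : K) -> x = y.
Proof.
move=> du dx dy ux uy; apply/eqP; rewrite -subr_eq0; apply/eqP.
apply: (nrm_eq0 r01 (k := k)); first exact: dom_B.
apply/eqP; rewrite eq_le nrm_ge0 ?andbT; [|by []|exact: dom_B].
apply: (@cvg0_ge_le _ _ _ (fun d => nrm X k r (u d - x) + nrm X k r (u d - y))).
  move=> d; rewrite addr0 [leLHS](_ : _ = nrm X k r ((u d - y) - (u d - x))).
    by rewrite [leRHS]addrC nrm_B//; exact: dom_B.
  by congr nrm; rewrite opprB [RHS]addrC addrA subrK.
by rewrite -(addr0 0); exact: cvgD.
Qed.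

Lemma geometric_lim k (C : K) (u : nat -> X r) : 0 <= C ->
  (forall d, dom X k r (u d)) ->
  (forall d, nrm X k r (u d.+1 - u d) <= C * 2^-1 ^+ d) ->
  exists2 x, dom X k r x & (fun d => nrm X k r (u d - x)) @ \oo --> (0 : K).
Proof.
move=> C0 du uC.
have uij i n : nrm X k r (u (i + n)%N - u i) <= 2 * C * (2^-1 ^+ i - 2^-1 ^+ (i + n)).
  elim: n => [|n IH]; first by rewrite addn0 !subrr nrm_0// mulr0.
  have -> : u (i + n.+1)%N - u i =
      (u (i + n).+1 - u (i + n)%N) + (u (i + n)%N - u i).
    by rewrite addnS addrA subrK.
  rewrite (le_trans (nrm_D _ _ _))//; [exact: dom_B..|].
  rewrite (le_trans (lerD (uC _) IH))// addnS exprS; lra.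
apply: (bn_complete (sci_banach (sci_axioms X) k r01)) => // eps eps0.
have /cvgrPdist_lt/(_ _ eps0)[n0 _ n0P] := cvg0_pow2V (4 * C).
exists n0 => i j n0i n0j.
wlog ij : i j n0i n0j / (i <= j)%N.
  move=> wl; have [|/ltnW] := leqP i j; first exact: wl.
  by move=> /(wl _ _ n0j n0i); rewrite nrm_BC.
have := uij i (j - i)%N; rewrite subnKC// nrm_BC// => /le_lt_trans; apply.
have := n0P _ n0i; rewrite /= sub0r normrN ger0_norm; last first.
  by rewrite !mulr_ge0 ?exprn_ge0 ?invr_ge0.
apply: le_lt_trans.
have := pow2V_gt0 K i; have := pow2V_gt0 K j; nra.
Qed.

(** Completeness gives one limit per level. Two such limits are both limits at the smaller of their
    levels, hence equal. *)
Lemma geometric_lim_levels (good : nat -> Prop) (u : nat -> X r) k1 : good k1 ->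
  (forall k, good k -> forall d, dom X k r (u d)) ->
  (forall k, good k -> exists2 C, 0 <= C &
     forall d, nrm X k r (u d.+1 - u d) <= C * 2^-1 ^+ d) ->
  exists x, forall k, good k -> dom X k r x /\
    (fun d => nrm X k r (u d - x)) @ \oo --> (0 : K).
Proof.
move=> g1 du uC; have [C C0 CP] := uC _ g1.
have [x dx ux] := geometric_lim C0 (du _ g1) CP.
exists x => k gk; have [D D0 DP] := uC _ gk.
have [y dy uy] := geometric_lim D0 (du _ gk) DP.
suff -> : x = y by [].
have lower j j' z : (j <= j')%N -> (forall d, dom X j' r (u d)) ->
    dom X j' r z -> (fun d => nrm X j' r (u d - z)) @ \oo --> (0 : K) ->
    (fun d => nrm X j r (u d - z)) @ \oo --> (0 : K).
  move=> jj du' dz; apply: cvg0_le => d.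
  rewrite nrm_leq ?nrm_ge0//; last exact: dom_B.
  by apply: (dom_leq r01 jj); exact: dom_B.
apply: (@lim_unique (minn k1 k) u).
- by move=> d; apply: (dom_leq r01 (geq_minl _ _)); exact: du.
- exact: (dom_leq r01 (geq_minl _ _)).
- exact: (dom_leq r01 (geq_minr _ _)).
- by apply: (lower _ k1) => //; [exact: geq_minl|exact: du].
- by apply: (lower _ k) => //; [exact: geq_minr|exact: du].
Qed.

End Limits.

Section Shrinks.
Variables (K : realType) (X : sciSpace K).

Lemma shrinks_le c c' k r (x : X r) r' : c <= c' -> shrinks X c' k r x r' ->
  shrinks X c k r x r'.
Proof.
move=> cc [r01 dx r'0 r'P]; split=> //; apply: le_trans r'P _.
have /andP[r0 _] := r01.
by rewrite ler_pM2l// lerB// ler_wpM2r// nrm_ge0.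
Qed.

Lemma shrinks_nrm (c b : K) k r (x : X r) r' : 0 < r <= 1 -> dom X k r x -> 0 < r' ->
  0 <= c -> nrm X k r x <= b -> r' <= r * (1 - c * b) -> shrinks X c k r x r'.
Proof.
move=> r01 dx r'0 c0 xb r'P; split=> //; apply: le_trans r'P _.
have /andP[r0 _] := r01.
by rewrite ler_pM2l// lerB// ler_wpM2l.
Qed.

End Shrinks.

(** The action axiom is applied at the radius where the inverse exists, and restrictions bring the
    identity back to the radii [r], [x], [r']. The factor [2 * (gcst G + acst A)] pays for
    inverting, composing and acting. *)
Lemma act_inv (K : realType) (W : sciSpace K) (G : sciGroup W) (X : sciSpace K)
    (A : sciAction G X) (r x r' : K) (chi : W r) (f : X r) :
  shrinks W (2 * (gcst G + acst A)) 1 r chi x -> dom X 0 r f -> r' < x ->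
  shrinks W (acst A) 1 x (Defs.inv G r x chi) r' ->
  act A x r' (Defs.inv G r x chi) (act A r x chi f) = res X r r' f.
Proof.
move=> [r01 dchi x0 xP] df r'x shi.
have [_ _ r'0 _] := shi.
have g0 := gcst_gt0 G; have a0 := acst_gt0 A.
have n0 := nrm_ge0 r01 dchi; have /andP[r0 r1] := r01.
set n := nrm W 1 r chi in n0 xP.
have gn0 : 0 <= gcst G * n by rewrite mulr_ge0// ltW.
have an0 : 0 <= acst A * n by rewrite mulr_ge0// ltW.
have xP' : x <= r * (1 - 2 * (gcst G * n) - 2 * (acst A * n)).
  by apply: le_trans xP _; rewrite ler_pM2l//; lra.
have gn1 : 2 * (gcst G * n) + 2 * (acst A * n) < 1.
  have : 0 < r * (1 - 2 * (gcst G * n) - 2 * (acst A * n)) by exact: lt_le_trans x0 _.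
  by rewrite pmulr_rgt0//; lra.
(* The radius of the inverse in [inv_law]; [xy] below leaves room for one composition and one action
   starting from it. *)
pose y := (1 - gcst G / 2 * n) * r.
have yr : y <= r by rewrite /y; nra.
have xy : x <= y * (1 - gcst G * n - acst A * n).
  apply: le_trans xP' _; rewrite /y [_ * r]mulrC -[leRHS]mulrA ler_pM2l//.
  by rewrite mulrAC; move: (gcst G * n) (acst A * n) gn0 an0 => p p'; nra.
have y0 : 0 < y by rewrite /y pmulr_lgt0//; lra.
have y1 : y <= 1 by exact: le_trans yr r1.
have y01 : 0 < y <= 1 by rewrite y0.
have xley : x <= y by apply: le_trans xy _; nra.
have dres : dom W 1 y (res W r y chi) by exact: dom_res.
have nres : nrm W 1 y (res W r y chi) <= n by exact: nrm_res.
have idef : inv_def (gcst G) y chi.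
  split; last by rewrite -/n; lra.
  by split=> //; rewrite mulrC.
have dinv : dom W 1 y (Defs.inv G r y chi) by exact: (inv_dom G _ dchi).
have shg : shrinks W (gcst G) 1 r chi r'.
  split=> //; apply: (le_trans (ltW r'x)); apply: (le_trans xP').
  by rewrite ler_pM2l//; rewrite -/n; lra.
have r'y : r' < y by exact: lt_le_trans r'x _.
have [_ Einv] := inv_law G shg r'y.
have cdef : comp_def (gcst G) r' (res W r y chi).
  split=> //; apply: (shrinks_nrm (b := n)) => //; first exact: ltW.
  by apply: (le_trans (ltW r'x)); apply: (le_trans xy); rewrite ler_pM2l//; lra.
have sha : shrinks W (acst A) 1 y (res W r y chi) x.
  apply: (shrinks_nrm (b := n)) => //; first exact: ltW.
  by apply: (le_trans xy); rewrite ler_pM2l//; lra.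
have shax : shrinks W (acst A) 1 r chi x.
  by split=> //; apply: (le_trans xP'); rewrite ler_pM2l//; rewrite -/n; lra.
have Einvx : res W y x (Defs.inv G r y chi) = Defs.inv G r x chi.
  exact: inv_res_out.
have r'1 : r' <= 1 by exact: le_trans (ltW r'y) y1.
have sh0 : shrinks W (acst A) 1 r' (Defs.comp G y r' (Defs.inv G r y chi) (res W r y chi)) r'.
  rewrite Einv; split=> //; rewrite ?r'0//; first by apply: dom_0; rewrite r'0.
  by rewrite nrm_0 ?r'0// mulr0 subr0 mulr1.
have dfy : dom X 0 y (res X r y f) by exact: dom_res.
have := act_comp A dinv dfy cdef sh0 sha.
rewrite Einvx => /(_ shi); rewrite Einv act_id//; last by apply: dom_res => //; exact: ltW.
rewrite (act_res_in A)// => <-.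
by rewrite res_comp ?res_comp//; exact: ltW.
Qed.

Lemma rp_bounded (K : realType) n (P : radPoly K n) (a0 B : K) : 0 < a0 <= 1 ->
  exists2 C, 0 <= C & forall r x, a0 <= r <= 1 ->
    (forall i, 0 <= tnth x i <= B) -> 0 <= rp_eval P r x <= C.
Proof.
move=> a01.
(* With all pairs (radius, argument) of the box as index family, the constant of [rp_eval_le]
   becomes a uniform bound. *)
pose J := {p : K * n.-tuple K | (a0 <= p.1 <= 1) && [forall i, 0 <= tnth p.2 i <= B]}.
have J1 (j : J) : a0 <= (val j).1 <= 1 by case: j => /= p /andP[].
have J2 (j : J) i : 0 <= tnth (val j).2 i <= B by case: j => /= p /andP[_ /forallP].
have [|m _|C C0 CP] := rp_eval_le (P := P) a01 J1 (xx := fun j => (val j).2)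
    (Y := fun=> 1).
- by move=> j i; case/andP: (J2 j i).
- pose D : K := \prod_(i < n) `|B| ^+ mpoly.fun_of_multinom m i.
  exists D => [|j]; first by apply: prodr_ge0 => i _; rewrite exprn_ge0.
  rewrite mulr1; apply: ler_prod => i _; have /andP[x0 xB] := J2 j i.
  by rewrite exprn_ge0//= lerXn2r ?nnegrE// (le_trans xB)// ler_norm.
exists C => // r x ar xB.
have pJ : (a0 <= (r, x).1 <= 1) && [forall i, 0 <= tnth (r, x).2 i <= B].
  by rewrite ar; apply/forallP.
by have := CP (exist _ (r, x) pJ); rewrite mulr1.
Qed.

(** * Group and action estimates with uniform constants on bounded sets *)

Section Uniform.
Variables (K : realType) (W : sciSpace K) (G : sciGroup W) (X : sciSpace K)
  (A : sciAction G X) (a0 : K).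
Hypothesis a01 : 0 < a0 <= 1.

Lemma inv_bound_uniform k B : (1 <= k)%N -> exists2 C, 0 <= C &
  forall r r' chi, a0 <= r <= 1 -> dom W (2 * k - 1) r chi ->
    nrm W k r chi <= B -> shrinks W (gcst G) 1 r chi r' ->
    nrm_le W k r' (Defs.inv G r r' chi) (C * nrm W k r chi).
Proof.
move=> k1; have [P PP] := inv_bound G k1; have [C C0 CP] := rp_bounded P B a01.
exists C => // r r' chi ar dchi chiB sh.
have [r01 _ _ _] := sh; have dk : dom W k r chi by apply: (dom_leq r01) dchi; lia.
have [dinv /le_trans le] := PP _ _ _ dchi sh; split=> //; apply: le.
rewrite mulrC ler_wpM2r ?nrm_ge0//.
have tB i : 0 <= tnth [tuple nrm W k r chi] i <= B by rewrite (ord1 i) tnth0 nrm_ge0.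
by have /andP[_ ->] := CP r _ ar tB.
Qed.

Lemma comp_bound_uniform k B : (1 <= k)%N -> exists2 C, 0 <= C &
  forall r r' chi xi, a0 <= r <= 1 -> dom W k r chi -> dom W k r xi ->
    nrm W k r xi <= B -> comp_def (gcst G) r' xi ->
    (dom W k.+1 r chi ->
      nrm_le W k r' (Defs.comp G r r' chi xi - res W r r' chi)
        (C * nrm W k r xi * (1 + nrm W k.+1 r chi))) /\
    nrm_le W k r' (Defs.comp G r r' chi xi)
      (C * nrm W k r xi + nrm W k r chi * (1 + C * nrm W k r xi)).
Proof.
move=> k1; have [P [Q [R [L PP]]]] := comp_bound G k1.
have [C1 C10 C1P] := rp_bounded P B a01; have [C2 C20 C2P] := rp_bounded Q B a01.
have [C3 C30 C3P] := rp_bounded R B a01; have [C4 C40 C4P] := rp_bounded L B a01.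
exists (C1 + C2 + C3 + C4) => [|r r' chi xi ar dchi dxi xiB cdef].
  by rewrite !addr_ge0.
have [[r01 _ _ _] _] := cdef.
have x0 : 0 <= nrm W k r xi by exact: nrm_ge0.
have y0 : 0 <= nrm W k r chi by exact: nrm_ge0.
have tB i : 0 <= tnth [tuple nrm W k r xi] i <= B by rewrite (ord1 i) tnth0 x0.
have /andP[p0 pC] := C1P r _ ar tB; have /andP[q0 qC] := C2P r _ ar tB.
have /andP[s0 sC] := C3P r _ ar tB; have /andP[l0 lC] := C4P r _ ar tB.
have [PP1 [dc PP2]] := PP _ _ _ _ dchi dxi cdef.
move: p0 pC q0 qC s0 sC l0 lC PP1 PP2.
move: (rp_eval P _ _) (rp_eval Q _ _) (rp_eval R _ _) (rp_eval L _ _).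
move=> p q s l p0 pC q0 qC s0 sC l0 lC PP1 PP2; split.
  move=> /[dup] dchi1 /PP1[dd /le_trans le]; split=> //; apply: le.
  have z0 : 0 <= nrm W k.+1 r chi by exact: nrm_ge0.
  move: (nrm W k r xi) (nrm W k.+1 r chi) x0 z0 => x z x0 z0.
  have xz0 : 0 <= x * z by exact: mulr_ge0.
  have := mulr_ge0 x0 C20; have := mulr_ge0 x0 C30; have := mulr_ge0 x0 C40.
  have := mulr_ge0 xz0 C10; have := mulr_ge0 xz0 C30; have := mulr_ge0 xz0 C40.
  have := ler_wpM2l x0 pC; have := ler_wpM2l xz0 qC; lra.
split=> //; apply: le_trans PP2 _.
move: (nrm W k r xi) (nrm W k r chi) x0 y0 => x z x0 z0.
have xz0 : 0 <= x * z by exact: mulr_ge0.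
have := mulr_ge0 x0 C20; have := mulr_ge0 x0 C10; have := mulr_ge0 x0 C40.
have := mulr_ge0 xz0 C10; have := mulr_ge0 xz0 C30; have := mulr_ge0 xz0 C20.
have := ler_wpM2l x0 sC; have := ler_wpM2l xz0 lC; lra.
Qed.

Lemma act_cont_uniform k B : exists2 C, 0 <= C &
  forall r r' eta chi f, a0 <= r <= 1 -> dom W (k + agamma A) r eta ->
    dom W (k + agamma A) r chi -> dom X (k + agamma A) r f ->
    nrm W (k + agamma A) r eta <= B -> nrm W (k + agamma A) r chi <= B ->
    0 < r' -> r' <= (1 - acst A * (nrm W 1 r chi + nrm W 1 r eta)) * r ->
    nrm_le X k r' (act A r r' (eta + chi) f - act A r r' eta f)
      (C * nrm W (k + agamma A) r chi * nrm X (k + agamma A) r f).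
Proof.
have [P PP] := act_cont A k; have [C C0 CP] := rp_bounded P B a01.
exists C => // r r' eta chi f ar deta dchi df etaB chiB r'0 r'r.
have r01 : 0 < r <= 1.
  by move: a01 ar => /andP[a0' _] /andP[/(lt_le_trans a0') -> ->].
have [dd /le_trans le] := PP _ _ _ _ _ r01 deta dchi df r'0 r'r; split=> //; apply: le.
rewrite mulrC -[leRHS]mulrA ler_wpM2r ?mulr_ge0 ?nrm_ge0//.
have tB i : 0 <= tnth [tuple nrm W (k + agamma A) r eta; nrm W (k + agamma A) r chi] i
    <= B by case: i => [[|[|//]]] ?; rewrite (tnth_nth 0)/= nrm_ge0.
by have /andP[_ ->] := CP r _ ar tB.
Qed.

End Uniform.

(** * The decreasing sequences of radii *)

Section Radii.
Variables (K : realType) (R : K).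
Hypothesis R01 : 0 < R <= 1.

(** The iterate f_d lives at [rr d], and phi_d at [rm d], the midpoint of [rr d.+1] and [rr d].
    These radii exceed 3R/4; below them, [rho d] carries theta_d and decreases from 11R/16 to
    [rinf]. The limits live at [rinf], psi at [sigma], and the result at R/2. The gaps are of order
    2^-d, to match corrections of size O(2^-d). *)
Definition rr (d : nat) : K := R * (3 / 4 + 4^-1 * 2^-1 ^+ d).
Definition rm (d : nat) : K := R * (3 / 4 + 3 / 16 * 2^-1 ^+ d).
Definition rho (d : nat) : K := R * (5 / 8 + 16^-1 * 2^-1 ^+ d).
Definition rinf : K := R * (5 / 8).
Definition sigma : K := R * (9 / 16).

Local Ltac radtac d := case/andP: R01 => [R0 R1];
  have w0 := pow2V_gt0 K d; have w1 := pow2V_le1 K d;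
  rewrite /rr /rm /rho /rinf /sigma ?exprS; nra.

Lemma rr0 : rr 0 = R. Proof. by rewrite /rr expr0; field. Qed.
Lemma rr_bound d : R / 2 <= rr d <= 1. Proof. by apply/andP; split; radtac d. Qed.
Lemma rm_bound d : R / 2 <= rm d <= 1. Proof. by apply/andP; split; radtac d. Qed.
Lemma rho_bound d : R / 2 <= rho d <= 1. Proof. by apply/andP; split; radtac d. Qed.
Lemma rinf_bound : R / 2 <= rinf <= 1. Proof. by apply/andP; split; radtac 0%N. Qed.
Lemma sigma_bound : R / 2 <= sigma <= 1. Proof. by apply/andP; split; radtac 0%N. Qed.
Lemma rm_rr d : rm d <= rr d. Proof. radtac d. Qed.
Lemma rr_rm d : rr d.+1 <= rm d. Proof. radtac d. Qed.
Lemma rho_rr d : rho d <= rr d.+1. Proof. radtac d. Qed.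
Lemma rho_rr0 d : rho d <= rr d. Proof. radtac d. Qed.
Lemma rhoS d : rho d.+1 < rho d. Proof. radtac d. Qed.
Lemma rinf_rho d : rinf <= rho d. Proof. radtac d. Qed.
Lemma sigma_rinf : sigma < rinf. Proof. radtac 0%N. Qed.
Lemma half_sigma : R / 2 < sigma. Proof. radtac 0%N. Qed.
Lemma half_bound : 0 < R / 2 <= 1.
Proof. by case/andP: R01 => R0 R1; apply/andP; split; lra. Qed.

Let gt0 r : R / 2 <= r <= 1 -> 0 < r <= 1.
Proof. by case/andP: half_bound => a0 _ /andP[/(lt_le_trans a0)-> ->]. Qed.

Lemma rr01 d : 0 < rr d <= 1. Proof. exact: gt0 (rr_bound d). Qed.
Lemma rm01 d : 0 < rm d <= 1. Proof. exact: gt0 (rm_bound d). Qed.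
Lemma rho01 d : 0 < rho d <= 1. Proof. exact: gt0 (rho_bound d). Qed.
Lemma rinf01 : 0 < rinf <= 1. Proof. exact: gt0 rinf_bound. Qed.
Lemma sigma01 : 0 < sigma <= 1. Proof. exact: gt0 sigma_bound. Qed.

Let mul_shrink b b' x y : 0 <= b <= 1 -> 0 <= y -> x <= y -> b' <= b - y ->
  R * b' <= R * b * (1 - x).
Proof.
case/andP: R01 => R0 _ /andP[b0 b1] y0 xy b'b; rewrite -mulrA ler_pM2l//.
have := ler_wpM2l b0 xy; have := ler_piMl y0 b1; lra.
Qed.

Local Ltac shrinktac d y := have w0 := pow2V_gt0 K d; have w1 := pow2V_le1 K d;
  move=> xP; apply: (mul_shrink (y := y)) => //; rewrite ?exprS; lra.

Lemma rm_shrink d x : x <= 16^-1 * 2^-1 ^+ d -> rm d <= rr d * (1 - x).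
Proof. shrinktac d (16^-1 * 2^-1 ^+ d : K). Qed.
Lemma rr_shrink d x : x <= 16^-1 * 2^-1 ^+ d -> rr d.+1 <= rm d * (1 - x).
Proof. shrinktac d (16^-1 * 2^-1 ^+ d : K). Qed.
Lemma rho_shrink d x : x <= 32^-1 * 2^-1 ^+ d -> rho d.+1 <= rho d * (1 - x).
Proof. shrinktac d (32^-1 * 2^-1 ^+ d : K). Qed.
Lemma rr_rho_shrink d x : x <= 16^-1 -> rho d.+1 <= rr d.+1 * (1 - x).
Proof. shrinktac d (16^-1 : K). Qed.
Lemma sigma_shrink x : x <= 16^-1 -> sigma <= rinf * (1 - x).
Proof. shrinktac 0%N (16^-1 : K). Qed.
Lemma rho_sigma_shrink d x : x <= 16^-1 -> sigma <= rho d * (1 - x).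
Proof. shrinktac d (16^-1 : K). Qed.
Lemma half_shrink x : x <= 16^-1 -> R / 2 <= sigma * (1 - x).
Proof. shrinktac 0%N (16^-1 : K). Qed.
End Radii.

(** * The limit in the group *)

Section GroupLimit.
Variables (K : realType) (T : sciSpace K) (W : sciSpace K) (G : sciGroup W)
  (A : sciAction G T) (G0 : sciSubset W) (R : K).
Hypotheses (R01 : 0 < R <= 1) (G0_closed : closedSubgroup G G0).

Let M : K := 2 * (gcst G + acst A).

Section Theta.
(** [C1] and [C2] are the constants of inversion and composition at level 1, the level that governs
    the radius losses in the group. The theta_d stay in the ball of radius [nu] as soon as chi_d has
    size at most [kap] 2^-d. *)
Variables (C1 C2 nu kap : K).
Hypotheses (C1ge1 : 1 <= C1) (C2ge1 : 1 <= C2) (nu0 : 0 < nu) (kap0 : 0 < kap)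
  (C1nu : C1 * nu <= 64^-1) (MC1nu : M * (C1 * nu) <= 64^-1)
  (C12kap : 4 * C2 * (C1 * kap) <= nu).
Hypothesis inv1 : forall r r' chi, R / 2 <= r <= 1 -> dom W 1 r chi ->
  nrm W 1 r chi <= 1 -> shrinks W (gcst G) 1 r chi r' ->
  nrm_le W 1 r' (Defs.inv G r r' chi) (C1 * nrm W 1 r chi).
Hypothesis comp1 : forall r r' chi xi, R / 2 <= r <= 1 -> dom W 1 r chi ->
  dom W 1 r xi -> nrm W 1 r xi <= 1 -> comp_def (gcst G) r' xi ->
  nrm_le W 1 r' (Defs.comp G r r' chi xi)
    (C2 * nrm W 1 r xi + nrm W 1 r chi * (1 + C2 * nrm W 1 r xi)).

Variables (fs : forall d, T (rr R d)) (ch : forall d, W (rm R d)).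
Hypotheses (ch_G0 : forall j d, G0 j (rm R d) (ch d))
  (ch_small : forall d, nrm W 1 (rm R d) (ch d) <= kap * 2^-1 ^+ d)
  (fs_dom : forall d, dom T 0 (rr R d) (fs d))
  (fsS : forall d, fs d.+1 =
    act A (rm R d) (rr R d.+1) (ch d) (res T (rr R d) (rm R d) (fs d))).

Let w0 d : 0 < (2^-1 : K) ^+ d := pow2V_gt0 K d.
Let w1 d : (2^-1 : K) ^+ d <= 1 := pow2V_le1 K d.
Let rr1 d := rr01 R01 d.
Let rm1 d := rm01 R01 d.
Let rho1 d := rho01 R01 d.
Let gt0 (r : K) : 0 < r <= 1 -> 0 < r. Proof. by case/andP. Qed.
Let le1 (r : K) : 0 < r <= 1 -> r <= 1. Proof. by case/andP. Qed.
Let g0 : 0 < gcst G := gcst_gt0 G.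
Let al0 : 0 < acst A := acst_gt0 A.
Let M0 : 0 < M. Proof. by rewrite /M mulr_gt0// addr_gt0. Qed.
Let gM : gcst G <= M. Proof. by move: g0 al0; rewrite /M; lra. Qed.
Let alM : acst A <= M. Proof. by move: g0 al0; rewrite /M; lra. Qed.
Let nu64 : nu <= 64^-1.
Proof. by apply: le_trans C1nu; rewrite ler_peMl// ltW. Qed.
Let nu1 : nu <= 1. Proof. by move: nu64; lra. Qed.
Let MC1 (x : K) : 0 <= x -> x <= C1 * nu -> M * x <= 64^-1.
Proof. by move=> x0 xn; apply: le_trans MC1nu; rewrite ler_pM2l. Qed.
Let C1kap : C1 * kap <= nu / 4.
Proof.
have : C1 * kap <= C2 * (C1 * kap).
  by rewrite ler_peMl// mulr_ge0 ?(ltW kap0)// (le_trans ler01).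
by move: C12kap; lra.
Qed.
Let kapnu : kap <= nu / 4.
Proof. by apply: le_trans C1kap; rewrite ler_peMl// ltW. Qed.
Let nuC1nu : nu <= C1 * nu. Proof. by rewrite ler_peMl// ltW. Qed.

Local Ltac rad := solve [ by [] | by apply: gt0 | by apply: le1 | by apply: ltW
  | exact: rho_rr | exact: rho_rr0 | exact: rm_rr | exact: rr_rm | exact: rinf_rho
  | by apply/ltW/rhoS | exact: ltW (sigma_rinf R01) ].

Let ch_dom j d : dom W j (rm R d) (ch d).
Proof. exact: (sub_dom G0 (rm1 d) _ (ch_G0 j d)). Qed.

Let ch_shrinks d : shrinks W M 1 (rm R d) (ch d) (rr R d.+1).
Proof.
apply: (shrinks_nrm (b := kap * 2^-1 ^+ d)); try rad.
apply: rr_shrink => //; rewrite mulrA ler_pM2r//.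
apply: (@le_trans _ _ 64^-1); last by lra.
by apply: MC1; [exact: ltW|move: kapnu nuC1nu nu0; lra].
Qed.

Let ch_inv_def d : inv_def (gcst G) (rr R d.+1) (ch d).
Proof.
split; first by apply: (shrinks_le _ (ch_shrinks d)); move: gM g0; lra.
have n0 := nrm_ge0 (rm1 d) (ch_dom 1 d).
apply: (@le_lt_trans _ _ (M * kap)).
  apply: ler_pM => //; first exact: ltW.
  by apply: (le_trans (ch_small d)); rewrite ler_piMr// ltW.
have : M * kap <= 64^-1 by apply: MC1; [exact: ltW|move: kapnu nuC1nu nu0; lra].
lra.
Qed.

Definition eta d : W (rr R d.+1) := Defs.inv G (rm R d) (rr R d.+1) (ch d).
Definition etar d : W (rho R d) := res W (rr R d.+1) (rho R d) (eta d).

Fixpoint theta d : W (rho R d) :=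
  if d is d'.+1 then Defs.comp G (rho R d') (rho R d) (theta d') (etar d') else 0.

Lemma eta_G0 k d : (1 <= k)%N -> G0 k (rr R d.+1) (eta d).
Proof. by move=> k1; apply: (csg_inv G0_closed). Qed.

Lemma etar_G0 k d : (1 <= k)%N -> G0 k (rho R d) (etar d).
Proof.
move=> k1; apply: (sub_res G0); [exact: gt0|exact: rho_rr|exact: le1|exact: eta_G0].
Qed.

Let eta_dom k d : (1 <= k)%N -> dom W k (rr R d.+1) (eta d).
Proof. by move=> k1; exact: (sub_dom G0 (rr1 _) _ (eta_G0 d k1)). Qed.

Let etar_dom k d : (1 <= k)%N -> dom W k (rho R d) (etar d).
Proof. by move=> k1; exact: (sub_dom G0 (rho1 _) _ (etar_G0 d k1)). Qed.

Let etar_eta k d : (1 <= k)%N ->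
  nrm W k (rho R d) (etar d) <= nrm W k (rr R d.+1) (eta d).
Proof.
move=> k1; apply: nrm_res; [exact: gt0|exact: rho_rr|exact: le1|exact: eta_dom].
Qed.

Lemma eta_small d : nrm W 1 (rr R d.+1) (eta d) <= C1 * kap * 2^-1 ^+ d.
Proof.
have [|_ le] := inv1 (rm_bound R01 d) (ch_dom 1 d) _ (shrinks_le gM (ch_shrinks d)).
  apply: le_trans (ch_small d) _; rewrite mulr_ile1 ?(ltW kap0) ?(ltW (w0 d))//.
  by move: kapnu nu1; lra.
by apply: (le_trans le); rewrite -mulrA ler_wpM2l// (le_trans ler01).
Qed.

Let etar_small d : nrm W 1 (rho R d) (etar d) <= C1 * kap * 2^-1 ^+ d.
Proof. exact: le_trans (etar_eta d (leqnn _)) (eta_small d). Qed.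

Let C1kapw d : C1 * kap * 2^-1 ^+ d <= nu / 4.
Proof.
apply: le_trans C1kap; rewrite ler_piMr//.
by rewrite mulr_ge0 ?(ltW kap0)// (le_trans ler01).
Qed.

Let C1kap0 : 0 <= C1 * kap. Proof. by rewrite mulr_ge0 ?(ltW kap0)// (le_trans ler01). Qed.

Lemma etar_comp_def d : comp_def (gcst G) (rho R d.+1) (etar d).
Proof.
split; last exact: rhoS.
apply: (shrinks_le gM); apply: (shrinks_nrm (b := C1 * kap * 2^-1 ^+ d)) => //.
- exact: etar_dom.
- exact: gt0.
- exact: ltW.
apply: rho_shrink => //; rewrite mulrA ler_pM2r//.
apply: (@le_trans _ _ 64^-1); last by lra.
by apply: MC1 => //; move: C1kap nuC1nu nu0; lra.
Qed.

Lemma theta_G0 k d : (1 <= k)%N -> G0 k (rho R d) (theta d).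
Proof.
move=> k1; elim: d => [|d IH]; first exact: (csg_id G0_closed).
by apply: (csg_comp G0_closed) => //; [exact: etar_G0|exact: etar_comp_def].
Qed.

Let theta_dom k d : (1 <= k)%N -> dom W k (rho R d) (theta d).
Proof. by move=> k1; exact: (sub_dom G0 (rho1 _) _ (theta_G0 d k1)). Qed.

Lemma theta_small d : nrm W 1 (rho R d) (theta d) <= nu.
Proof.
(* The increment from d to d+1 is at most nu 2^-(d+1): [comp1] adds two terms, each at most nu/4 *
   2^-d. *)
suff : nrm W 1 (rho R d) (theta d) <= nu * (1 - 2^-1 ^+ d).
  by move=> /le_trans; apply; rewrite ger_pMr// gerBl ltW.
elim: d => [|d IH]; first by rewrite nrm_0// expr0 subrr mulr0.
have etas := etar_small d.
have [|_ /le_trans le] := comp1 (rho_bound R01 d) (theta_dom d (leqnn 1))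
    (etar_dom d (leqnn 1)) _ (etar_comp_def d).
  by move: etas (C1kapw d) nu1; lra.
apply: le; have e0 := nrm_ge0 (rho1 d) (etar_dom d (leqnn 1)).
have th1 : nrm W 1 (rho R d) (theta d) <= 1.
  apply: (le_trans IH); apply: le_trans nu1.
  by rewrite ger_pMr// gerBl ltW.
have C2e : C2 * nrm W 1 (rho R d) (etar d) <= nu / 4 * 2^-1 ^+ d.
  rewrite (@le_trans _ _ (C2 * (C1 * kap * 2^-1 ^+ d)))//.
    by rewrite ler_wpM2l// (le_trans ler01).
  by rewrite mulrA ler_pM2r//; move: C12kap; lra.
have C2e0 : 0 <= C2 * nrm W 1 (rho R d) (etar d).
  by rewrite mulr_ge0// (le_trans ler01).
have th0 := nrm_ge0 (rho1 d) (theta_dom d (leqnn 1)).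
have := ler_piMl C2e0 th1.
rewrite exprS; move: IH C2e; lra.
Qed.

Let act_small r x (chi : W r) : 0 < r <= 1 -> 0 < x -> dom W 1 r chi ->
  nrm W 1 r chi <= C1 * nu -> (forall y, y <= 16^-1 -> x <= r * (1 - y)) ->
  shrinks W (acst A) 1 r chi x.
Proof.
move=> r01 x0 dchi cn xr; apply: (shrinks_le alM).
apply: (shrinks_nrm (b := C1 * nu)) => //; first exact: ltW.
by apply: xr; move: MC1nu; lra.
Qed.

Lemma eta_act d : act A (rr R d.+1) (rho R d.+1) (eta d) (fs d.+1) =
  res T (rr R d) (rho R d.+1) (fs d).
Proof.
rewrite fsS /eta act_inv.
- apply: res_comp; try rad.
  exact: le_trans (rho_rr0 R01 _) (rr_rm R01 _).
- exact: ch_shrinks.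
- by apply: dom_res => //; [exact: gt0|exact: rm_rr|exact: le1].
- exact: lt_le_trans (rhoS R01 _) (rho_rr R01 _).
apply: act_small => //; [exact: gt0|exact: (eta_dom d (leqnn 1))| |].
  by apply: (le_trans (eta_small d)); move: (C1kapw d) nuC1nu nu0; lra.
by move=> y; exact: rr_rho_shrink.
Qed.

Let theta_shrinks d : shrinks W (acst A) 1 (rho R d) (theta d) (sigma R).
Proof.
apply: act_small => //; [exact/gt0/sigma01|exact: theta_dom| |].
  exact: le_trans (theta_small d) nuC1nu.
by move=> y; exact: rho_sigma_shrink.
Qed.

(** By induction, theta_{d+1} . f_{d+1} = theta_d . (phi_d^-1 . f_{d+1}) = theta_d . f_d. The target
    radius [sigma R] does not depend on d, so that the identity can pass to the limit. *)
Lemma theta_act d : act A (rho R d) (sigma R) (theta d)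
    (res T (rr R d) (rho R d) (fs d)) = res T (rr R 0) (sigma R) (fs 0%N).
Proof.
have sig0 : 0 < sigma R by exact/gt0/sigma01.
have sr d' : sigma R <= rho R d'.
  exact: (le_trans (ltW (sigma_rinf R01)) (rinf_rho R01 d')).
elim: d => [|d IH].
  rewrite act_id//; [|exact: le1|]; last first.
    by apply: dom_res => //; [exact: gt0|exact: rho_rr0|exact: le1].
  by apply: res_comp; rad.
have fsr : dom T 0 (rho R d) (res T (rr R d.+1) (rho R d) (fs d.+1)).
  by apply: dom_res => //; [exact: gt0|exact: rho_rr|exact: le1].
have rd := rhoS R01 d.
have sh2 : shrinks W (acst A) 1 (rho R d) (etar d) (rho R d.+1).
  apply: (shrinks_le alM); apply: (shrinks_nrm (b := C1 * kap * 2^-1 ^+ d)) => //.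
  - exact: etar_dom.
  - exact: gt0.
  - exact: ltW.
  apply: rho_shrink => //; rewrite mulrA ler_pM2r//.
  apply: (@le_trans _ _ 64^-1); last by lra.
  by apply: MC1 => //; move: C1kap nuC1nu nu0; lra.
have sh2' : shrinks W (acst A) 1 (rr R d.+1) (eta d) (rho R d.+1).
  apply: act_small => //; [exact: gt0|exact: (eta_dom d (leqnn 1))| |].
    by apply: (le_trans (eta_small d)); move: (C1kapw d) nuC1nu nu0; lra.
  by move=> y; exact: rr_rho_shrink.
have dth : dom W 1 (rho R d) (theta d) by exact: theta_dom.
have shr : shrinks W (acst A) 1 (rho R d.+1)
    (res W (rho R d) (rho R d.+1) (theta d)) (sigma R).
  apply: act_small => //.
  - by apply: dom_res => //; [exact: gt0|exact: ltW|exact: le1].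
  - apply: le_trans nuC1nu; apply: le_trans (theta_small d).
    by apply: nrm_res => //; [exact: gt0|exact: ltW|exact: le1].
  by move=> y; exact: rho_sigma_shrink.
have := act_comp A dth fsr (etar_comp_def d) (theta_shrinks d.+1) sh2 shr.
rewrite res_comp; try rad.
move=> ->; rewrite /etar (act_res_in A)//; [|exact: gt0|exact: rho_rr].
rewrite eta_act -IH.
rewrite -(res_comp (X := T) (r' := rho R d)); try rad.
rewrite (act_res_in A)//; [exact: gt0|exact: ltW|].
by apply: dom_res => //; [exact: gt0|exact: rho_rr0|exact: le1].
Qed.

(** What makes theta_d and f_d converge at level k. The bound on [ch] is at level k+1 because the
    estimate of phi o psi - phi in [comp_bound] involves the left factor, here theta_d, one level
    higher. *)
Definition good k := [/\ (1 <= k)%N,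
  exists2 C, 0 <= C & forall d, nrm W k.+1 (rm R d) (ch d) <= C * 2^-1 ^+ d,
  forall d, dom T k (rr R d) (fs d) &
  exists2 C, 0 <= C & forall d, nrm T k (rr R d.+1)
    (fs d.+1 - res T (rr R d) (rr R d.+1) (fs d)) <= C * 2^-1 ^+ d].

Let thr d : W (rinf R) := res W (rho R d) (rinf R) (theta d).
Let fsr d : T (rinf R) := res T (rr R d) (rinf R) (fs d).

Let i1 := rinf01 R01.
Let i0 : 0 < rinf R. Proof. exact: gt0. Qed.

Lemma eta_level k : (1 <= k)%N ->
  (exists2 C, 0 <= C & forall d, nrm W k (rm R d) (ch d) <= C * 2^-1 ^+ d) ->
  exists2 C, 0 <= C & forall d, nrm W k (rho R d) (etar d) <= C * 2^-1 ^+ d.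
Proof.
move=> k1 [C C0 CP]; have [D D0 DP] := inv_bound_uniform G (half_bound R01) C k1.
exists (D * C) => [|d]; first exact: mulr_ge0.
apply: (le_trans (etar_eta d k1)).
(* Level 2k-1 enters through membership only, and [ch d] belongs to all levels. *)
have [|_ le] := DP _ _ _ (rm_bound R01 d) (ch_dom (2 * k - 1) d) _
   (shrinks_le gM (ch_shrinks d)).
  by apply: le_trans (CP d) _; rewrite ler_piMr.
by apply: (le_trans le); rewrite -mulrA ler_wpM2l.
Qed.

(** The second estimate of [comp_bound] loses no derivative, so it is a recursion at level k alone,
    of the form treated by [bounded_rec]. *)
Lemma theta_bounded k : (1 <= k)%N ->
  (exists2 C, 0 <= C & forall d, nrm W k (rm R d) (ch d) <= C * 2^-1 ^+ d) ->
  exists2 B, 0 <= B & forall d, nrm W k (rho R d) (theta d) <= B.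
Proof.
move=> k1 /(eta_level k1)[C C0 CP].
have [D D0 DP] := comp_bound_uniform G (half_bound R01) C k1.
have n0 d : 0 <= nrm W k (rho R d) (theta d) by apply: nrm_ge0 => //; exact: theta_dom.
apply: (bounded_rec (C := D * C)) => // [|d]; first exact: mulr_ge0.
have [|_ [_ le]] := DP _ _ _ _ (rho_bound R01 d) (theta_dom d k1) (etar_dom d k1) _
    (etar_comp_def d).
  by apply: le_trans (CP d) _; rewrite ler_piMr.
apply: (le_trans le); have De : D * nrm W k (rho R d) (etar d) <= D * C * 2^-1 ^+ d.
  by rewrite -mulrA ler_wpM2l.
by rewrite lerD// ler_wpM2l// lerD.
Qed.

Let thr_dom k d : (1 <= k)%N -> dom W k (rinf R) (thr d).
Proof.
move=> k1; apply: dom_res => //; [exact: rinf_rho|exact: le1|exact: theta_dom].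
Qed.

Lemma thr_diff k : good k -> exists2 C, 0 <= C &
  forall d, nrm W k (rinf R) (thr d.+1 - thr d) <= C * 2^-1 ^+ d.
Proof.
move=> [k1 [C C0 CP] _ _].
have chk : exists2 C, 0 <= C & forall d, nrm W k (rm R d) (ch d) <= C * 2^-1 ^+ d.
  exists C => // d; apply: le_trans (CP d); apply: nrm_leq => //; exact: ch_dom.
have [E E0 EP] := eta_level k1 chk.
have [B B0 BP] := theta_bounded (k := k.+1) isT (ex_intro2 _ _ C C0 CP).
have [D D0 DP] := comp_bound_uniform G (half_bound R01) E k1.
exists (D * E * (1 + B)) => [|d]; first by rewrite !mulr_ge0// addr_ge0.
have [|le _] := DP _ _ _ _ (rho_bound R01 d) (theta_dom d k1) (etar_dom d k1) _
    (etar_comp_def d).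
  by apply: le_trans (EP d) _; rewrite ler_piMr.
have [dd {}le] := le (theta_dom d (leqW k1)).
have -> : thr d.+1 - thr d = res W (rho R d.+1) (rinf R)
    (theta d.+1 - res W (rho R d) (rho R d.+1) (theta d)).
  rewrite linearB/= /thr (res_comp (r' := rho R d.+1)); try rad.
  by apply: (dom_leq (rho1 d) (leq0n 1)); exact: theta_dom.
apply: (@le_trans _ _ _ _ _ (nrm_res _ _ _ dd)) => //.
- exact: rinf_rho.
- exact: le1.
apply: (le_trans le).
rewrite -[leRHS]mulrA [_ * 2^-1 ^+ d]mulrC mulrA.
have e0 := nrm_ge0 (rho1 d) (etar_dom d k1).
have t0 := nrm_ge0 (rho1 d) (theta_dom d (leqW k1)).
by rewrite ler_pM ?mulr_ge0 ?addr_ge0// -?mulrA ?ler_wpM2l// lerD.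
Qed.

Lemma fsr_diff k : good k -> exists2 C, 0 <= C &
  forall d, nrm T k (rinf R) (fsr d.+1 - fsr d) <= C * 2^-1 ^+ d.
Proof.
move=> [k1 _ df [C C0 CP]]; exists C => // d; apply: le_trans (CP d).
have ir d' : rinf R <= rr R d' by exact: le_trans (rinf_rho R01 _) (rho_rr0 R01 d').
have rrS : rr R d.+1 <= rr R d by exact: le_trans (rr_rm R01 d) (rm_rr R01 d).
have -> : fsr d.+1 - fsr d = res T (rr R d.+1) (rinf R)
    (fs d.+1 - res T (rr R d) (rr R d.+1) (fs d)).
  by rewrite linearB/= /fsr (res_comp (r' := rr R d.+1))//; rad.
apply: nrm_res => //; first exact: le1.
apply: dom_B => //; apply: dom_res => //; [exact: gt0|exact: le1].
Qed.

(** The identity theta_d . f_d = f_0 passes to the limit at level 0, where convergence at level l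
    suffices because continuity of the action loses [agamma A <= l] levels. Then [act_inv] turns th
    . f_oo = f_0 into th^-1 . f_0 = f_oo. *)
Lemma group_limit l : good l -> (agamma A <= l)%N ->
  exists (psi : W (sigma R)) (finf : T (rinf R)),
  [/\ forall k, good k -> G0 k (sigma R) psi,
      shrinks W (acst A) 1 (sigma R) psi (R / 2),
      act A (sigma R) (R / 2) psi (res T (rr R 0) (sigma R) (fs 0%N)) =
        res T (rinf R) (R / 2) finf &
      forall k, good k -> dom T k (rinf R) finf /\
        (fun d => nrm T k (rinf R) (fsr d - finf)) @ \oo --> (0 : K)].
Proof.
move=> gl gal.
have ir d' : rinf R <= rr R d' by exact: le_trans (rinf_rho R01 _) (rho_rr0 R01 d').
have good1 k : good k -> (1 <= k)%N by case.
have [th thP] : exists x, forall k, good k -> dom W k (rinf R) x /\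
    (fun d => nrm W k (rinf R) (thr d - x)) @ \oo --> (0 : K).
  apply: geometric_lim_levels gl _ thr_diff => // k /good1 k1 d.
  exact: thr_dom.
have dfsr k : good k -> forall d, dom T k (rinf R) (fsr d).
  by move=> [_ _ df _] d; apply: dom_res => //; exact: le1.
have [fi fiP] : exists x, forall k, good k -> dom T k (rinf R) x /\
    (fun d => nrm T k (rinf R) (fsr d - x)) @ \oo --> (0 : K).
  by apply: geometric_lim_levels gl _ fsr_diff.
have l1 := good1 _ gl; have [dthl thl] := thP _ gl; have [dfil fil] := fiP _ gl.
have dth1 := dom_leq i1 l1 dthl.
have thG0 k : good k -> G0 k (rinf R) th.
  move=> gk; have [dk ck] := thP _ gk.
  apply: (csg_closed G0_closed i1 (u := thr)) => // d.
  apply: (sub_res G0) => //; [exact: rinf_rho|exact: le1|apply: theta_G0; exact: good1].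
have thr_small d : nrm W 1 (rinf R) (thr d) <= nu.
  apply: le_trans (theta_small d); apply: nrm_res => //.
  - exact: rinf_rho.
  - exact: le1.
  - exact: theta_dom.
have diff_cvg : (fun d => nrm W 1 (rinf R) (thr d - th)) @ \oo --> (0 : K).
  apply: cvg0_le thl => d; rewrite nrm_ge0 ?nrm_leq//; apply: dom_B => //; exact: thr_dom.
have th_small : nrm W 1 (rinf R) th <= nu.
  apply: cvg0_ge_le diff_cvg => d; rewrite nrm_BC//; last exact: thr_dom.
  rewrite (le_trans (nrm_tri i1 dth1 (thr_dom d (leqnn 1))))//.
  by rewrite lerD2l.
have sig0 : 0 < sigma R by exact/gt0/sigma01.
have si := sigma_rinf R01.
have th_shM : shrinks W M 1 (rinf R) th (sigma R).
  apply: (shrinks_nrm (b := nu)) => //; first exact: ltW.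
  apply: sigma_shrink => //; have := MC1 (ltW nu0) nuC1nu; lra.
have th_act : act A (rinf R) (sigma R) th fi = res T (rr R 0) (sigma R) (fs 0%N).
  pose y := res T (rr R 0) (sigma R) (fs 0%N).
  have ith d : act A (rinf R) (sigma R) (thr d) (fsr d) = y.
    rewrite /y -(theta_act d) -(act_res_in A i0 (rinf_rho R01 d) _ (theta_shrinks d)).
    - by congr act; rewrite res_comp//; rad.
    - by apply: dom_res => //; [exact: gt0|exact: rho_rr0|exact: le1].
    apply: act_small => //; [exact: thr_dom| |by move=> z; exact: sigma_shrink].
    exact: le_trans (thr_small d) nuC1nu.
  have dy : dom T 0 (sigma R) y.
    by apply: dom_res => //; [exact: le_trans (ltW si) (ir _)|exact: le1].
  have thsh : shrinks W (acst A) 1 (rinf R) th (sigma R) by exact: shrinks_le alM th_shM.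
  have dfi0 := dom_leq i1 (leq0n l) dfil.
  have ds1 := sigma01 R01.
  have dact : dom T 0 (sigma R) (act A (rinf R) (sigma R) th fi).
    by apply: act_dom thsh => //; exact: (dom_leq i1 (leq0n l)).
  suff /(nrm_eq0 ds1 (dom_B ds1 dact dy))/eqP : nrm T 0 (sigma R)
      (act A (rinf R) (sigma R) th fi - y) = 0.
    by rewrite subr_eq0 => /eqP.
  have [_ [C C0 CP] _ _] := gl.
  have chl : exists2 C, 0 <= C & forall d, nrm W l (rm R d) (ch d) <= C * 2^-1 ^+ d.
    exists C => // d; apply: le_trans (CP d); apply: nrm_leq => //; exact: ch_dom.
  have [B B0 BP] := theta_bounded l1 chl.
  have thrB d : nrm W l (rinf R) (thr d) <= B.
    apply: le_trans (BP d); apply: nrm_res => //.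
    - exact: rinf_rho.
    - exact: le1.
    - exact: theta_dom.
  set Bt := B + nrm W l (rinf R) th.
  have BBt : B <= Bt by rewrite lerDl nrm_ge0.
  have [D D0 DP] := act_cont_uniform A (half_bound R01) 0 Bt; rewrite !add0n in DP.
  have ib := rinf_bound R01.
  have dthr d : dom W l (rinf R) (thr d) by exact: thr_dom.
  have ddiff d : dom W l (rinf R) (th - thr d) by exact: dom_B.
  have dfd d : dom T l (rinf R) (fi - fsr d) by apply: dom_B => //; exact: dfsr.
  have lowW z : dom W l (rinf R) z -> nrm W (agamma A) (rinf R) z <= nrm W l (rinf R) z.
    by move=> dz; exact: nrm_leq.
  have lowT z : dom T l (rinf R) z -> nrm T (agamma A) (rinf R) z <= nrm T l (rinf R) z.
    by move=> dz; exact: nrm_leq.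
  have dgW z : dom W l (rinf R) z -> dom W (agamma A) (rinf R) z by exact: dom_leq.
  have dgT z : dom T l (rinf R) z -> dom T (agamma A) (rinf R) z by exact: dom_leq.
  have sigP z : 0 <= z -> z <= 3 * nu -> sigma R <= (1 - acst A * z) * rinf R.
    move=> z0 z3; rewrite mulrC; apply: sigma_shrink => //.
    have : acst A * z <= M * (3 * nu) by apply: ler_pM => //; exact: ltW.
    have := MC1 (ltW nu0) nuC1nu; lra.
  (* Variation of the group element: [act_cont] at [thr d], perturbed by [th - thr d]. *)
  have part1 d : nrm T 0 (sigma R) (act A (rinf R) (sigma R) th fi -
      act A (rinf R) (sigma R) (thr d) fi) <=
      D * nrm T l (rinf R) fi * nrm W l (rinf R) (thr d - th).
    have dB : nrm W (agamma A) (rinf R) (th - thr d) <= Bt.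
      apply: (le_trans (lowW _ (ddiff d))); apply: (le_trans (nrm_B _ _ _)) => //.
      by rewrite addrC lerD2r.
    have n2 : nrm W 1 (rinf R) (th - thr d) + nrm W 1 (rinf R) (thr d) <= 3 * nu.
      have := nrm_B i1 dth1 (thr_dom d (leqnn 1)).
      by have := thr_small d; move: th_small; lra.
    have n20 : 0 <= nrm W 1 (rinf R) (th - thr d) + nrm W 1 (rinf R) (thr d).
      by rewrite addr_ge0 ?nrm_ge0//; [exact: dom_leq (ddiff d)|exact: thr_dom].
    have [_] := DP _ _ (thr d) (th - thr d) fi ib (dgW _ (dthr d)) (dgW _ (ddiff d))
      (dgT _ dfil) (le_trans (lowW _ (dthr d)) (le_trans (thrB d) BBt)) dB sig0
      (sigP _ n20 n2).
    rewrite [thr d + _]addrC subrK => /le_trans; apply.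
    rewrite -!mulrA ler_wpM2l// mulrC ler_pM ?nrm_ge0//; [exact: dgT|exact: dgW|exact: lowT|].
    by rewrite [leRHS]nrm_BC//; exact: lowW.
  (* Variation of the vector: by [ith] and linearity the difference is [thr d] acting on
     [fi - fsr d], which [act_cont] at the identity compares with [fi - fsr d] itself. *)
  have part2 d : nrm T 0 (sigma R) (act A (rinf R) (sigma R) (thr d) fi - y) <=
      (D * B + 1) * nrm T l (rinf R) (fsr d - fi).
    have thrsh : shrinks W (acst A) 1 (rinf R) (thr d) (sigma R).
      apply: act_small => //; [exact: thr_dom| |by move=> z; exact: sigma_shrink].
      exact: le_trans (thr_small d) nuC1nu.
    have dfd0 : dom T 0 (rinf R) (fsr d) by exact: dom_leq (dfsr _ gl d).
    have dfdd : dom T 0 (rinf R) (fi - fsr d) by exact: dom_leq (dfd d).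
    have -> : act A (rinf R) (sigma R) (thr d) fi - y =
        act A (rinf R) (sigma R) (thr d) (fi - fsr d).
      rewrite -{1}(ith d) addrC -[X in X + _]scaleN1r -(act_lin A)//.
      by rewrite scaleN1r addrC.
    have n1 : nrm W 1 (rinf R) (thr d) + nrm W 1 (rinf R) 0 <= 3 * nu.
      by rewrite nrm_0// addr0; have := thr_small d; move: nu0; lra.
    have n10 : 0 <= nrm W 1 (rinf R) (thr d) + nrm W 1 (rinf R) 0.
      by rewrite nrm_0// addr0 nrm_ge0//; exact: thr_dom.
    have [dd le] := DP _ _ 0 (thr d) (fi - fsr d) ib (dom_0 W i1 _) (dgW _ (dthr d))
      (dgT _ (dfd d)) ltac:(by rewrite nrm_0// (le_trans B0))
      (le_trans (lowW _ (dthr d)) (le_trans (thrB d) BBt)) sig0 (sigP _ n10 n1).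
    rewrite add0r in dd le.
    have da0 : dom T 0 (sigma R) (act A (rinf R) (sigma R) 0 (fi - fsr d)).
      rewrite act_id//; [|exact: ltW|exact: le1].
      by apply: dom_res => //; [exact: ltW|exact: le1].
    have da : dom T 0 (sigma R) (act A (rinf R) (sigma R) (thr d) (fi - fsr d)).
      by apply: act_dom thrsh => //; exact: (dom_leq i1 (leq0n l)).
    apply: (le_trans (nrm_tri ds1 da da0)).
    rewrite mulrDl mul1r (nrm_BC i1 (dfsr _ gl d) dfil); apply: lerD.
      apply: (le_trans le); rewrite -!mulrA ler_wpM2l// ler_pM ?nrm_ge0//.
      - exact: dgW.
      - exact: dgT.
      - exact: le_trans (lowW _ (dthr d)) (thrB d).
      - exact: lowT.
    rewrite act_id//; [|exact: ltW|exact: le1].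
    apply: le_trans (nrm_leq i1 (leq0n l) (dfd d)).
    by apply: nrm_res => //; [exact: ltW|exact: le1].
  apply/eqP; rewrite eq_le (nrm_ge0 ds1) ?andbT; last exact: dom_B.
  apply: (@cvg0_ge_le _ _ _ (fun d =>
     D * nrm T l (rinf R) fi * nrm W l (rinf R) (thr d - th) +
     (D * B + 1) * nrm T l (rinf R) (fsr d - fi))).
    move=> d; rewrite addr0; apply: le_trans (lerD (part1 d) (part2 d)).
    have thrsh : shrinks W (acst A) 1 (rinf R) (thr d) (sigma R).
      apply: act_small => //; [exact: thr_dom| |by move=> z; exact: sigma_shrink].
      exact: le_trans (thr_small d) nuC1nu.
    have da : dom T 0 (sigma R) (act A (rinf R) (sigma R) (thr d) fi).
      by apply: act_dom thrsh => //; exact: (dom_leq i1 (leq0n l)).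
    rewrite -{1}[act A (rinf R) (sigma R) th fi](subrK (act A (rinf R) (sigma R) (thr d) fi)).
    by rewrite -addrA nrm_D//; exact: dom_B.
  rewrite -[X in _ --> X](addr0 0); apply: cvgD.
    by rewrite -(mulr0 (D * nrm T l (rinf R) fi)); exact: cvgMr.
  by rewrite -(mulr0 (D * B + 1)); exact: cvgMr.
have dthk : dom W (2 * 1 - 1) (rinf R) th by [].
have [dpsi psi_le] := inv1 (rinf_bound R01) dth1 (le_trans th_small nu1)
  (shrinks_le gM th_shM).
have psi_sh : shrinks W (acst A) 1 (sigma R)
    (Defs.inv G (rinf R) (sigma R) th) (R / 2).
  apply: act_small => //; [exact: sigma01|exact/gt0/half_bound| |].
    by apply: (le_trans psi_le); rewrite ler_wpM2l// (le_trans ler01).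
  by move=> y; exact: half_shrink.
exists (Defs.inv G (rinf R) (sigma R) th), fi; split => //.
  move=> k gk; apply: (csg_inv G0_closed) (good1 _ gk) (thG0 _ gk) _.
  split; first by apply: (shrinks_le _ th_shM); move: gM g0; lra.
  apply: (@le_lt_trans _ _ (M * nu)); first by apply: ler_pM => //; [exact: ltW|exact: nrm_ge0].
  by have := MC1 (ltW nu0) nuC1nu; lra.
rewrite -th_act; apply: act_inv => //; last exact: half_sigma.
exact: (dom_leq i1 (leq0n l)).
Qed.

End Theta.

(** [kap] depends on the group, the action and R only, so t_0 can be taken large afterwards to make
    the corrections that small. *)
Lemma group_limit_exists : exists2 kap, 0 < kap &
  forall (fs : forall d, T (rr R d)) (ch : forall d, W (rm R d)),
  (forall j d, G0 j (rm R d) (ch d)) ->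
  (forall d, nrm W 1 (rm R d) (ch d) <= kap * 2^-1 ^+ d) ->
  (forall d, dom T 0 (rr R d) (fs d)) ->
  (forall d, fs d.+1 =
    act A (rm R d) (rr R d.+1) (ch d) (res T (rr R d) (rm R d) (fs d))) ->
  forall l, good fs ch l -> (agamma A <= l)%N ->
  exists (psi : W (sigma R)) (finf : T (rinf R)),
  [/\ forall k, good fs ch k -> G0 k (sigma R) psi,
      shrinks W (acst A) 1 (sigma R) psi (R / 2),
      act A (sigma R) (R / 2) psi (res T (rr R 0) (sigma R) (fs 0%N)) =
        res T (rinf R) (R / 2) finf &
      forall k, good fs ch k -> dom T k (rinf R) finf /\
        (fun d => nrm T k (rinf R) (res T (rr R d) (rinf R) (fs d) - finf))
          @ \oo --> (0 : K)].
Proof.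
have a01 := half_bound R01.
have [D1 D10 D1P] := inv_bound_uniform G a01 1 (leqnn 1).
have [D2 D20 D2P] := comp_bound_uniform G a01 1 (leqnn 1).
pose C1 := 1 + D1; pose C2 := 1 + D2.
have C1ge1 : 1 <= C1 by rewrite lerDl.
have C2ge1 : 1 <= C2 by rewrite lerDl.
have C10 : 0 < C1 by exact: lt_le_trans ltr01 _.
have C20 : 0 < C2 by exact: lt_le_trans ltr01 _.
have M0 : 0 <= M by rewrite mulr_ge0// addr_ge0 ?(ltW (gcst_gt0 G)) ?(ltW (acst_gt0 A)).
have M10 : 0 < 1 + M by rewrite ltr_pwDl.
(* Chosen so that C1 nu and M C1 nu are both at most 1/64; then [kap] turns 4 C2 C1 kap <= nu into
   an equality. *)
pose nu := (64 * (1 + M) * C1)^-1.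
have nu0 : 0 < nu by rewrite invr_gt0 !mulr_gt0.
pose kap := nu / (4 * C2 * C1).
have kap0 : 0 < kap by rewrite divr_gt0// !mulr_gt0.
have C1nuE : C1 * nu = (64 * (1 + M))^-1.
  by rewrite /nu; field; rewrite !gt_eqF.
exists kap => // fs ch chG chs df fS l gl gal.
apply: (group_limit C1ge1 C2ge1 nu0 kap0 _ _ _ _ _ chG chs df fS gl gal) => //.
- rewrite C1nuE lef_pV2 ?posrE ?mulr_gt0// ler_peMr//; lra.
- rewrite C1nuE invfM mulrCA ger_pMr ?invr_gt0// ler_pdivrMr// mul1r; lra.
- by rewrite /kap le_eqVlt; apply/orP; left; apply/eqP; field; rewrite !gt_eqF.
- move=> r r' chi ar dchi chi1 sh; have [dd le] := D1P _ _ _ ar dchi chi1 sh.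
  split=> //; apply: (le_trans le); rewrite ler_wpM2r ?lerDr//.
  by apply: nrm_ge0 => //; case: sh.
- move=> r r' chi xi ar dchi dxi xi1 cdef.
  have [_ [dd le]] := D2P _ _ _ _ ar dchi dxi xi1 cdef.
  have [[r01 _ _ _] _] := cdef.
  have x0 := nrm_ge0 r01 dxi; have y0 := nrm_ge0 r01 dchi.
  split=> //; apply: (le_trans le); apply: lerD.
    by rewrite ler_wpM2r// lerDr.
  by rewrite ler_wpM2l// lerD2l ler_wpM2r// lerDr.
Qed.

End GroupLimit.

(** * One step of the iteration *)

Lemma ordle_res (K : realType) (X : sciSpace K) (I : Type) (t r r' : I -> K)
    (a0 x : K) k (u : forall i, X (r i)) :
  0 < a0 <= 1 -> (forall i, a0 <= r' i) -> (forall i, r' i <= r i) ->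
  (forall i, r i <= 1) -> (forall i, dom X k (r i) (u i)) ->
  ordle t x (fun i => nrm X k (r i) (u i)) ->
  ordle t x (fun i => nrm X k (r' i) (res X (r i) (r' i) (u i))).
Proof.
move=> a01 ar' r'r r1 du.
have r'0 i : 0 < r' i by move: a01 => /andP[/lt_le_trans + _]; apply.
apply: (ordle_nrm a01) => i; first by rewrite ar' (le_trans (r'r i)).
by split; [exact: dom_res|exact: nrm_res].
Qed.

Ltac natlia :=
  repeat match goal with
  | h : is_true (leq _ _) |- _ => revert h
  | h : is_true (andb (leq _ _) (leq _ _)) |- _ => revert h
  | h : @eq nat _ _ |- _ => revert h
  end; clear; intros; lia.

Section Step.
Variables (K : realType) (T : sciSpace K) (F : sciSubspace T)
  (S : sciSubset T) (pi : forall (r : K), {linear T r -> T r})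
  (W : sciSpace K) (G : sciGroup W) (A : sciAction G T) (G0 : sciSubset W)
  (H : sciSpace K)
  (Hmap : forall (r : K), T r -> H r) (Phi : forall (r r' : K), H r -> W r')
  (s : nat) (c delta : K) (k0 tau : nat).
Hypotheses (pi_proj : isProj F pi)
  (zeta_bound : forall k, (k0 <= k)%N -> exists P : radPoly K 1,
      forall (r : K) f, 0 < r <= 1 -> dom T k r f ->
        nrm_le T k r (zeta pi f)
          (nrm T k r f * rp_eval P r [tuple nrm T ((k + 1) %/ 2)%N r f]))
  (Hmap_bound : forall k, (k0 <= k)%N -> exists P1 P2 : radPoly K 1,
      forall (r : K) f, 0 < r <= 1 -> S (k + s)%N r f ->
        let h := ((k + 1) %/ 2 + s)%N in
        nrm_le H k r (Hmap f)
          (nrm T (k + s) r (zeta pi f) * rp_eval P1 r [tuple nrm T h r f] +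
           nrm T (k + s) r f * nrm T h r (zeta pi f) *
             rp_eval P2 r [tuple nrm T h r f]))
  (Phi_bound : forall k, (k0 <= k)%N -> exists P : radPoly K 1,
      forall (r r' : K) g, dom H (k + s) r g -> shrinks H c 2 r g r' ->
        G0 k r' (Phi r' g) /\
        nrm_le W k r' (Phi r' g)
          (nrm H (k + s) r g *
             rp_eval P r [tuple nrm H ((k + 1) %/ 2 + s)%N r g]))
  (Phi_diff : forall k, (k0 <= k)%N -> exists P P2 : radPoly K 2,
      rp_mindeg 2 P2 /\
      forall (r r1 r' : K) f g1 g2, S (k + s)%N r f ->
        dom H (k + s) r g1 -> dom H (k + s) r g2 ->
        shrinks H c 2 r g1 r1 -> shrinks H c 2 r g2 r1 ->
        shrinks W (acst A) 1 r1 (Phi r1 g1) r' ->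
        shrinks W (acst A) 1 r1 (Phi r1 g2) r' ->
        let x := [tuple nrm H (k + s) r g1; nrm H (k + s) r g2] in
        nrm_le T k r'
          (act A r1 r' (Phi r1 g1) (res T r r1 f) -
           act A r1 r' (Phi r1 g2) (res T r r1 f))
          (nrm H (k + s) r (g1 - g2) * nrm T (k + s) r f * rp_eval P r x +
           nrm T (k + s) r f * rp_eval P2 r x))
  (delta_gt0 : 0 < delta)
  (G0_preserves : preserves A G0 S) (c_gt0 : 0 < c)
  (zeta_quad : forall k, (k0 <= k)%N -> exists Q : radPoly K 4,
      rp_deg1_le tau Q /\
      forall (r0 r r' : K) (f0 : T r0), S (k + s)%N r0 f0 ->
        shrinks H c 2 r0 (Hmap f0) r ->
        let f := res T r0 r f0 in
        let chi := Phi r (Hmap f0) in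
        dom W (k + s) r chi ->
        shrinks W c 1 r chi r' -> shrinks W (acst A) 1 r chi r' ->
        nrm_le T k r' (zeta pi (act A r r' chi f))
          (nrm T (k + s) r (zeta pi f) `^ (1 + delta) *
           rp_eval Q r [tuple nrm T (k + s) r f; nrm W (k + s) r chi;
                              nrm T (k + s) r (zeta pi f); nrm T k r f])).

Lemma zetaB r (x y : T r) : zeta pi (x - y) = zeta pi x - zeta pi y.
Proof. by rewrite /zeta linearB/= !opprB addrACA [RHS]addrACA [- y + _]addrC. Qed.

Lemma res_zeta (r r' : K) (f : T r) : 0 < r' -> r' <= r -> r <= 1 ->
  dom T 0 r f -> zeta pi (res T r r' f) = res T r r' (zeta pi f).
Proof. by case: pi_proj => _ _ piR *; rewrite /zeta linearB/= piR. Qed.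

Lemma dom_zeta k (r : K) (f : T r) : 0 < r <= 1 -> dom T k r f ->
  dom T k r (zeta pi f).
Proof.
case: pi_proj => piF _ _ r01 df; apply: dom_B => //.
by apply: (ss_dom F) => //; exact: piF.
Qed.

(* [e] is the exponent lost by an interpolation, [Ae] the growth exponent of the
   high norms, [q] the exponent of [t_{d+1} = t_d `^ q]; [m1] and [m] bound the
   shifts of level in one step, and [a0] is a lower bound for the radii. *)
Variables (e Ae q a0 : K) (N l : nat).
Let ga := agamma A.
Let m1 := (ga + 3 * s + 3)%N.
Let m := (m1 + s + 1)%N.
Let B0 : K := (2 + ga + 3 * s)%:R.
(** [NP] and [lN] make an interpolation over [m] levels cost only t^e. [lA] makes the smoothing
    error O(t^-2). [q_quad] reads (1+delta)(-1+e) + tau e <= -(q+e), the decay given by [zeta_quad].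
    [q_lin] reads -2 + 3e <= -(q+e), where -2 + 3e = e + 2(-1+e) comes from the quadratic part of
    [Phi_diff]. *)
Hypotheses (e0 : 0 < e) (e4 : e <= 4^-1) (Ae0 : 0 <= Ae) (a01 : 0 < a0 <= 1)
  (NP : (Ae + 1) * m%:R <= e * N%:R) (lN : (N + m + 1 <= l)%N)
  (lm : (2 * m + 2 <= l)%N) (lk0 : (k0 + 2 * s + 2 <= l)%N)
  (lA : Ae + (3 * s + 4)%:R <= l%:R)
  (q_quad : q + e + tau%:R * e <= (1 + delta) * (1 - e))
  (q0 : 0 <= q) (q_lin : q + e <= 2 - 3 * e).

Section Family.
(** Bounds known at the levels a and 2a-1 are turned into bounds at k and 2k-1: k = a serves the
    iteration at a fixed level, k = a+1 the passage to the next one. *)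
Variables (I : Type) (t r : I -> K) (f : forall i, T (r i)) (a k : nat).
Hypotheses (t1 : forall i, 1 < t i) (ar : forall i, a0 <= r i <= 1)
  (la : (l <= a)%N) (ak : (a <= k <= a.+1)%N)
  (fS : forall i, S (2 * k - 1)%N (r i) (f i))
  (fa : ordle t 0 (fun i => nrm T a (r i) (f i)))
  (fb : ordle t Ae (fun i => nrm T (2 * a - 1) (r i) (f i)))
  (za : ordle t (-1) (fun i => nrm T a (r i) (zeta pi (f i)))).

Let tge1 i : 1 <= t i. Proof. exact: ltW. Qed.
Let r01 i : 0 < r i <= 1. Proof. exact: (rad01 a01 ar). Qed.
Let e1 : -1 + e <= 0. Proof. by move: e4; lra. Qed.

Lemma step_domf j i : (j <= 2 * k - 1)%N -> dom T j (r i) (f i).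
Proof.
move=> jk; apply: (dom_leq (r01 i) jk).
exact: (sub_dom S (r01 i) _ (fS i)).
Qed.

Lemma step_subf j i : (j <= 2 * k - 1)%N -> S j (r i) (f i).
Proof. by move=> jk; exact: (sub_incl S (r01 i) jk). Qed.

Lemma step_domz j i : (j <= 2 * k - 1)%N -> dom T j (r i) (zeta pi (f i)).
Proof. by move=> jk; apply: dom_zeta => //; exact: step_domf. Qed.

(** At level 2a-1 the polynomial of [zeta_bound] takes the norm at level [(2a-1+1)/2] = a, which is
    bounded. *)
Lemma step_zeta_top : ordle t Ae (fun i => nrm T (2 * a - 1) (r i) (zeta pi (f i))).
Proof.
have [|P PP] := zeta_bound (k := (2 * a - 1)%N); first by natlia.
apply: (ordle_nrm a01 ar (B := fun i => _)) => [i|].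
  by apply: PP => //; apply: step_domf; natlia.
apply: (ordleM tge1 (x := Ae) (y := 0)) => //; first by rewrite addr0.
apply: (ordle_rp1 tge1 a01 ar) => //.
by rewrite (_ : ((2 * a - 1 + 1) %/ 2 = a)%N)//; natlia.
Qed.

Lemma step_f p : (p <= a + m)%N -> ordle t e (fun i => nrm T p (r i) (f i)).
Proof.
move=> pm; apply: (ordle_nrm_leq a01 ar pm) => [i|].
  by apply: step_domf; move: lm; rewrite /m /m1 ?/ga; natlia.
rewrite -[e]add0r; apply: (interpolation (m := m) t1 a01 ar _ _ _ _ _ _ fa fb) => //.
- by rewrite leqnn leq_addr.
- by move: lm; rewrite /m /m1 ?/ga; natlia.
- by rewrite /m; natlia.
- rewrite subr0 (@le_trans _ _ (e * N%:R))//.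
    by rewrite (le_trans _ NP)// ler_wpM2r// lerDl.
  by rewrite ler_wpM2l ?(ltW e0)// ler_nat; natlia.
- by move=> i; apply: step_domf; natlia.
Qed.

Lemma step_zeta p : (p <= a + m)%N ->
  ordle t (-1 + e) (fun i => nrm T p (r i) (zeta pi (f i))).
Proof.
move=> pm; apply: (ordle_nrm_leq a01 ar pm) => [i|].
  by apply: step_domz; move: lm; rewrite /m /m1 ?/ga; natlia.
apply: (interpolation (m := m) t1 a01 ar _ _ _ _ _ _ za step_zeta_top) => //.
- by rewrite leqnn leq_addr.
- by move: lm; rewrite /m /m1 ?/ga; natlia.
- by rewrite /m; natlia.
- rewrite opprK (@le_trans _ _ (e * N%:R))//.
  by rewrite ler_wpM2l ?(ltW e0)// ler_nat; natlia.
- by move=> i; apply: step_domz; natlia.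
Qed.

Lemma step_f0 p : (p <= a)%N -> ordle t 0 (fun i => nrm T p (r i) (f i)).
Proof. by move=> pa; apply: (ordle_nrm_leq a01 ar pa) => // i; apply: step_domf; natlia. Qed.

Lemma step_zeta1 p : (p <= a)%N ->
  ordle t (-1) (fun i => nrm T p (r i) (zeta pi (f i))).
Proof. by move=> pa; apply: (ordle_nrm_leq a01 ar pa) => // i; apply: step_domz; natlia. Qed.

(** [m] exceeds [m1] by s + 1, so k + m1 + s <= a + m even for k = a+1. In the second term of
    [Hmap_bound] the factor zeta(f) sits at a level at most a, where it decays like t^-1 without
    interpolation loss; this compensates the t^e of |f|. *)
Lemma step_Hmap_low j : (j <= k + m1)%N ->
  (forall i, dom H j (r i) (Hmap (f i))) /\
  ordle t (-1 + e) (fun i => nrm H j (r i) (Hmap (f i))).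
Proof.
move=> jm; have lm1 : (2 * m1 + 2 * s + 4 <= l)%N by move: lm; rewrite /m; natlia.
have [|P1 [P2 PP]] := Hmap_bound (k := (k + m1)%N); first by rewrite /m1 ?/ga; natlia.
have {}PP i := PP (r i) (f i) (r01 i).
have dH i : dom H (k + m1) (r i) (Hmap (f i)).
  by apply: (PP i _).1; apply: step_subf; rewrite /m1 ?/ga; natlia.
split=> [i|]; first by apply: (dom_leq (r01 i) jm).
apply: (ordle_nrm_leq a01 ar jm) => //.
apply: (ordle_nrm a01 ar (B := fun i => _)) => [i|].
  by apply: (PP i _); apply: step_subf; rewrite /m1 ?/ga; natlia.
apply: ordleD.
  apply: (ordleM tge1 (x := -1 + e) (y := 0)) => //; first by rewrite addr0.
    by apply: step_zeta; rewrite /m /m1 ?/ga; natlia.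
  by apply: (ordle_rp1 tge1 a01 ar) => //; apply: step_f0; rewrite /m1 ?/ga; natlia.
apply: (ordleM tge1 (x := -1 + e) (y := 0)) => //; first by rewrite addr0.
  apply: (ordleM tge1 (x := e) (y := -1)) => //; first by rewrite addrC.
    by apply: step_f; rewrite /m /m1 ?/ga; natlia.
  by apply: step_zeta1; rewrite /m1 ?/ga; natlia.
by apply: (ordle_rp1 tge1 a01 ar) => //; apply: step_f0; rewrite /m1 ?/ga; natlia.
Qed.

(** [j] solves (j+1)/2 + s = a: the half-level factors of [Hmap_bound] are then exactly at the
    controlled level a. *)
Lemma step_Hmap_top (j := (2 * a - 1 - 2 * s)%N) :
  (forall i, dom H j (r i) (Hmap (f i))) /\
  ordle t Ae (fun i => nrm H j (r i) (Hmap (f i))).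
Proof.
have hj : ((j + 1) %/ 2 + s = a)%N by rewrite /j; natlia.
have [|P1 [P2 PP]] := Hmap_bound (k := j); first by rewrite /j; natlia.
have jk : (j + s <= 2 * k - 1)%N by rewrite /j; natlia.
have {}PP i := PP (r i) (f i) (r01 i) (step_subf i jk).
rewrite hj in PP.
split=> [i|]; first exact: (PP i).1.
apply: (ordle_nrm a01 ar (B := fun i => _) PP).
have js : (j + s <= 2 * a - 1)%N by rewrite /j; natlia.
apply: ordleD.
  apply: (ordleM tge1 (x := Ae) (y := 0)) => //; first by rewrite addr0.
    apply: (ordle_nrm_leq a01 ar js); last exact: step_zeta_top.
    by move=> i; apply: step_domz; natlia.
  by apply: (ordle_rp1 tge1 a01 ar).
apply: (ordleM tge1 (x := Ae) (y := 0)) => //; first by rewrite addr0.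
  apply: (ordleM tge1 (x := Ae) (y := -1)) => //; first by rewrite gerDl lerN10.
  apply: (ordle_nrm_leq a01 ar js) => //.
  by move=> i; apply: step_domf; natlia.
exact: (ordle_rp1 tge1 a01 ar).
Qed.

Definition stepg i : H (r i) := smooth H (r i) (t i) (Hmap (f i)).

Lemma step_domg j i : dom H j (r i) (stepg i).
Proof.
apply: (sci_sm_dom (sci_axioms H)) => //; exact: (step_Hmap_low _).1.
Qed.

Lemma step_g_low j : (j <= k + m1)%N ->
  ordle t (-1 + e) (fun i => nrm H j (r i) (stepg i)).
Proof.
move=> jm; have [dH oH] := step_Hmap_low jm.
have [C C0 CP] := smooth_bound H a01 (leqnn j).
apply: (ordle_nrm a01 ar (B := fun i => C * nrm H j (r i) (Hmap (f i)))) => [i|].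
  split; first exact: step_domg.
  by have := (CP (r i) (t i) (Hmap (f i)) (ar i) (t1 i)).1 (dH i);
    rewrite subnn expr0 mulr1.
apply: (ordleM tge1 (x := 0) (y := -1 + e)) => //; first by rewrite add0r.
exact: ordle_cst.
Qed.

(** Smoothing lifts level 2a-1-2s to 2k-1+ga+s, that is by 2(k-a) + ga + 3s <= [B0] levels. This
    bound does not depend on a, so the growth exponent can be chosen before the level. *)
Lemma step_g_top :
  ordle t (Ae + B0) (fun i => nrm H (2 * k - 1 + ga + s) (r i) (stepg i)).
Proof.
have [dH oH] := step_Hmap_top.
set j := (2 * a - 1 - 2 * s)%N in dH oH.
have [|C C0 CP] := smooth_bound H a01 (p := (2 * k - 1 + ga + s)%N) (q := j).
  by rewrite /j; natlia.
apply: (ordle_nrm a01 ar (B := fun i => C * t i ^+ (2 * k - 1 + ga + s - j) *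
    nrm H j (r i) (Hmap (f i)))) => [i|].
  split; first exact: step_domg.
  exact: (CP (r i) (t i) (Hmap (f i)) (ar i) (t1 i)).1 (dH i).
apply: (ordleM tge1 (x := B0) (y := Ae)) => //; first by rewrite addrC.
apply: (ordleM tge1 (x := 0) (y := B0)) => //; first by rewrite add0r.
  exact: ordle_cst.
under eq_fun do rewrite -powR_mulrn ?(le_trans ler01)//.
apply: ordleW (ordle_powt _ _) => //; rewrite /B0 ler_nat /j; natlia.
Qed.

(** The levels k+s and 2a-1-2s differ by at least l - 3s - 2, which is at least Ae + 2 by [lA]: the
    gain beats the growth t^Ae by t^-2. *)
Lemma step_Hmap_smooth :
  ordle t (-2) (fun i => nrm H (k + s) (r i) (stepg i - Hmap (f i))).
Proof.
have [dH oH] := step_Hmap_top.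
set j := (2 * a - 1 - 2 * s)%N in dH oH.
have ksj : (k + s <= j)%N by rewrite /j; move: lm; rewrite /m /m1 ?/ga; natlia.
have [C C0 CP] := smooth_bound H a01 ksj.
apply: (ordle_nrm a01 ar (B := fun i => C * t i ^- (j - (k + s)) *
    nrm H j (r i) (Hmap (f i)))) => [i|].
  have dHk : dom H (k + s) (r i) (Hmap (f i)) by exact: dom_leq (dH i).
  have dg : dom H (k + s) (r i) (stepg i) by exact: step_domg.
  split; first exact: dom_B.
  rewrite nrm_BC//.
  exact: (CP (r i) (t i) (Hmap (f i)) (ar i) (t1 i)).2 (dH i).
apply: (ordleM tge1 (x := -2 - Ae) (y := Ae)) => //; first by rewrite subrK.
apply: (ordleM tge1 (x := 0) (y := -2 - Ae)) => //; first by rewrite add0r.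
  exact: ordle_cst.
under eq_fun do rewrite -powR_mulrn ?(le_trans ler01)// -powRN.
apply: ordleW (ordle_powt _ _) => //.
rewrite -opprD lerN2.
have : (l + k + s - (k + s + (3 * s + 4)) + 2 <= j - (k + s))%N.
  by rewrite /j; move: lm; rewrite /m /m1 ?/ga; natlia.
rewrite -(ler_nat K) natrD => /(le_trans _); apply.
rewrite addrC lerD2r (_ : (_ - _ = l - (3 * s + 4))%N); last by natlia.
rewrite natrB; first by rewrite lerBrDr.
by move: lm; rewrite /m /m1 ?/ga; natlia.
Qed.

Section Group.
Variable r1 : I -> K.
Hypotheses (ar1 : forall i, a0 <= r1 i) (r1r : forall i, r1 i <= r i)
  (shg : forall i, shrinks H c 2 (r i) (stepg i) (r1 i)).

Let r11 i : r1 i <= 1. Proof. by apply: le_trans (r1r i) _; case/andP: (r01 i). Qed.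
Let ar11 i : a0 <= r1 i <= 1. Proof. by rewrite ar1 r11. Qed.
Let r101 i : 0 < r1 i <= 1. Proof. exact: (rad01 a01 ar11). Qed.

Definition stepchi i : W (r1 i) := Phi (r1 i) (stepg i).

Lemma step_G0chi j i : G0 j (r1 i) (stepchi i).
Proof.
(* [Phi_bound] is only available from level [k0] on; lower levels follow by inclusion. *)
have [|P PP] := Phi_bound (k := maxn j k0); first by rewrite leq_maxr.
apply: (sub_incl G0 (r101 i) (leq_maxl j k0)).
by apply: (PP _ _ _ _ (shg i)).1; exact: step_domg.
Qed.

Lemma step_domchi j i : dom W j (r1 i) (stepchi i).
Proof. exact: (sub_dom G0 (r101 i) _ (step_G0chi j i)). Qed.

Lemma step_chi_low j : (j + s <= k + m1)%N ->
  ordle t (-1 + e) (fun i => nrm W j (r1 i) (stepchi i)).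
Proof.
move=> jm; have jj : (j <= maxn j k)%N by rewrite leq_maxl.
apply: (ordle_nrm_leq a01 ar11 jj); first exact: step_domchi.
have {}jm : (maxn j k + s <= k + m1)%N by rewrite /m1 ?/ga; natlia.
move: (maxn j k) (leq_maxr j k) jm => {jj}j kj jm.
have [|P PP] := Phi_bound (k := j); first by natlia.
apply: (ordle_nrm a01 ar11 (B := fun i => _)) => [i|].
  by apply: (PP _ _ _ _ (shg i)).2; exact: step_domg.
apply: (ordleM tge1 (x := -1 + e) (y := 0)) => //; first by rewrite addr0.
  exact: step_g_low.
apply: (ordle_rp1 tge1 a01 ar) => //; apply: ordleW (step_g_low _) => //.
by move: lm jm; rewrite /m /m1 ?/ga; natlia.
Qed.

Lemma step_chi_top :
  ordle t (Ae + B0) (fun i => nrm W (2 * k - 1 + ga) (r1 i) (stepchi i)).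
Proof.
have [|P PP] := Phi_bound (k := (2 * k - 1 + ga)%N); first by natlia.
apply: (ordle_nrm a01 ar11 (B := fun i => _)) => [i|].
  by apply: (PP _ _ _ _ (shg i)).2; exact: step_domg.
apply: (ordleM tge1 (x := Ae + B0) (y := 0)) => //; first by rewrite addr0.
  exact: step_g_top.
apply: (ordle_rp1 tge1 a01 ar) => //; apply: ordleW (step_g_low _) => //.
by rewrite /m1 ?/ga; natlia.
Qed.

(** [zeta_quad] concerns the unsmoothed Phi(H(f)). Unlike [stepchi], it is only known to lie in the
    levels where H(f) is controlled, so membership is part of the conclusion. *)
Lemma step_chiH_low j :
  (forall i, shrinks H c 2 (r i) (Hmap (f i)) (r1 i)) -> (j + s <= k + m1)%N ->
  (forall i, dom W j (r1 i) (Phi (r1 i) (Hmap (f i)))) /\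
  ordle t (-1 + e) (fun i => nrm W j (r1 i) (Phi (r1 i) (Hmap (f i)))).
Proof.
move=> shH jm; have jj : (j <= maxn j k)%N by rewrite leq_maxl.
have {}jm : (maxn j k + s <= k + m1)%N by rewrite /m1; natlia.
move: (maxn j k) (leq_maxr j k) jm jj => j' kj jm jj.
have [|P PP] := Phi_bound (k := j'); first by natlia.
have [dH oH] := step_Hmap_low jm.
have {}PP i := (PP _ _ _ (dH i) (shH i)).2.
split=> [i|]; first exact: (dom_leq (r101 i) jj (PP i).1).
apply: (ordle_nrm_leq a01 ar11 jj) => [i|]; first exact: (PP i).1.
apply: (ordle_nrm a01 ar11 (B := fun i => _) PP).
apply: (ordleM tge1 (x := -1 + e) (y := 0)) => //; first by rewrite addr0.
apply: (ordle_rp1 tge1 a01 ar) => //; apply: (ordleW tge1 e1 (step_Hmap_low _).2).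
by move: lm jm; rewrite /m /m1; natlia.
Qed.

Section Action.
Variable r' : I -> K.
Hypotheses (ar' : forall i, a0 <= r' i)
  (sha : forall i, shrinks W (acst A) 1 (r1 i) (stepchi i) (r' i)).

Let r'r1 i : r' i <= r1 i.
Proof.
have [/andP[r10 r11'] dw r'0 /le_trans->//] := sha i.
rewrite ger_pMr// gerBl mulr_ge0 ?(ltW (acst_gt0 A))//.
by apply: (nrm_ge0 (r101 i)).
Qed.
Let r'1 i : r' i <= 1. Proof. exact: le_trans (r'r1 i) (r11 i). Qed.
Let ar'1 i : a0 <= r' i <= 1. Proof. by rewrite ar' r'1. Qed.
Let r'01 i : 0 < r' i <= 1. Proof. exact: (rad01 a01 ar'1). Qed.
Let r'0 i : 0 < r' i. Proof. by case/andP: (r'01 i). Qed.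
Let r10 i : 0 < r1 i. Proof. by case/andP: (r101 i). Qed.
Let rle1 i : r i <= 1. Proof. by case/andP: (r01 i). Qed.

Definition stepf i : T (r' i) :=
  act A (r1 i) (r' i) (stepchi i) (res T (r i) (r1 i) (f i)).

Let dfr j i : (j <= 2 * k - 1)%N -> dom T j (r1 i) (res T (r i) (r1 i) (f i)).
Proof. by move=> jk; apply: dom_res => //; exact: step_domf. Qed.

Lemma step_domf' j i : (j <= 2 * k - 1)%N -> dom T j (r' i) (stepf i).
Proof.
move=> jk; apply: act_dom (sha i); first exact: step_domchi.
exact: dfr.
Qed.

(** The norm of f at level 2k-1 is kept on the right: for k = a+1 no exponent is known for it yet,
    and the estimate is used as a recursion along the iteration. *)
Lemma step_f'_top : exists2 C, 0 <= C & forall i,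
  nrm T (2 * k - 1) (r' i) (stepf i) <=
  C * (nrm T (2 * k - 1) (r i) (f i) + t i `^ (Ae + B0 + e)).
Proof.
have [|Q [R QR]] := act_bound A (k := k); first by natlia.
have ochi : ordle t 0 (fun i => nrm W (k + ga) (r1 i) (stepchi i)).
  by apply: (ordleW tge1 e1 (step_chi_low _)); rewrite /m1 ?/ga; natlia.
have [C C0 CP] : ordle t 0 (fun i => 1 + nrm W (k + ga) (r1 i) (stepchi i) *
    rp_eval Q (r1 i) [tuple nrm W (k + ga) (r1 i) (stepchi i)]).
  apply: ordleD; first exact: ordle_cst.
  by apply: (ordleM tge1 (x := 0) (y := 0)); rewrite ?addr0//; exact: (ordle_rp1 tge1 a01 ar11).
have [D D0 DP] : ordle t (Ae + B0 + e) (fun i =>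
    nrm W (2 * k - 1 + ga) (r1 i) (stepchi i) *
    nrm T k (r1 i) (res T (r i) (r1 i) (f i)) *
    rp_eval R (r1 i) [tuple nrm W (k + ga) (r1 i) (stepchi i)]).
  apply: (ordleM tge1 (x := Ae + B0 + e) (y := 0)) => //; first by rewrite addr0.
    apply: (ordleM tge1 (x := Ae + B0) (y := e)) => //; first exact: step_chi_top.
    apply: (ordle_res a01) => // [i|]; first by apply: step_domf; natlia.
    by apply: step_f; rewrite /m; natlia.
  exact: (ordle_rp1 tge1 a01 ar11).
exists (C + D) => [|i]; first exact: addr_ge0.
have [_ /le_trans->//] := QR _ _ (stepchi i) _ (dfr i (leqnn _)) (step_domchi _ i) (sha i).
have df := step_domf i (leqnn _).
rewrite [leRHS]mulrDr lerD//.
  rewrite mulrC (@le_trans _ _ (C * nrm T (2 * k - 1) (r i) (f i)))//.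
    have := CP i; rewrite powRr0 mulr1 => /andP[? ?].
    by apply: ler_pM => //; [apply: nrm_ge0 => //; exact: dfr|exact: nrm_res].
  by rewrite ler_wpM2r ?nrm_ge0// lerDl.
have /andP[_ /le_trans->//] := DP i.
by rewrite ler_wpM2r ?powR_ge0// lerDr.
Qed.

(** [act_cont] at the identity gives t^(-1+e) t^e, and -1 + 2e <= -1/2. The exponent -1/2 is the
    common rate from which all geometric series are derived. *)
Lemma step_f'_diff : ordle t (- 2^-1)
  (fun i => nrm T k (r' i) (stepf i - res T (r i) (r' i) (f i))).
Proof.
have [R RP] := act_cont A k.
have kga : (k + ga <= 2 * k - 1)%N by move: lm; rewrite /m /m1 ?/ga; natlia.
have ochi : ordle t (-1 + e) (fun i => nrm W (k + ga) (r1 i) (stepchi i)).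
  by apply: step_chi_low; rewrite /m1 ?/ga; natlia.
apply: (ordle_nrm a01 ar'1 (B := fun i => _)) => [i|].
  have act0 : act A (r1 i) (r' i) 0 (res T (r i) (r1 i) (f i)) =
      res T (r i) (r' i) (f i).
    rewrite act_id//; last exact: dfr.
    by apply: res_comp => //; exact: step_domf.
  have := RP (r1 i) (r' i) 0 (stepchi i) (res T (r i) (r1 i) (f i)) (r101 i)
    (dom_0 W (r101 i) _) (step_domchi _ i) (dfr i kga) (r'0 i).
  rewrite add0r act0.
  apply; rewrite nrm_0 ?addr0 1?mulrC//.
  by have [] := sha i.
apply: (ordleM tge1 (x := - 2^-1) (y := 0)) => //; first by rewrite addr0.
  apply: (ordleM tge1 (x := -1 + e) (y := e)) => //; first by move: e4; lra.
  apply: (ordle_res a01) => // [i|]; first exact: step_domf.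
  by apply: step_f; rewrite /m /m1 ?/ga; natlia.
apply: (ordle_rp2 tge1 a01 ar11) => //; last by apply: ordleW ochi.
under eq_fun => i do rewrite (nrm_0 W (r101 i)).
exact: ordle_cst.
Qed.

Section Quadratic.
Hypotheses (f0 : ordle t 0 (fun i => nrm T k (r i) (f i)))
  (shH : forall i, shrinks H c 2 (r i) (Hmap (f i)) (r1 i))
  (shHa : forall i, shrinks W (acst A) 1 (r1 i) (Phi (r1 i) (Hmap (f i))) (r' i))
  (shHc : forall i, shrinks W c 1 (r1 i) (Phi (r1 i) (Hmap (f i))) (r' i)).

(** With fH = Phi(H(f)) . f, linearity splits zeta(f') into zeta(fH), controlled by [zeta_quad], and
    zeta(f' - fH), controlled by [Phi_diff] and [zeta_bound]. The bound [f0] on |f|_k is a separate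
    hypothesis because for k = a+1 it must be established first. *)
Lemma step_zeta' :
  ordle t (- (q + e)) (fun i => nrm T k (r' i) (zeta pi (stepf i))).
Proof.
pose chiH i := Phi (r1 i) (Hmap (f i)).
pose fr i := res T (r i) (r1 i) (f i).
pose fH i := act A (r1 i) (r' i) (chiH i) (fr i).
have ksm : (k + s <= 2 * k - 1)%N by move: lm; rewrite /m /m1 ?/ga; natlia.
have [dHs oHs] := step_Hmap_low (j := (k + s)%N) ltac:(rewrite /m1 ?/ga; natlia).
have [dHss oHss] := step_Hmap_low (j := (k + s + s)%N) ltac:(rewrite /m1 ?/ga; natlia).
have [P [P2 [P2d PP]]] := Phi_diff (k := k) ltac:(natlia).
have [Q [Qd QP]] := zeta_quad (k := k) ltac:(natlia).
have [Z ZP] := zeta_bound (k := k) ltac:(natlia).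
have [dchiH ochiH'] := step_chiH_low (j := (k + s)%N) shH ltac:(rewrite /m1; natlia).
have ochiH := ordleW tge1 e1 ochiH'.
have ofs : ordle t e (fun i => nrm T (k + s) (r i) (f i)).
  by apply: step_f; rewrite /m /m1 ?/ga; natlia.
have dzr i : dom T 0 (r i) (f i) by exact: step_domf.
have ozs : ordle t (-1 + e) (fun i => nrm T (k + s) (r1 i) (zeta pi (fr i))).
  under eq_fun => i do rewrite /fr res_zeta//.
  apply: (ordle_res a01) => // [i|]; first exact: step_domz.
  by apply: step_zeta; rewrite /m /m1 ?/ga; natlia.
have ofH : ordle t (- (q + e)) (fun i => nrm T k (r' i) (zeta pi (fH i))).
  apply: (ordle_nrm a01 ar'1 (B := fun i => _)) => [i|].
    exact: (QP _ _ _ (f i) (step_subf i ksm) (shH i) (dchiH i) (shHc i) (shHa i)).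
  apply: (ordleM tge1 (x := (-1 + e) * (1 + delta)) (y := tau%:R * e)) => //.
  - by move: q_quad; lra.
  - by apply: ordle_powR => //; rewrite addr_ge0// ltW.
  apply: (ordle_rp4_deg1 tge1 a01 ar11 Qd (ltW e0)) => //.
  - by rewrite mulr_natl.
  - by apply: (ordle_res a01) => // i; exact: step_domf.
  - by apply: ordleW ozs.
  - by apply: (ordle_res a01) => // i; apply: step_domf; natlia.
have od : ordle t (- (q + e)) (fun i => nrm T k (r' i) (stepf i - fH i)).
  apply: (ordle_nrm a01 ar'1 (B := fun i => _)) => [i|].
    exact: (PP _ _ _ _ _ _ (step_subf i ksm) (step_domg _ i) (dHs i) (shg i)
      (shH i) (sha i) (shHa i)).
  have og : ordle t (-1 + e) (fun i => nrm H (k + s) (r i) (stepg i)).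
    by apply: step_g_low; rewrite /m1 ?/ga; natlia.
  apply: ordleD.
    apply: (ordleM tge1 (x := -2 + e) (y := 0)) => //.
    - by move: q_lin e0; lra.
    - by apply: (ordleM tge1 (x := -2) (y := e)) => //; exact: step_Hmap_smooth.
    by apply: (ordle_rp2 tge1 a01 ar) => //; exact: (ordleW tge1 e1).
  apply: (ordleM tge1 (x := e) (y := (-1 + e) *+ 2)) => //.
  - by move: q_lin e0; rewrite mulr2n; lra.
  exact: (ordle_rp2_mindeg tge1 a01 ar).
have dfH i : dom T k (r' i) (fH i).
  apply: act_dom (shHa i); last by apply: dfr; natlia.
  by apply: (dom_leq (r101 i) _ (dchiH i)); natlia.
have ddf i : dom T k (r' i) (stepf i - fH i).
  by apply: dom_B => //; apply: step_domf'; natlia.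
have oz : ordle t (- (q + e)) (fun i => nrm T k (r' i) (zeta pi (stepf i - fH i))).
  apply: (ordle_nrm a01 ar'1 (B := fun i => _)) => [i|]; first exact: ZP.
  apply: (ordleM tge1 (x := - (q + e)) (y := 0)) => //; first by rewrite addr0.
  apply: (ordle_rp1 tge1 a01 ar'1) => //.
  have hk : ((k + 1) %/ 2 <= k)%N by natlia.
  apply: (ordle_nrm_leq a01 ar'1 hk) => //.
  by apply: ordleW od => //; rewrite oppr_le0 addr_ge0// ltW.
apply: (ordle_nrm a01 ar'1 _ (ordleD oz ofH)) => i; split.
  by apply: dom_zeta => //; apply: step_domf'; natlia.
rewrite zetaB nrm_tri//; apply: dom_zeta => //.
by apply: step_domf'; natlia.
Qed.

End Quadratic.
End Action.
End Group.
End Family.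
(** * The iteration *)

(* The step lemmas are applied at level [l] to the family of all the admissible
   configurations: their constants are then uniform and [t0] can be chosen
   after them. *)
Record conf := Conf {
  cf_r : K; cf_r1 : K; cf_r' : K; cf_t : K; cf_f : T cf_r }.

Definition cf_g (x : conf) : H (cf_r x) := smooth H (cf_r x) (cf_t x) (Hmap (cf_f x)).
Definition cf_chi (x : conf) : W (cf_r1 x) := Phi (cf_r1 x) (cf_g x).
Definition cf_chiH (x : conf) : W (cf_r1 x) := Phi (cf_r1 x) (Hmap (cf_f x)).
Definition cf_f' (x : conf) : T (cf_r' x) :=
  act A (cf_r1 x) (cf_r' x) (cf_chi x) (res T (cf_r x) (cf_r1 x) (cf_f x)).

(** The conditions come in three layers, as each radius condition is checked with constants from the
    previous layer: [conf0] bounds g and H(f), whence [conf1]; this bounds the group elements,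
    whence [conf2]. *)
Definition conf0 (x : conf) :=
  [/\ a0 <= cf_r x <= 1, 1 < cf_t x, S (2 * l - 1)%N (cf_r x) (cf_f x) &
   [/\ nrm T l (cf_r x) (cf_f x) <= 2,
       nrm T (2 * l - 1) (cf_r x) (cf_f x) <= cf_t x `^ Ae &
       nrm T l (cf_r x) (zeta pi (cf_f x)) <= cf_t x `^ (-1)]].

Definition conf1 (x : conf) :=
  [/\ a0 <= cf_r1 x, cf_r1 x <= cf_r x,
      shrinks H c 2 (cf_r x) (cf_g x) (cf_r1 x) &
      shrinks H c 2 (cf_r x) (Hmap (cf_f x)) (cf_r1 x)].

Definition conf2 (x : conf) :=
  [/\ a0 <= cf_r' x, shrinks W (acst A) 1 (cf_r1 x) (cf_chi x) (cf_r' x),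
      shrinks W (acst A) 1 (cf_r1 x) (cf_chiH x) (cf_r' x) &
      shrinks W c 1 (cf_r1 x) (cf_chiH x) (cf_r' x)].

Section ConfFamily.
Variables (I : Type) (x : I -> conf).
Hypothesis x0 : forall i, conf0 (x i).

Let r01 i : 0 < cf_r (x i) <= 1.
Proof. by have [h _ _ _] := x0 i; exact: (rad01 (I := unit) a01 (fun=> h) tt). Qed.
Let df i : dom T (2 * l - 1) (cf_r (x i)) (cf_f (x i)).
Proof. by have [_ _ h _] := x0 i; exact: (sub_dom S (r01 i) _ h). Qed.
Let l1 : (l <= 2 * l - 1)%N. Proof. by natlia. Qed.

Lemma conf0_ordle : [/\ ordle (fun i => cf_t (x i)) 0
    (fun i => nrm T l (cf_r (x i)) (cf_f (x i))),
  ordle (fun i => cf_t (x i)) Ae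
    (fun i => nrm T (2 * l - 1) (cf_r (x i)) (cf_f (x i))) &
  ordle (fun i => cf_t (x i)) (-1)
    (fun i => nrm T l (cf_r (x i)) (zeta pi (cf_f (x i))))].
Proof.
have dl i := dom_leq (r01 i) l1 (df i).
split.
- exists 2 => // i; have [_ _ _ [h _ _]] := x0 i.
  by rewrite powRr0 mulr1 h andbT nrm_ge0.
- exists 1 => // i; have [_ _ _ [_ h _]] := x0 i.
  by rewrite mul1r h andbT nrm_ge0.
- exists 1 => // i; have [_ _ _ [_ _ h]] := x0 i.
  by rewrite mul1r h andbT nrm_ge0//; exact: dom_zeta.
Qed.
End ConfFamily.

Let ll : (l <= l <= l.+1)%N. Proof. by rewrite leqnn leqnSn. Qed.

Lemma base0 : exists2 C, 0 <= C & forall x, conf0 x ->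
  [/\ dom H 2 (cf_r x) (cf_g x), dom H 2 (cf_r x) (Hmap (cf_f x)),
      nrm H 2 (cf_r x) (cf_g x) <= C * cf_t x `^ (-1 + e) &
      nrm H 2 (cf_r x) (Hmap (cf_f x)) <= C * cf_t x `^ (-1 + e)].
Proof.
pose I := {x | conf0 x}; pose x (i : I) := sval i.
have x0 i : conf0 (x i) by exact: (svalP i).
have [fa fb za] := conf0_ordle x0.
have t1 i : 1 < cf_t (x i) by case: (x0 i).
have ar i : a0 <= cf_r (x i) <= 1 by case: (x0 i).
have fS i : S (2 * l - 1)%N (cf_r (x i)) (cf_f (x i)) by case: (x0 i).
have m2 : (2 <= l + m1)%N by rewrite /m1; natlia.
have [dH [C C0 CP]] := step_Hmap_low t1 ar (leqnn l) ll fS fa fb za m2.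
have [D D0 DP] := step_g_low t1 ar (leqnn l) ll fS fa fb za m2.
exists (C + D) => [|y y0]; first exact: addr_ge0.
have p0 := powR_ge0 (cf_t y) (-1 + e).
pose i : I := exist _ y y0; split.
- exact: (step_domg t1 ar (leqnn l) ll fS fa fb za 2 i).
- exact: dH i.
- have /andP[_ /le_trans] := DP i; apply; by rewrite ler_wpM2r// lerDr.
- have /andP[_ /le_trans] := CP i; apply; by rewrite ler_wpM2r// lerDl.
Qed.

Lemma base1 : exists2 C, 0 <= C & forall x, conf0 x -> conf1 x ->
  [/\ forall j, G0 j (cf_r1 x) (cf_chi x),
      nrm W 1 (cf_r1 x) (cf_chi x) <= C * cf_t x `^ (-1 + e),
      dom W 1 (cf_r1 x) (cf_chiH x) &
      nrm W 1 (cf_r1 x) (cf_chiH x) <= C * cf_t x `^ (-1 + e)].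
Proof.
pose I := {x | conf0 x /\ conf1 x}; pose x (i : I) := sval i.
have x0 i : conf0 (x i) by case: (svalP i).
have x1 i : conf1 (x i) by case: (svalP i).
have [fa fb za] := conf0_ordle x0.
have t1 i : 1 < cf_t (x i) by case: (x0 i).
have ar i : a0 <= cf_r (x i) <= 1 by case: (x0 i).
have fS i : S (2 * l - 1)%N (cf_r (x i)) (cf_f (x i)) by case: (x0 i).
have ar1 i : a0 <= cf_r1 (x i) by case: (x1 i).
have r1r i : cf_r1 (x i) <= cf_r (x i) by case: (x1 i).
have shg i : shrinks H c 2 (cf_r (x i)) (cf_g (x i)) (cf_r1 (x i)) by case: (x1 i).
have shH i : shrinks H c 2 (cf_r (x i)) (Hmap (cf_f (x i))) (cf_r1 (x i)).
  by case: (x1 i).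
have m2 : (1 + s <= l + m1)%N by rewrite /m1; natlia.
have [D D0 DP] := step_chi_low t1 ar (leqnn l) ll fS fa fb za ar1 r1r shg m2.
have [dH [C C0 CP]] := step_chiH_low t1 ar (leqnn l) ll fS fa fb za ar1 r1r shH m2.
exists (C + D) => [|y y0 y1]; first exact: addr_ge0.
have p0 := powR_ge0 (cf_t y) (-1 + e).
pose i : I := exist _ y (conj y0 y1); split.
- by move=> j; exact: (step_G0chi t1 ar (leqnn l) ll fS fa fb za ar1 r1r shg j i).
- have /andP[_ /le_trans] := DP i; apply; by rewrite ler_wpM2r// lerDr.
- exact: dH i.
- have /andP[_ /le_trans] := CP i; apply; by rewrite ler_wpM2r// lerDl.
Qed.

Lemma base2 : exists2 C, 0 <= C & forall x, conf0 x -> conf1 x -> conf2 x ->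
  [/\ nrm T (2 * l - 1) (cf_r' x) (cf_f' x) <=
        C * (nrm T (2 * l - 1) (cf_r x) (cf_f x) + cf_t x `^ (Ae + B0 + e)),
      nrm T l (cf_r' x) (cf_f' x - res T (cf_r x) (cf_r' x) (cf_f x)) <=
        C * cf_t x `^ (- 2^-1) &
      nrm T l (cf_r' x) (zeta pi (cf_f' x)) <= C * cf_t x `^ (- (q + e))].
Proof.
pose I := {x | [/\ conf0 x, conf1 x & conf2 x]}; pose x (i : I) := sval i.
have x0 i : conf0 (x i) by case: (svalP i).
have x1 i : conf1 (x i) by case: (svalP i).
have x2 i : conf2 (x i) by case: (svalP i).
have [fa fb za] := conf0_ordle x0.
have t1 i : 1 < cf_t (x i) by case: (x0 i).
have ar i : a0 <= cf_r (x i) <= 1 by case: (x0 i).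
have fS i : S (2 * l - 1)%N (cf_r (x i)) (cf_f (x i)) by case: (x0 i).
have ar1 i : a0 <= cf_r1 (x i) by case: (x1 i).
have r1r i : cf_r1 (x i) <= cf_r (x i) by case: (x1 i).
have shg i : shrinks H c 2 (cf_r (x i)) (cf_g (x i)) (cf_r1 (x i)) by case: (x1 i).
have shH i : shrinks H c 2 (cf_r (x i)) (Hmap (cf_f (x i))) (cf_r1 (x i)).
  by case: (x1 i).
have ar' i : a0 <= cf_r' (x i) by case: (x2 i).
have sha i : shrinks W (acst A) 1 (cf_r1 (x i)) (cf_chi (x i)) (cf_r' (x i)).
  by case: (x2 i).
have shHa i : shrinks W (acst A) 1 (cf_r1 (x i)) (cf_chiH (x i)) (cf_r' (x i)).
  by case: (x2 i).
have shHc i : shrinks W c 1 (cf_r1 (x i)) (cf_chiH (x i)) (cf_r' (x i)).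
  by case: (x2 i).
have [C C0 CP] := step_f'_top t1 ar (leqnn l) ll fS fa fb za ar1 r1r shg sha.
have [D D0 DP] := step_f'_diff t1 ar (leqnn l) ll fS fa fb za ar1 r1r shg ar' sha.
have [E E0 EP] := step_zeta' t1 ar (leqnn l) ll fS fa fb za ar1 r1r shg ar' sha
  fa shH shHa shHc.
exists (C + D + E) => [|y y0 y1 y2]; first by rewrite !addr_ge0.
pose i : I := exist _ y (And3 y0 y1 y2); split.
- apply: (le_trans (CP i)); rewrite ler_wpM2r//; last by lra.
  rewrite addr_ge0 ?powR_ge0// nrm_ge0//.
    by have [h _ _ _] := y0; exact: (rad01 (I := unit) a01 (fun=> h) tt).
  apply: (sub_dom S _ _ (fS i)).
  by have [h _ _ _] := y0; exact: (rad01 (I := unit) a01 (fun=> h) tt).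
- have /andP[_ /le_trans] := DP i; apply; rewrite ler_wpM2r ?powR_ge0//; lra.
- have /andP[_ /le_trans] := EP i; apply; rewrite ler_wpM2r ?powR_ge0//; lra.
Qed.

Section Iteration.
Variables (R t0 : K) (f0 : T R).
Hypotheses (R01 : 0 < R <= 1) (a0R : a0 = R / 2) (t01 : 1 < t0).

Fixpoint ts (d : nat) : K := if d is d'.+1 then ts d' `^ q else t0.

(** The initial restriction is a transport: [rr R 0] equals [R], but not definitionally. *)
Fixpoint fseq (d : nat) : T (rr R d) :=
  if d is d'.+1 then
    act A (rm R d') (rr R d'.+1)
      (Phi (rm R d') (smooth H (rr R d') (ts d') (Hmap (fseq d'))))
      (res T (rr R d') (rm R d') (fseq d'))
  else res T R (rr R 0) f0.

Definition chseq d : W (rm R d) :=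
  Phi (rm R d) (smooth H (rr R d) (ts d) (Hmap (fseq d))).

Definition confseq d : conf :=
  @Conf (rr R d) (rm R d) (rr R d.+1) (ts d) (fseq d).

Hypotheses (q1 : 1 < q) (qA : Ae + B0 + e + 2^-1 <= q * Ae)
  (t02 : 2 <= t0 `^ ((q - 1) / 2)).

Lemma ts_ge d : t0 <= ts d.
Proof.
elim: d => [//|d IH] /=; apply: (le_trans IH).
by rewrite -[leLHS]powRr1 ?ler_powR ?ltW ?(lt_trans ltr01)// (lt_le_trans t01).
Qed.

Lemma ts_gt1 d : 1 < ts d. Proof. exact: lt_le_trans t01 (ts_ge d). Qed.

Let ts0 d : 0 <= ts d. Proof. exact: ltW (lt_trans ltr01 (ts_gt1 d)). Qed.
Let tsge1 d : 1 <= ts d. Proof. exact: ltW (ts_gt1 d). Qed.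

(** t_{d+1}^(-1/2) = t_d^(-1/2) t_d^(-(q-1)/2), and [t02] makes the last factor at most 1/2. The
    true decay is faster, but a geometric rate matches the gaps of the radii. *)
Lemma ts_small d : ts d `^ (- 2^-1) <= t0 `^ (- 2^-1) * 2^-1 ^+ d.
Proof.
elim: d => [|d IH]; first by rewrite expr0 mulr1.
rewrite /= -powRrM exprSr mulrA.
have -> : q * - 2^-1 = - 2^-1 + - ((q - 1) / 2) by field.
rewrite powRD; last by apply/implyP => _; rewrite gt_eqF// (lt_trans ltr01) ?ts_gt1.
rewrite ler_pM ?powR_ge0// powRN lef_pV2 ?posrE ?powR_gt0 ?(lt_trans ltr01 (ts_gt1 d))//.
apply: (le_trans t02); apply: ge0_ler_powR; rewrite ?nnegrE//.
- by rewrite divr_ge0// subr_ge0 ltW.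
- by rewrite ltW// (lt_trans ltr01).
- exact: ts_ge.
Qed.

Lemma ts_geom d : ts d `^ (- 2^-1) <= 2^-1 ^+ d.
Proof.
apply: (le_trans (ts_small d)); rewrite ler_piMl ?(ltW (pow2V_gt0 _ _))//.
by rewrite -[leRHS](powRr0 t0) ler_powR ?(ltW t01)// oppr_le0.
Qed.

Definition step_ok d := conf1 (confseq d) /\ conf2 (confseq d).

(** The bound 2 - 2^-d leaves room for the increment 2^-(d+1) of step d, and never exceeds the value
    2 of [conf0]. *)
Definition invariant d := [/\ S (2 * l - 1)%N (rr R d) (fseq d),
  nrm T l (rr R d) (fseq d) <= 2 - 2^-1 ^+ d,
  nrm T (2 * l - 1) (rr R d) (fseq d) <= ts d `^ Ae &
  nrm T l (rr R d) (zeta pi (fseq d)) <= ts d `^ (-1)].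

Lemma invariant_conf0 d : invariant d -> conf0 (confseq d).
Proof.
move=> [dS h1 h2 h3]; split => //=.
- by rewrite a0R; exact: rr_bound.
- exact: ts_gt1.
split=> //; apply: (le_trans h1); have := pow2V_gt0 K d; lra.
Qed.

Section Bootstrap.
Variables (C kap : K).
(** The corrections of step d are at most C lam 2^-d. [lam_shrink] keeps the radius losses within
    the gaps, [lam_kap] feeds the limit in the group, [lam_half] preserves the bounds on f_d and
    [t0e] the decay of zeta(f_d). *)
Let lam := t0 `^ (- 2^-1).
Hypotheses (C0 : 0 <= C)
  (lam_shrink : (c + acst A) * (C * lam) <= 16^-1)
  (lam_kap : C * lam <= kap) (lam_half : C * lam <= 2^-1) (t0e : C <= t0 `^ e).
Hypothesis base0C : forall x, conf0 x ->
  [/\ dom H 2 (cf_r x) (cf_g x), dom H 2 (cf_r x) (Hmap (cf_f x)),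
      nrm H 2 (cf_r x) (cf_g x) <= C * cf_t x `^ (-1 + e) &
      nrm H 2 (cf_r x) (Hmap (cf_f x)) <= C * cf_t x `^ (-1 + e)].
Hypothesis base1C : forall x, conf0 x -> conf1 x ->
  [/\ forall j, G0 j (cf_r1 x) (cf_chi x),
      nrm W 1 (cf_r1 x) (cf_chi x) <= C * cf_t x `^ (-1 + e),
      dom W 1 (cf_r1 x) (cf_chiH x) &
      nrm W 1 (cf_r1 x) (cf_chiH x) <= C * cf_t x `^ (-1 + e)].
Hypothesis base2C : forall x, conf0 x -> conf1 x -> conf2 x ->
  [/\ nrm T (2 * l - 1) (cf_r' x) (cf_f' x) <=
        C * (nrm T (2 * l - 1) (cf_r x) (cf_f x) + cf_t x `^ (Ae + B0 + e)),
      nrm T l (cf_r' x) (cf_f' x - res T (cf_r x) (cf_r' x) (cf_f x)) <=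
        C * cf_t x `^ (- 2^-1) &
      nrm T l (cf_r' x) (zeta pi (cf_f' x)) <= C * cf_t x `^ (- (q + e))].

Let Ct d : C * ts d `^ (-1 + e) <= C * lam * 2^-1 ^+ d.
Proof.
rewrite -mulrA ler_wpM2l//; apply: le_trans (ts_small d).
by rewrite ler_powR//; move: e4; lra.
Qed.

Let Clam0 d : 0 <= C * lam * 2^-1 ^+ d.
Proof. by rewrite !mulr_ge0 ?powR_ge0 ?(ltW (pow2V_gt0 _ _)). Qed.

Let al0 : 0 < acst A := acst_gt0 A.

Let shrink_cst c' d : 0 <= c' -> c' <= c + acst A ->
  c' * (C * lam * 2^-1 ^+ d) <= 16^-1 * 2^-1 ^+ d.
Proof.
move=> c'0 c'c; rewrite mulrA ler_pM2r ?pow2V_gt0//; apply: le_trans lam_shrink.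
by rewrite ler_wpM2r// mulr_ge0// powR_ge0.
Qed.

Lemma invariant_ok d : invariant d -> step_ok d /\
  (nrm W 1 (rm R d) (chseq d) <= kap * 2^-1 ^+ d /\
   forall j, G0 j (rm R d) (chseq d)).
Proof.
move=> /invariant_conf0 x0; have [dg dH ng nH] := base0C x0.
have x1 : conf1 (confseq d).
  split=> /=; [by rewrite a0R; case/andP: (rm_bound R01 d)|exact: rm_rr| |].
    apply: (shrinks_nrm (b := C * lam * 2^-1 ^+ d)) => //;
      [exact: rr01|by case/andP: (rm01 R01 d)|exact: ltW
      |exact: le_trans ng (Ct d)|].
    by apply: rm_shrink => //; apply: shrink_cst; [exact: ltW|rewrite lerDl ltW].
  apply: (shrinks_nrm (b := C * lam * 2^-1 ^+ d)) => //;
    [exact: rr01|by case/andP: (rm01 R01 d)|exact: ltW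
    |exact: le_trans nH (Ct d)|].
  by apply: rm_shrink => //; apply: shrink_cst; [exact: ltW|rewrite lerDl ltW].
have [chG nchi dchiH nchiH] := base1C x0 x1.
split; last first.
  split=> //; apply: (le_trans nchi); apply: (le_trans (Ct d)).
  by rewrite ler_wpM2r ?(ltW (pow2V_gt0 _ _)).
split=> //; have r'0 : 0 < rr R d.+1 by case/andP: (rr01 R01 d.+1).
have rm1 := rm01 R01 d.
split=> /=; first by rewrite a0R; case/andP: (rr_bound R01 d.+1).
- apply: (shrinks_nrm (b := C * lam * 2^-1 ^+ d)) => //.
  + exact: (sub_dom G0 rm1 _ (chG 1%N)).
  + exact: ltW.
  + exact: le_trans nchi (Ct d).
  by apply: rr_shrink => //; apply: shrink_cst; [exact: ltW|rewrite lerDr ltW].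
- apply: (shrinks_nrm (b := C * lam * 2^-1 ^+ d)) => //;
    [exact: ltW|exact: le_trans nchiH (Ct d)|].
  by apply: rr_shrink => //; apply: shrink_cst; [exact: ltW|rewrite lerDr ltW].
- apply: (shrinks_nrm (b := C * lam * 2^-1 ^+ d)) => //;
    [exact: ltW|exact: le_trans nchiH (Ct d)|].
  by apply: rr_shrink => //; apply: shrink_cst; [exact: ltW|rewrite lerDl ltW].
Qed.

Lemma invariantS d : invariant d -> invariant d.+1.
Proof.
move=> inv; have x0 := invariant_conf0 inv.
have [[x1 x2] [_ chG]] := invariant_ok inv.
have [n1 n2 n3] := base2C x0 x1 x2.
have [_ sha _ _] := x2; have [fS h1 h2 h3] := inv.
have rr0' : 0 < rr R d.+1 by case/andP: (rr01 R01 d.+1).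
have rrd := rr01 R01 d; have rmd := rm01 R01 d.
have rle : rr R d.+1 <= rr R d by exact: le_trans (rr_rm R01 d) (rm_rr R01 d).
have t0' : 0 < ts d by exact: lt_trans ltr01 (ts_gt1 d).
have fS' : S (2 * l - 1)%N (rr R d.+1) (fseq d.+1).
  apply: (G0_preserves (chG (2 * l - 1)%N)) sha.
  by apply: (sub_res S) fS => //; [case/andP: rmd|exact: rm_rr|case/andP: rrd].
have df : dom T l (rr R d) (fseq d).
  apply: (dom_leq rrd _ (sub_dom S rrd _ fS)); natlia.
have df' : dom T l (rr R d.+1) (fseq d.+1).
  apply: (dom_leq (rr01 R01 d.+1) _ (sub_dom S (rr01 R01 d.+1) _ fS')); natlia.
have dres : dom T l (rr R d.+1) (res T (rr R d) (rr R d.+1) (fseq d)).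
  by apply: dom_res => //; case/andP: rrd.
split=> //.
- apply: (le_trans (nrm_tri (rr01 R01 d.+1) df' dres)).
  have nres : nrm T l (rr R d.+1) (res T (rr R d) (rr R d.+1) (fseq d)) <=
      2 - 2^-1 ^+ d.
    by apply: le_trans h1; apply: nrm_res => //; case/andP: rrd.
  have : C * ts d `^ (- 2^-1) <= 2^-1 * 2^-1 ^+ d.
    apply: (@le_trans _ _ (C * lam * 2^-1 ^+ d)).
      by rewrite -mulrA ler_wpM2l// ts_small.
    by rewrite ler_wpM2r ?(ltW (pow2V_gt0 _ _)).
  move: n2; rewrite /= exprS; lra.
(* Both terms are at most t_d^(Ae+B0+e), and 2C <= t_d^(1/2); by [qA] the product is at most t_d^(q
   Ae) = t_{d+1}^Ae. *)
- apply: (le_trans n1); rewrite /= -powRrM.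
  apply: (@le_trans _ _ (ts d `^ (2^-1) * ts d `^ (Ae + B0 + e))); last first.
    rewrite -powRD; last by apply/implyP => _; rewrite gt_eqF.
    by rewrite ler_powR// addrC.
  apply: (@le_trans _ _ (C * (2 * ts d `^ (Ae + B0 + e)))).
    rewrite ler_wpM2l// mulr2n mulrDl mul1r lerD2r (le_trans h2)//.
    by rewrite ler_powR// -addrA lerDl addr_ge0 ?ler0n ?ltW.
  rewrite mulrA ler_wpM2r ?powR_ge0//.
  have : C * ts d `^ (- 2^-1) <= 2^-1.
    apply: le_trans lam_half; rewrite ler_wpM2l//; apply: (le_trans (ts_small d)).
    by rewrite ler_piMr ?powR_ge0// pow2V_le1.
  rewrite powRN ler_pdivrMr ?powR_gt0//; lra.
(* The spare exponent e absorbs the constant, since C <= t_0^e <= t_d^e. *)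
- apply: (le_trans n3); rewrite /= -powRrM mulrN1 opprD powRD; last first.
    by apply/implyP => _; rewrite gt_eqF.
  rewrite mulrCA ger_pMr ?powR_gt0// powRN ler_pdivrMr ?powR_gt0// mul1r.
  apply: (le_trans t0e); apply: ge0_ler_powR (ts_ge d); rewrite ?nnegrE.
  + exact: ltW.
  + by rewrite ltW// (lt_trans ltr01).
  + exact: ltW.
Qed.

Lemma invariant_all : S (2 * l - 1)%N R f0 -> nrm T (2 * l - 1) R f0 <= 1 ->
  nrm T l R (zeta pi f0) <= t0^-1 -> forall d, invariant d.
Proof.
move=> fS n1 n2; elim=> [|d]; last exact: invariantS.
have R0 : 0 < rr R 0 by case/andP: (rr01 R01 0).
have /andP[_ R1] := R01.
have rrR : rr R 0 <= R by rewrite rr0.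
have df : dom T (2 * l - 1) R f0 by exact: (sub_dom S R01 _ fS).
have l2 : (l <= 2 * l - 1)%N by natlia.
have dl : dom T l R f0 by exact: dom_leq df.
split=> /=.
- exact: (sub_res S).
- rewrite expr0; apply: (le_trans (nrm_res R0 rrR R1 dl)).
  by apply: (le_trans (nrm_leq R01 l2 df)); lra.
- apply: (le_trans (nrm_res R0 rrR R1 df)); apply: (le_trans n1).
  by rewrite -[leLHS](powRr0 t0) ler_powR ?(ltW t01).
- rewrite res_zeta//; last exact: dom_leq df.
  apply: (le_trans (nrm_res R0 rrR R1 (dom_zeta R01 dl))); apply: (le_trans n2).
  by rewrite powR_inv1// ltW// (lt_trans ltr01).
Qed.

End Bootstrap.

(** * Propagation to the higher levels *)

Section Regularity.
Hypotheses (inv : forall d, invariant d) (ok : forall d, step_ok d)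
  (chG : forall j d, G0 j (rm R d) (chseq d)).

Lemma fseq_S j : S j R f0 -> forall d, S j (rr R d) (fseq d).
Proof.
move=> fS; elim=> [|d IH] /=.
  apply: (sub_res S) fS; [by case/andP: (rr01 R01 0)|by rewrite rr0|by case/andP: R01].
have [_ [_ sha _ _]] := ok d.
apply: (G0_preserves (chG j d)) sha.
by apply: (sub_res S) IH; [case/andP: (rm01 R01 d)|exact: rm_rr|case/andP: (rr01 R01 d)].
Qed.

(** After division by t_d^Ae, condition [qA] brings the recursion to the form of [bounded_rec]. Any
    constant [C] is absorbed, so neither [t0] nor [Ae] has to change with the level. *)
Lemma ordle_rec C u : 0 <= C -> (forall d, 0 <= u d) ->
  (forall d, u d.+1 <= C * (u d + ts d `^ (Ae + B0 + e))) -> ordle ts Ae u.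
Proof.
move=> C0 u0 uS.
have tp d : 0 < ts d by exact: lt_trans ltr01 (ts_gt1 d).
have tD d x y : ts d `^ (x + y) = ts d `^ x * ts d `^ y.
  by rewrite powRD//; apply/implyP => _; rewrite gt_eqF.
pose v d := u d * ts d `^ (- Ae).
have v0 d : 0 <= v d by rewrite mulr_ge0// powR_ge0.
have uv d : u d = v d * ts d `^ Ae by rewrite /v -mulrA -tD addNr powRr0 mulr1.
have [d|M M0 MP] := bounded_rec (u := v) C0 v0.
  have small x : x <= - 2^-1 -> ts d `^ x <= 2^-1 ^+ d.
    by move=> xs; apply: le_trans (ts_geom d); rewrite ler_powR.
  rewrite {1}/v /= -powRrM.
  have := ler_wpM2r (powR_ge0 (ts d) (q * - Ae)) (uS d) => /le_trans; apply.
  rewrite uv -mulrA mulrDl -mulrA -!tD.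
  have p1 : v d * ts d `^ (Ae + q * - Ae) <= v d * 2^-1 ^+ d.
    apply: ler_wpM2l => //; apply: small; have : 0 <= B0 by rewrite ler0n.
    move: qA e0; lra.
  have p2 : ts d `^ (Ae + B0 + e + q * - Ae) <= 2^-1 ^+ d.
    by apply: small; move: qA; lra.
  have := ler_wpM2l C0 (lerD p1 p2); have := v0 d; lra.
exists M => // d; rewrite u0/= uv ler_wpM2r ?powR_ge0//.
Qed.

Lemma ordle_succ C x u : 0 <= C -> (forall d, 0 <= u d) ->
  (forall d, u d.+1 <= C * ts d.+1 `^ x) -> ordle ts x u.
Proof.
move=> C0 u0 uS; have p0 : 0 < ts 0 `^ x by rewrite powR_gt0// (lt_trans ltr01 (ts_gt1 0)).
exists (C + u 0%N / ts 0 `^ x) => [|d]; first by rewrite addr_ge0// divr_ge0// ltW.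
rewrite u0/=; case: d => [|d].
  by rewrite mulrDl divfK ?gt_eqF// lerDr mulr_ge0// ltW.
by apply: (le_trans (uS d)); rewrite ler_wpM2r ?powR_ge0// lerDl divr_ge0// ltW.
Qed.

Definition regular k := [/\ ordle ts 0 (fun d => nrm T k (rr R d) (fseq d)),
  ordle ts Ae (fun d => nrm T (2 * k - 1) (rr R d) (fseq d)) &
  ordle ts (-1) (fun d => nrm T k (rr R d) (zeta pi (fseq d)))].

Let ar d : a0 <= rr R d <= 1. Proof. by rewrite a0R rr_bound. Qed.
Let ar1 d : a0 <= rm R d. Proof. by rewrite a0R; case/andP: (rm_bound R01 d). Qed.
Let ar' d : a0 <= rr R d.+1. Proof. by case/andP: (ar d.+1). Qed.
Let r1r d : rm R d <= rr R d. Proof. exact: rm_rr. Qed.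
Let shg d : shrinks H c 2 (rr R d) (stepg ts fseq d) (rm R d).
Proof. by have [[]] := ok d. Qed.
Let shH d : shrinks H c 2 (rr R d) (Hmap (fseq d)) (rm R d).
Proof. by have [[]] := ok d. Qed.
Let sha d : shrinks W (acst A) 1 (rm R d) (chseq d) (rr R d.+1).
Proof. by have [_ []] := ok d. Qed.
Let shHa d : shrinks W (acst A) 1 (rm R d) (Phi (rm R d) (Hmap (fseq d))) (rr R d.+1).
Proof. by have [_ []] := ok d. Qed.
Let shHc d : shrinks W c 1 (rm R d) (Phi (rm R d) (Hmap (fseq d))) (rr R d.+1).
Proof. by have [_ []] := ok d. Qed.

Lemma regular_base : regular l.
Proof. exact: conf0_ordle (fun d => invariant_conf0 (inv d)). Qed.

(** The order matters: summing the differences first bounds |f_d|_{k+1}, which [step_zeta'] then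
    takes as its separate hypothesis. *)
Lemma regular_succ k : (l <= k)%N -> S (2 * k.+1 - 1)%N R f0 -> regular k -> regular k.+1.
Proof.
move=> lk fS0 [fa fb za].
have ak : (k <= k.+1 <= k.+1)%N by rewrite leqnSn leqnn.
have fS := fseq_S fS0.
have df j d : (j <= 2 * k.+1 - 1)%N -> dom T j (rr R d) (fseq d).
  by move=> jk; exact: (dom_leq (rr01 R01 d) jk (sub_dom S (rr01 R01 d) _ (fS d))).
have n0 j d : (j <= 2 * k.+1 - 1)%N -> 0 <= nrm T j (rr R d) (fseq d).
  by move=> jk; exact: (nrm_ge0 (rr01 R01 d) (df _ d jk)).
have kk : (k.+1 <= 2 * k.+1 - 1)%N by natlia.
have [C C0 CP] := step_f'_top ts_gt1 ar lk ak fS fa fb za ar1 r1r shg sha.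
have [D D0 DP] := step_f'_diff ts_gt1 ar lk ak fS fa fb za ar1 r1r shg ar' sha.
have fk : ordle ts 0 (fun d => nrm T k.+1 (rr R d) (fseq d)).
  have [d|d|M M0 MP] := bounded_rec (u := fun d => nrm T k.+1 (rr R d) (fseq d)) D0.
  - exact: n0.
  - have rle : rr R d.+1 <= rr R d by exact: le_trans (rr_rm R01 d) (rm_rr R01 d).
    have rp : 0 < rr R d.+1 by case/andP: (rr01 R01 d.+1).
    have r1 : rr R d <= 1 by case/andP: (rr01 R01 d).
    have dres := dom_res rp rle r1 (df _ d kk).
    apply: (le_trans (nrm_tri (rr01 R01 d.+1) (df _ d.+1 kk) dres)); apply: lerD.
      have /andP[_ /le_trans] := DP d; apply; rewrite ler_wpM2l//; exact: ts_geom.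
    apply: (le_trans (nrm_res rp rle r1 (df _ d kk))).
    by rewrite ler_peMr ?n0// lerDl mulr_ge0// ltW// pow2V_gt0.
  exists M => // d; rewrite n0//= powRr0 mulr1; exact: MP.
split=> //.
  by apply: (ordle_rec C0 _ CP) => d; exact: n0.
have [E E0 EP] := step_zeta' ts_gt1 ar lk ak fS fa fb za ar1 r1r shg ar' sha fk shH shHa shHc.
apply: (ordle_succ E0) => d.
  by exact: (nrm_ge0 (rr01 R01 d) (dom_zeta (rr01 R01 d) (df _ d kk))).
(* t_d^-(q+e) <= t_d^-q = t_{d+1}^-1. *)
have /andP[_ /le_trans] := EP d; apply; rewrite ler_wpM2l//= -powRrM ler_powR//.
by move: e0; lra.
Qed.

Lemma regular_all k : (l <= k)%N -> S (2 * k - 1)%N R f0 -> regular k.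
Proof.
elim: k => [|k IH]; first by rewrite leqn0 => /eqP <- _; exact: regular_base.
rewrite leq_eqVlt => /orP[/eqP <- _|lk fS]; first exact: regular_base.
apply: regular_succ => //; apply: IH => //.
by apply: (sub_incl S R01) fS; natlia.
Qed.

Lemma regular_good k : (l <= k)%N -> S (2 * k - 1)%N R f0 -> good fseq chseq k.
Proof.
move=> lk fS0; have [fa fb za] := regular_all lk fS0; have fS := fseq_S fS0.
have ak : (k <= k <= k.+1)%N by rewrite leqnSn leqnn.
have geom u : ordle ts (- 2^-1) u -> exists2 C, 0 <= C & forall d, u d <= C * 2^-1 ^+ d.
  move=> [C C0 CP]; exists C => // d; have /andP[_ /le_trans] := CP d; apply.
  by rewrite ler_wpM2l// ts_geom.
split.
- by natlia.
- apply: geom; apply: (ordleW tsge1 (x := -1 + e)); first by move: e4; lra.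
  apply: (step_chi_low ts_gt1 ar lk ak fS fa fb za ar1 r1r shg).
  by rewrite /m1; natlia.
- move=> d; apply: (dom_leq (rr01 R01 d) _ (sub_dom S (rr01 R01 d) _ (fS d))); natlia.
- exact: geom (step_f'_diff ts_gt1 ar lk ak fS fa fb za ar1 r1r shg ar' sha).
Qed.

Lemma zeta_fseq_cvg0 : (fun d => nrm T l (rr R d) (zeta pi (fseq d))) @ \oo --> (0 : K).
Proof.
have [_ _ [C C0 CP]] := regular_base.
apply: cvg0_le (cvg0_pow2V C) => d; have /andP[-> /le_trans] := CP d; apply.
rewrite ler_wpM2l//; apply: le_trans (ts_geom d); rewrite ler_powR//.
by rewrite lerN2 invf_le1// ler1n.
Qed.

End Regularity.
End Iteration.

Hypothesis G0_closed : closedSubgroup G G0.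

Lemma normal_form_iteration (R : K) : 0 < R <= 1 -> a0 = R / 2 -> 1 < q ->
  Ae + B0 + e + 2^-1 <= q * Ae ->
  exists2 beta, 0 < beta & forall (p : option nat) (f : T R), lvl_le l p ->
    in_scale S (omap (fun j => 2 * j - 1)%N p) R f ->
    nrm T (2 * l - 1) R f < 1 -> nrm T l R (zeta pi f) < beta ->
    exists r (psi : W r),
      [/\ R / 2 <= r <= R, in_scale G0 p r psi,
          in_scale G0 p (R / 2) (res W r (R / 2) psi),
          shrinks W (acst A) 1 r psi (R / 2) &
          in_scale (scaleI F S) p (R / 2)
            (act A r (R / 2) psi (res T R r f))].
Proof.
move=> R01 a0R q1 qA.
have [kap kap0 GL] := group_limit_exists A R01 G0_closed.
have [D0 D00 D0P] := base0; have [D1 D10 D1P] := base1; have [D2 D20 D2P] := base2.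
pose C := 1 + D0 + D1 + D2; have C0 : 0 < C by rewrite /C; lra.
have al0 := acst_gt0 A.
(* Each term of [Y] is the inverse of a bound wanted for a multiple of C lam, so C lam Y <= 1 yields
   [lam1], [lam2] and [lam3] together. *)
pose Y := 16 * (c + acst A) + kap^-1 + 2.
have k0' : 0 < kap^-1 by rewrite invr_gt0.
have Y0 : 0 < Y by rewrite /Y; move: c_gt0; lra.
have [t0 t01 [t0Y t0e t02]] : exists2 t0 : K, 1 < t0 &
    [/\ C * Y <= t0 `^ 2^-1, C <= t0 `^ e & 2 <= t0 `^ ((q - 1) / 2)].
  have half0 : 0 < 2^-1 :> K by rewrite invr_gt0.
  have [t1 t11 t1P] := powR_large (C * Y) half0.
  have [t2 t21 t2P] := powR_large C e0.
  have [|t3 t31 t3P] := powR_large (2 : K) (x := (q - 1) / 2).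
    by rewrite divr_gt0// subr_gt0.
  exists (t1 + t2 + t3); first by move: t11 t21 t31; lra.
  by split; [apply: t1P|apply: t2P|apply: t3P]; move: t11 t21 t31; lra.
have tp : 0 < t0 by exact: lt_trans ltr01 t01.
pose lam := t0 `^ (- 2^-1).
have CY : C * lam * Y <= 1.
  by rewrite mulrAC /lam powRN ler_pdivrMr ?powR_gt0// mul1r.
have Cl0 : 0 <= C * lam by rewrite mulr_ge0 ?powR_ge0 ?ltW.
have lam1 : (c + acst A) * (C * lam) <= 16^-1.
  have := mulr_ge0 Cl0 (ltW k0'); move: CY Cl0; rewrite /Y; lra.
have lam2 : C * lam <= kap.
  have : C * lam * kap^-1 <= 1.
    apply: le_trans CY; rewrite ler_wpM2l// /Y; move: c_gt0; lra.
  by rewrite ler_pdivrMr// mul1r.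
have lam3 : C * lam <= 2^-1.
  have : C * lam * 2 <= 1.
    apply: le_trans CY; rewrite ler_wpM2l// /Y; move: c_gt0; lra.
  lra.
(* The iteration starts only if |zeta(f)|_l <= t_0^-1, and t_0 is fixed by now. *)
exists t0^-1 => [|p f lp fS f1 fz]; first by rewrite invr_gt0.
pose inrange k := if p is Some j then (k <= j)%N else true.
have rl : inrange l by rewrite /inrange; case: (p) lp.
have rS k : inrange k -> S (2 * k - 1)%N R f.
  rewrite /inrange; case: (p) fS => [j|] fS kj; last exact: fS.
  by apply: (sub_incl S R01) fS; natlia.
have scaleP (X : sciSpace K) (B : nat -> forall r, set (X r)) r (x : X r) :
    (forall k, inrange k -> B k r x) -> in_scale B p r x.
  by rewrite /inrange; case: (p) => [j|] h; [exact: h|move=> k; exact: h].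
have base0C x : conf0 x -> [/\ dom H 2 (cf_r x) (cf_g x),
      dom H 2 (cf_r x) (Hmap (cf_f x)),
      nrm H 2 (cf_r x) (cf_g x) <= C * cf_t x `^ (-1 + e) &
      nrm H 2 (cf_r x) (Hmap (cf_f x)) <= C * cf_t x `^ (-1 + e)].
  move=> /D0P[d1 d2 h1 h2]; split=> //.
    by apply: (le_trans h1); rewrite ler_wpM2r ?powR_ge0// /C; lra.
  by apply: (le_trans h2); rewrite ler_wpM2r ?powR_ge0// /C; lra.
have base1C x : conf0 x -> conf1 x -> [/\ forall j, G0 j (cf_r1 x) (cf_chi x),
      nrm W 1 (cf_r1 x) (cf_chi x) <= C * cf_t x `^ (-1 + e),
      dom W 1 (cf_r1 x) (cf_chiH x) &
      nrm W 1 (cf_r1 x) (cf_chiH x) <= C * cf_t x `^ (-1 + e)].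
  move=> x0 /(D1P _ x0)[d1 h1 d2 h2]; split=> //.
    by apply: (le_trans h1); rewrite ler_wpM2r ?powR_ge0// /C; lra.
  by apply: (le_trans h2); rewrite ler_wpM2r ?powR_ge0// /C; lra.
have base2C x : conf0 x -> conf1 x -> conf2 x ->
  [/\ nrm T (2 * l - 1) (cf_r' x) (cf_f' x) <=
        C * (nrm T (2 * l - 1) (cf_r x) (cf_f x) + cf_t x `^ (Ae + B0 + e)),
      nrm T l (cf_r' x) (cf_f' x - res T (cf_r x) (cf_r' x) (cf_f x)) <=
        C * cf_t x `^ (- 2^-1) &
      nrm T l (cf_r' x) (zeta pi (cf_f' x)) <= C * cf_t x `^ (- (q + e))].
  move=> x0 x1 /(D2P _ x0 x1)[h1 h2 h3]; split.
  - apply: (le_trans h1); rewrite ler_wpM2r//; last by rewrite /C; lra.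
    have [ar _ xS _] := x0.
    have r01 := rad01 (I := unit) a01 (fun=> ar) tt.
    by rewrite addr_ge0 ?powR_ge0// nrm_ge0//; exact: (sub_dom S r01 _ xS).
  - by apply: (le_trans h2); rewrite ler_wpM2r ?powR_ge0// /C; lra.
  - by apply: (le_trans h3); rewrite ler_wpM2r ?powR_ge0// /C; lra.
have inv := invariant_all R01 a0R t01 q1 qA t02 (ltW C0) lam1 lam2 lam3
  t0e base0C base1C base2C (rS l rl) (ltW f1) (ltW fz).
have okG d : step_ok t0 f d /\ (nrm W 1 (rm R d) (chseq t0 f d) <= kap * 2^-1 ^+ d /\
    forall j, G0 j (rm R d) (chseq t0 f d)).
  exact: (invariant_ok R01 a0R t01 q1 t02 (ltW C0) lam1 lam2 base0C base1C (inv d)).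
have ok d : step_ok t0 f d by case: (okG d).
have chG j d : G0 j (rm R d) (chseq t0 f d) by have [_ []] := okG d.
have ch_small d : nrm W 1 (rm R d) (chseq t0 f d) <= kap * 2^-1 ^+ d.
  by have [_ []] := okG d.
have gd k : (l <= k)%N -> inrange k -> good (fseq t0 f) (chseq t0 f) k.
  move=> lk rk; apply: regular_good => //; exact: rS.
have gl : good (fseq t0 f) (chseq t0 f) l by exact: gd.
have df d : dom T l (rr R d) (fseq t0 f d) by have [_ _ h _] := gl.
have rd d := rr01 R01 d.
have gal : (agamma A <= l)%N by move: lm; rewrite /m /m1 /ga; natlia.
have [|psi [fi [psiG psish psiE fiP]]] := GL (fseq t0 f) (chseq t0 f) chG ch_small
    _ (fun d => erefl) l gl gal.
  by move=> d; exact: (dom_leq (rd d) (leq0n l)).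
have i1 := rinf01 R01; have /andP[i0 ile1] := i1; have h1 := half_bound R01.
have /andP[h0 _] := h1; have /andP[R0 R1] := R01.
have ir d : rinf R <= rr R d by exact: le_trans (rinf_rho R01 _) (rho_rr0 R01 d).
have iR : rinf R <= R by rewrite -[leRHS](rr0 R).
have sgi := sigma_rinf R01; have hs := half_sigma R01.
have sg1 := sigma01 R01; have /andP[sg0 sgle1] := sg1.
have hi : R / 2 <= rinf R by exact: le_trans (ltW hs) (ltW sgi).
have [dfi fi_lim] := fiP l gl.
(* zeta(fi) = zeta(fi - f_d) + zeta(f_d) after restriction: the first term tends to 0 by
   [zeta_bound] applied to the difference, the second by the decay of the iteration. *)
have z0 : zeta pi fi = 0.
  apply: (nrm_eq0 i1 (k := l)); first exact: dom_zeta.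
  pose fr d := res T (rr R d) (rinf R) (fseq t0 f d).
  have dfr d : dom T l (rinf R) (fr d) by apply: dom_res => //; case/andP: (rd d).
  have ddf d : dom T l (rinf R) (fr d - fi) by exact: dom_B.
  have [P PP] := zeta_bound (k := l) ltac:(natlia).
  have [E E0 EP] := rp_bounded P (2 + nrm T l (rinf R) fi) h1.
  have zle d : nrm T l (rinf R) (zeta pi (fr d - fi)) <= E * nrm T l (rinf R) (fr d - fi).
    have [_ /le_trans] := PP _ _ i1 (ddf d); apply; rewrite mulrC ler_wpM2r ?nrm_ge0//.
    have hl : ((l + 1) %/ 2 <= l)%N by natlia.
    have tB i : 0 <= tnth [tuple nrm T ((l + 1) %/ 2)%N (rinf R) (fr d - fi)] i <=
        2 + nrm T l (rinf R) fi.
      rewrite (ord1 i) tnth0 nrm_ge0//=; last exact: dom_leq (ddf d).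
      apply: (le_trans (nrm_leq i1 hl (ddf d))); apply: (le_trans (nrm_B i1 (dfr d) dfi)).
      rewrite lerD2r; apply: (@le_trans _ _ (nrm T l (rr R d) (fseq t0 f d))).
        by apply: nrm_res => //; case/andP: (rd d).
      have [_ /le_trans + _ _] := inv d; apply.
      by rewrite gerBl ltW// pow2V_gt0.
    by have /andP[_] := EP _ _ (rinf_bound R01) tB.
  have dz := dom_zeta i1 dfi.
  apply/eqP; rewrite eq_le nrm_ge0// andbT.
  apply: (@cvg0_ge_le _ _ _ (fun d => E * nrm T l (rinf R) (fr d - fi) +
    nrm T l (rr R d) (zeta pi (fseq t0 f d)))).
    move=> d; rewrite addr0.
    have dzr : dom T l (rinf R) (zeta pi (fr d)) by exact: dom_zeta.
    apply: (le_trans (nrm_tri i1 dz dzr)); apply: lerD.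
      by rewrite nrm_BC// -zetaB.
    have /andP[_ rd1] := rd d.
    have d0f : dom T 0 (rr R d) (fseq t0 f d) by exact: (dom_leq (rd d) (leq0n l)).
    rewrite /fr res_zeta//; apply: nrm_res => //.
    exact: (dom_zeta (rd d) (df d)).
  rewrite -[X in _ --> X](addr0 0); apply: cvgD.
    by rewrite -(mulr0 E); exact: cvgMr.
  exact: zeta_fseq_cvg0.
have [piF _ piR] := pi_proj.
have piE : pi (rinf R) fi = fi by apply/esym/eqP; rewrite -subr_eq0; apply/eqP.
(* No estimate is made below level l; these levels are inherited from l by inclusion. *)
have rangeP k : inrange k -> G0 k (sigma R) psi /\ dom T k (rinf R) fi.
  move=> rk; have [lk|/ltnW kl] := leqP l k.
    by split; [apply: psiG|apply: (fiP k _).1]; exact: gd.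
  by split; [exact: (sub_incl G0 sg1 kl _ (psiG _ gl))|exact: dom_leq dfi].
exists (sigma R), psi; split=> //.
- by rewrite ltW//= (le_trans (ltW sgi)).
- by apply: scaleP => k /rangeP[].
- apply: scaleP => k /rangeP[h _].
  by apply: (sub_res G0) h => //; exact: ltW.
have dfR : dom T 0 R f by exact: (dom_leq R01 (leq0n _) (sub_dom S R01 _ (rS l rl))).
have E : act A (sigma R) (R / 2) psi (res T R (sigma R) f) = res T (rinf R) (R / 2) fi.
  have /andP[rr00 _] := rd 0%N.
  have rrR : rr R 0 <= R by rewrite rr0.
  have sr : sigma R <= rr R 0 by exact: le_trans (ltW sgi) (ir _).
  by rewrite -psiE /= res_comp.
(* Membership in F is read on the limit, where pi fi = fi; membership in S is read on psi . f, since
   psi preserves S. *)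
apply: scaleP => k rk; have [psik dk] := rangeP _ rk; split.
  rewrite E -piE piR//; last exact: (dom_leq i1 (leq0n k)).
  by apply: piF => //; exact: dom_res.
apply: (G0_preserves psik) psish.
have kk : (k <= 2 * k - 1)%N \/ k = 0%N by case: (k) => [|j]; [right|left; natlia].
have fSk : S k R f.
  case: kk => [h|k00]; first exact: (sub_incl S R01 h _ (rS k rk)).
  by rewrite k00; exact: (sub_incl S R01 (leq0n _) _ (rS l rl)).
apply: (sub_res S) fSk => //; exact: le_trans (ltW sgi) iR.
Qed.
End Step.

(** * Choice of the constants *)

Lemma near_infty_ge (P : nat -> Prop) : (\forall k \near \oo, P k) ->
  exists n0, forall k, (n0 <= k)%N -> P k.
Proof. by move=> [n0 _ h]; exists n0 => k; exact: h. Qed.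

Theorem theorem6p8 (K : realType) (T : sciSpace K) (F : sciSubspace T)
    (S : sciSubset T) (pi : forall (r : K), {linear T r -> T r})
    (W : sciSpace K) (G : sciGroup W) (A : sciAction G T) (G0 : sciSubset W)
    (H : sciSpace K)
    (Hmap : forall (r : K), T r -> H r) (Phi : forall (r r' : K), H r -> W r')
    (s : nat) (c delta : K)
    (pi_proj : isProj F pi)
    (zeta_bound : \forall k \near \oo, exists P : radPoly K 1,
      forall (r : K) f, 0 < r <= 1 -> dom T k r f ->
        nrm_le T k r (zeta pi f)
          (nrm T k r f * rp_eval P r [tuple nrm T ((k + 1) %/ 2)%N r f]))
    (G0_closed : closedSubgroup G G0)
    (G0_preserves : preserves A G0 S)
    (c_gt0 : 0 < c)
    (Hmap_bound : \forall k \near \oo, exists P1 P2 : radPoly K 1,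
      forall (r : K) f, 0 < r <= 1 -> S (k + s)%N r f ->
        let h := ((k + 1) %/ 2 + s)%N in
        nrm_le H k r (Hmap r f)
          (nrm T (k + s) r (zeta pi f) * rp_eval P1 r [tuple nrm T h r f] +
           nrm T (k + s) r f * nrm T h r (zeta pi f) *
             rp_eval P2 r [tuple nrm T h r f]))
    (Phi_res : forall (r r' r'' : K) g, shrinks H c 2 r g r' -> 0 < r'' -> r'' <= r' ->
      res W r' r'' (Phi r r' g) = Phi r r'' g)
    (Phi_bound : \forall k \near \oo, exists P : radPoly K 1,
      forall (r r' : K) g, dom H (k + s) r g -> shrinks H c 2 r g r' ->
        G0 k r' (Phi r r' g) /\
        nrm_le W k r' (Phi r r' g)
          (nrm H (k + s) r g *
             rp_eval P r [tuple nrm H ((k + 1) %/ 2 + s)%N r g]))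
    (Phi_diff : \forall k \near \oo, exists P P2 : radPoly K 2,
      rp_mindeg 2 P2 /\
      forall (r r1 r' : K) f g1 g2, S (k + s)%N r f ->
        dom H (k + s) r g1 -> dom H (k + s) r g2 ->
        shrinks H c 2 r g1 r1 -> shrinks H c 2 r g2 r1 ->
        shrinks W (acst A) 1 r1 (Phi r r1 g1) r' ->
        shrinks W (acst A) 1 r1 (Phi r r1 g2) r' ->
        let x := [tuple nrm H (k + s) r g1; nrm H (k + s) r g2] in
        nrm_le T k r'
          (act A r1 r' (Phi r r1 g1) (res T r r1 f) -
           act A r1 r' (Phi r r1 g2) (res T r r1 f))
          (nrm H (k + s) r (g1 - g2) * nrm T (k + s) r f * rp_eval P r x +
           nrm T (k + s) r f * rp_eval P2 r x))
    (delta_gt0 : 0 < delta)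
    (zeta_quad : exists tau : nat, \forall k \near \oo, exists Q : radPoly K 4,
      rp_deg1_le tau Q /\
      forall (r0 r r' : K) (f0 : T r0), S (k + s)%N r0 f0 ->
        shrinks H c 2 r0 (Hmap r0 f0) r ->
        let f := res T r0 r f0 in
        let chi := Phi r0 r (Hmap r0 f0) in
        dom W (k + s) r chi ->
        shrinks W c 1 r chi r' -> shrinks W (acst A) 1 r chi r' ->
        nrm_le T k r' (zeta pi (act A r r' chi f))
          (nrm T (k + s) r (zeta pi f) `^ (1 + delta) *
           rp_eval Q r [tuple nrm T (k + s) r f; nrm W (k + s) r chi;
                              nrm T (k + s) r (zeta pi f); nrm T k r f])) :
  forall R : K, 0 < R <= 1 ->
  exists (l : nat) (alpha beta : K), [/\ (0 < l)%N, 0 < alpha, 0 < beta &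
    forall (p : option nat) (f : T R), lvl_le l p ->
      in_scale S (omap (fun q => 2 * q - 1)%N p) R f ->
      nrm T (2 * l - 1) R f < alpha -> nrm T l R (zeta pi f) < beta ->
      exists r (psi : W r),
        [/\ R / 2 <= r <= R, in_scale G0 p r psi,
            in_scale G0 p (R / 2) (res W r (R / 2) psi),
            shrinks W (acst A) 1 r psi (R / 2) &
            in_scale (scaleI F S) p (R / 2)
              (act A r (R / 2) psi (res T R r f))]].
Proof.
move=> R R01.
have [n1 zb] := near_infty_ge zeta_bound.
have [n2 Hb] := near_infty_ge Hmap_bound.
have [n3 Pb] := near_infty_ge Phi_bound.
have [n4 Pd] := near_infty_ge Phi_diff.
have [tau /near_infty_ge[n5 zq]] := zeta_quad.
pose k0 := (n1 + n2 + n3 + n4 + n5)%N.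
have {}zb k (h : (k0 <= k)%N) := zb k ltac:(rewrite /k0 in h; natlia).
have {}Hb k (h : (k0 <= k)%N) := Hb k ltac:(rewrite /k0 in h; natlia).
have {}Pb k (h : (k0 <= k)%N) := Pb k ltac:(rewrite /k0 in h; natlia).
have {}Pd k (h : (k0 <= k)%N) := Pd k ltac:(rewrite /k0 in h; natlia).
have {}zq k (h : (k0 <= k)%N) := zq k ltac:(rewrite /k0 in h; natlia).
(* The truncation at 1 keeps q = 1 + d0/2 below 2, as [q_lin] demands. *)
pose d0 : K := Num.min delta 1.
have d00 : 0 < d0 by rewrite /d0 lt_min delta_gt0 ltr01.
have d01 : d0 <= 1 by rewrite /d0 ge_min lexx orbT.
have d0d : d0 <= delta by rewrite /d0 ge_min lexx.
(* Then (tau + 8) e = d0/2 = q - 1, which covers the losses in [q_quad] and [q_lin]. *)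
pose e : K := d0 / (2 * (tau%:R + 8)).
have tau0 : 0 <= tau%:R :> K by rewrite ler0n.
have tau8 : 0 < 2 * (tau%:R + 8) :> K by rewrite mulr_gt0// ltr_wpDl.
have e0 : 0 < e by rewrite divr_gt0.
have te0 : 0 <= tau%:R * e by rewrite mulr_ge0// ltW.
have eE : 2 * (tau%:R * e) + 16 * e = d0.
  by rewrite -[RHS](divfK (lt0r_neq0 tau8)) -/e; ring.
pose q : K := 1 + d0 / 2.
pose ga := agamma A.
pose m := (ga + 3 * s + 3 + s + 1)%N.
pose B0 : K := (2 + ga + 3 * s)%:R.
have B00 : 0 <= B0 by rewrite ler0n.
(* Makes (q-1) Ae = B0 + 1, which exceeds the loss B0 + e + 1/2 of one step. *)
pose Ae : K := 2 * (B0 + 1) / d0.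
have AeE : Ae * d0 = 2 * (B0 + 1) by rewrite /Ae divfK// gt_eqF.
have Ae0 : 0 <= Ae by rewrite divr_ge0 ?(ltW d00)// mulr_ge0// addr_ge0.
pose N := Num.bound ((Ae + 1) * m%:R / e).
have NP : (Ae + 1) * m%:R <= e * N%:R.
  rewrite mulrC [leRHS]mulrC -ler_pdivrMr// [m%:R * _]mulrC ltW// archi_boundP//.
  by rewrite divr_ge0 ?(ltW e0)// mulr_ge0// addr_ge0.
(* A sum, so that every lower bound on the level holds at once; all its terms are fixed before l. *)
pose l := (N + m + 1 + (2 * m + 2) + (k0 + 2 * s + 2) +
  Num.bound (Ae + (3 * s + 4)%:R))%N.
have lA : Ae + (3 * s + 4)%:R <= l%:R.
  apply: (@le_trans _ _ (Num.bound (Ae + (3 * s + 4)%:R))%:R).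
    by rewrite ltW// archi_boundP// addr_ge0.
  by rewrite ler_nat /l leq_addl.
have lN : (N + m + 1 <= l)%N by rewrite /l; natlia.
have lm : (2 * m + 2 <= l)%N by rewrite /l; natlia.
have lk0 : (k0 + 2 * s + 2 <= l)%N by rewrite /l; natlia.
have e4 : e <= 4^-1 by move: te0 eE d01; lra.
have q_quad : q + e + tau%:R * e <= (1 + delta) * (1 - e).
  apply: (@le_trans _ _ ((1 + d0) * (1 - e))).
    have d0e : d0 * e <= e by rewrite ler_piMl// ltW.
    by rewrite /q; move: te0 eE e0 d0e; lra.
  by rewrite ler_wpM2r ?lerD2l// subr_ge0; move: e4; lra.
have q0 : 0 <= q by rewrite /q; move: d00; lra.
have q_lin : q + e <= 2 - 3 * e by rewrite /q; move: te0 eE e0 d01; lra.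
have q1 : 1 < q by rewrite /q; move: d00; lra.
have qA : Ae + B0 + e + 2^-1 <= q * Ae.
  by rewrite /q mulrDl mul1r mulrAC [d0 * Ae]mulrC AeE; move: e4; lra.
have [beta beta0 betaP] := normal_form_iteration pi_proj zb Hb Pb Pd
  delta_gt0 G0_preserves c_gt0 zq e0 e4 Ae0 (half_bound R01) NP lN lm lk0 lA
  q_quad q0 q_lin G0_closed R01 erefl q1 qA.
by exists l, 1, beta; split=> //; rewrite /l; natlia.
Qed.
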